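(* Let $\epsilon>0$ and $\kappa\in\mathbb{R}$, and consider an FLRW spacetime with spatial curvature $\kappa$ whose scale factor $a$ is smooth and positive for $t>0$ and, near the singularity $t_0=0$, has the form $a(t)=-t^{1/\epsilon}\log(t)$ (for $0<t<\delta$, some $\delta\in(0,1)$). Assume that one of the following holds: (i) $0<\epsilon<1$ and $\kappa>0$; (ii) $\epsilon\ge1$ or $\kappa=0$. Then for every $C>0$ there is $t_1>0$ such that $$\lim_{t\to 0^+}\int_{t}^{t_1}a(t')\int_{t'}^{t_1}\frac{1}{a}\left[\frac{\ddot a}{a}-\frac{\dot a^{2}}{a^{2}}-\frac{\kappa}{a^{2}}\right]dt''\,dt'=-\infty \qquad\text{and}\qquad \lim_{t\to 0^+}\int_{t}^{t_1}f_+\,dt'\in\mathbb{R}_{\ge0},$$ where $f=3\ddot a+\frac{2C}{a}\left[\frac{\ddot a}{a}-\frac{\dot a^{2}}{a^{2}}-\frac{\kappa}{a^{2}}\right]$ and $f_+=\max(f,0)$. Consequently, every point $\gamma(\tau(t_2))$, $t_2>0$, on every non-comoving, non-spacelike geodesic $\gamma$ of the spacetime is conjugate, in the generalized sense defined in the context, to a point $\gamma(\tau(t'))$ with $0\le t'<t_2$.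
   Context: FLRW spacetime: the metric is, in spherical coordinates, $$ds^2=-dt^2+a(t)^2\left[\frac{dr^2}{1-\kappa r^2}+r^2\left(d\theta^2+\sin^2\theta\,d\varphi^2\right)\right],$$ i.e. $-dt^2+a(t)^2h$ with $h$ a Riemannian metric of constant curvature $\kappa$ on a three-dimensional space. Dots on $a$ denote $d/dt$. The time $t_0=0$, where $a$ vanishes (as a limit), is the singularity, where the metric degenerates. The scale factor is normalized to equal $1$ at some time. Geodesics: a geodesic $\gamma(\tau)$, with $\tau$ an affine parameter (proper time in the timelike case), satisfies $$\frac{dt}{d\tau}=\frac{\sqrt{C-\epsilon_{\mathrm n}a^2}}{a},$$ with $\epsilon_{\mathrm n}=g(\dot\gamma,\dot\gamma)$ equal to $0$ for null geodesics and $-1$ for timelike geodesics. Here $C\ge 0$ is the constant equal to $a^2 g_{ij}\dot\gamma^i\dot\gamma^j$ (spatial indices $i,j$). The geodesic is non-comoving if $C>0$; it can then be parametrized by $t$ and is taken to be defined for all $t$ from the singularity $t_0=0$ (excluded) up to and including the times considered. Curvature convention: $R(X,Y)Z=\nabla_X\nabla_YZ-\nabla_Y\nabla_XZ-\nabla_{[X,Y]}Z$. A Jacobi field along $\gamma$ is a vector field $J$ with $D_\tau^2J+R(J,\dot\gamma)\dot\gamma=0$, where $D_\tau$ is covariant differentiation along $\gamma$. Jacobi tensor based at $\gamma(\tau_2)$, where $\tau_2=\tau(t_2)$: - Timelike case: let $\{E_0=\dot\gamma,E_1,E_2,E_3\}$ be a parallel orthonormal frame along $\gamma$, and let $J_i$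 ($i=1,2,3$) be the Jacobi field with $J_i(\tau_2)=0$ and $D_\tau J_i(\tau_2)=E_i(\tau_2)$. Let $A(\tau)$ be the $3\times3$ matrix with entries $A^k{}_l=(J_l)^k$, the components in the frame $E_1,E_2,E_3$. - Null case: let $N(\gamma)$ be the bundle of vectors along $\gamma$ orthogonal to $\dot\gamma$ and let $\bar N(\gamma)=N(\gamma)/\langle\dot\gamma\rangle$ (rank 2), with the induced covariant derivative and the induced endomorphism $\bar R_\gamma(\bar v)=\overline{R(v,\dot\gamma)\dot\gamma}$. Let $\bar A(\tau)$ be the endomorphism field of $\bar N(\gamma)$ with $D_\tau^2\bar A+\bar R_\gamma\bar A=0$, $\bar A(\tau_2)=0$, $D_\tau\bar A(\tau_2)=I$; it is a $2\times2$ matrix in a parallel frame. Generalized conjugate points: for $t'>0$, $t'\ne t_2$, the point $\gamma(\tau(t'))$ is conjugate to $\gamma(\tau(t_2))$ if $\det A=0$ (respectively $\det\bar A=0$ in the null case) at $t'$. For $t'=0$ (the singularity), $\gamma(\tau(t_2))$ is said to be conjugate to the point of $\gamma$ at $t_0=0$ if $\det A(\tau(t))\to0$ (respectively $\det\bar A(\tau(t))\to0$) as $t\to0^+$. *)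

(* Defs.v *)
From HB Require Import structures.
From mathcomp Require Import all_boot all_order all_algebra.
From mathcomp Require Import all_classical all_reals all_analysis.
Set Implicit Arguments.
Unset Strict Implicit.
Unset Printing Implicit Defensive.
Import Order.TTheory GRing.Theory Num.Theory.
Import numFieldNormedType.Exports.
Local Open Scope classical_set_scope.
Local Open Scope ring_scope.

(* C^oo on an open set of the line, for functions into a normed module *)
Definition smooth1 (R : realType) (V : normedModType R) (D : set R)
    (f : R -> V) :=
  forall (k : nat) (x : R), D x -> derivable (derive1n k f) x 1.

Section LocalGeometry.
Variables (R : realType) (n : nat).

Definition partial (k : 'I_n) (f : 'rV[R]_n -> R) (x : 'rV[R]_n) : R :=
  'D_(delta_mx 0 k) f x.

(* C^oo on an open set U: every iterated partial derivative is (Frechet)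
   differentiable at every point of U *)
Definition smooth (U : set 'rV[R]_n) (f : 'rV[R]_n -> R) :=
  forall (s : seq 'I_n) (x : 'rV[R]_n), U x -> differentiable (foldr partial f s) x.

(* A metric in local coordinates is a matrix-valued function of the
   coordinates; tangent vectors are row vectors of components. *)
Variable g : 'rV[R]_n -> 'M[R]_n.

Definition inner (x u v : 'rV[R]_n) : R := (u *m g x *m v^T) 0 0.

Definition christoffel (i j k : 'I_n) (x : 'rV[R]_n) : R :=
  2^-1 * \sum_l invmx (g x) i l *
    (partial j (fun y => g y l k) x + partial k (fun y => g y l j) x
     - partial l (fun y => g y j k) x).

Definition christoffel_vec (x u v : 'rV[R]_n) : 'rV[R]_n :=
  \row_i \sum_j \sum_k christoffel i j k x * u 0 j * v 0 k.

(* R^i_{jkl}, normalized by R(d_k, d_l) d_j = \sum_i R^i_{jkl} d_i with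
   R(X, Y) Z = nabla_X nabla_Y Z - nabla_Y nabla_X Z - nabla_[X, Y] Z *)
Definition riemann (i j k l : 'I_n) (x : 'rV[R]_n) : R :=
  partial k (christoffel i l j) x - partial l (christoffel i k j) x
  + \sum_m (christoffel i k m x * christoffel m l j x
            - christoffel i l m x * christoffel m k j x).

(* R(u, v) w *)
Definition curvature (x u v w : 'rV[R]_n) : 'rV[R]_n :=
  \row_i \sum_j \sum_k \sum_l riemann i j k l x * w 0 j * u 0 k * v 0 l.

Definition plane_area2 (x u v : 'rV[R]_n) : R :=
  inner x u u * inner x v v - inner x u v ^+ 2.

Definition sectional_curvature (x u v : 'rV[R]_n) : R :=
  inner x (curvature x u v v) u / plane_area2 x u v.

End LocalGeometry.

(* The data of an n-manifold with a metric tensor: for each index i the chart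
   chart i with domain dom i and inverse param i, and the matrix metric i of the
   metric in this chart, as a function of the coordinates.  Values outside the
   domains are irrelevant. *)
Record metric_atlas (R : realType) (n : nat) (M : Type) := MetricAtlas {
  chart_index : Type ;
  dom : chart_index -> set M ;
  chart : chart_index -> M -> 'rV[R]_n ;
  param : chart_index -> 'rV[R]_n -> M ;
  metric : chart_index -> 'rV[R]_n -> 'M[R]_n }.

Section Manifold.
Variables (R : realType) (n : nat) (M : topologicalType).
Variable A : metric_atlas R n M.

Definition overlap (i j : chart_index A) : set 'rV[R]_n :=
  chart i @` (dom i `&` dom j).

Definition transition (i j : chart_index A) (x : 'rV[R]_n) : 'rV[R]_n :=
  chart j (param i x).

Definition smooth_manifold :=
  [/\ hausdorff_space M, @second_countable M,
      (forall p, exists i : chart_index A, dom i p),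
      (forall i : chart_index A,
        [/\ open (dom i), open (chart i @` dom i),
            (forall p, dom i p -> param i (chart i p) = p),
            (forall p, dom i p -> {for p, continuous (chart i)}) &
            (forall x, (chart i @` dom i) x -> {for x, continuous (param i)})]) &
      (forall (i j : chart_index A) (k : 'I_n),
        smooth (overlap i j) (fun x => transition i j x 0 k))].

(* With row vectors of components, u in chart i becomes
   u *m 'J (transition i j) in chart j. *)
Definition riemannian_metric :=
  [/\ (forall (i : chart_index A) (k l : 'I_n),
        smooth (chart i @` dom i) (fun x => metric i x k l)),
      (forall (i : chart_index A) x, (chart i @` dom i) x ->
        (metric i x)^T = metric i x /\
        forall u, u != 0 -> 0 < inner (metric i) x u u) &
      (forall (i j : chart_index A) p, dom i p -> dom j p ->
        let J := 'J (transition i j) (chart i p) in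
        metric i (chart i p) = J *m metric j (chart j p) *m J^T)].

Definition constant_curvature (kappa : R) :=
  forall (i : chart_index A) x, (chart i @` dom i) x ->
  forall u v, plane_area2 (metric i) x u v != 0 ->
    sectional_curvature (metric i) x u v = kappa.

(* Curves and vector fields along them, on a parameter interval D.  A vector
   field along gamma is given by its components in every chart: V i s is
   meaningful only when gamma s lies in the domain of chart i. *)
Variables (D : set R) (gamma : R -> M).

Definition vfield := chart_index A -> R -> 'rV[R]_n.

Definition smooth_curve :=
  [/\ open D, is_interval D,
      (forall s, D s -> exists i : chart_index A, dom i (gamma s)),
      (forall s, D s -> {for s, continuous gamma}) &
      (forall i : chart_index A, smooth1 (D `&` gamma @^-1` dom i) (chart i \o gamma))].

Definition smooth_vfield (V : vfield) :=
  (forall i, smooth1 (D `&` gamma @^-1` dom i) (V i)) /\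
  (forall i j s, D s -> dom i (gamma s) -> dom j (gamma s) ->
    V j s = V i s *m 'J (transition i j) (chart i (gamma s))).

Definition velocity : vfield := fun i => derive1 (chart i \o gamma).

Definition covD (V : vfield) : vfield := fun i s =>
  derive1 (V i) s + christoffel_vec (metric i) (chart i (gamma s)) (velocity i s) (V i s).

Definition inner_along (i : chart_index A) (s : R) (u v : 'rV[R]_n) : R :=
  inner (metric i) (chart i (gamma s)) u v.

(* R(V, gamma') gamma' *)
Definition tidal (V : vfield) : vfield := fun i s =>
  curvature (metric i) (chart i (gamma s)) (V i s) (velocity i s) (velocity i s).

Definition geodesic :=
  smooth_curve /\
  forall i s, D s -> dom i (gamma s) -> covD velocity i s = 0.

Definition jacobi_field (V : vfield) :=
  smooth_vfield V /\
  forall i s, D s -> dom i (gamma s) -> covD (covD V) i s + tidal V i s = 0.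

End Manifold.

Section Spacetime.
Variables (R : realType) (Sigma : topologicalType).
Variables (a : R -> R) (h : metric_atlas R 3 Sigma).

(* ]0, +oo[ x Sigma with the metric - dt^2 + a(t)^2 h; coordinate 0 is t *)
Definition flrw_atlas : metric_atlas R (1 + 3) (R * Sigma)%type :=
  @MetricAtlas R (1 + 3) (R * Sigma)%type (chart_index h)
    (fun i => [set p | 0 < p.1 /\ dom i p.2])
    (fun i p => row_mx (p.1)%:M (chart i p.2))
    (fun i x => (lsubmx x 0 0, param i (rsubmx x)))
    (fun i x => block_mx (- 1)%:M 0
                         0 ((a (lsubmx x 0 0)) ^+ 2 *: metric i (rsubmx x))).

Definition flrw (kappa : R) :=
  [/\ smooth_manifold h, riemannian_metric h, constant_curvature h kappa,
      smooth1 `]0, +oo[ a &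
      (forall t, 0 < t -> 0 < a t) /\ (exists2 t, 0 < t & a t = 1)].

Section AlongGeodesic.
Variables (D : set R) (gamma : R -> R * Sigma).

Local Notation A := flrw_atlas.
Local Notation vel := (velocity (A := A) gamma).
Local Notation ip := (inner_along (A := A) gamma).
Local Notation D_tau := (covD (A := A) gamma).
Local Notation at_chart i s := (D s /\ dom (i : chart_index A) (gamma s)).

(* \sum_(i, j) g_ij u^i v^j over spatial indices *)
Definition spatial_inner (i : chart_index A) (s : R) (u v : 'rV[R]_(1 + 3)) : R :=
  \sum_(j < 3) \sum_(k < 3)
    metric i (chart i (gamma s)) (rshift 1 j) (rshift 1 k)
    * u 0 (rshift 1 j) * v 0 (rshift 1 k).

(* Future-directed affinely parametrized geodesic with g(gamma', gamma') = epsn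
   and constant C *)
Definition flrw_geodesic (epsn C : R) :=
  [/\ geodesic A D gamma,
      (forall i s, at_chart i s -> ip i s (vel i s) (vel i s) = epsn),
      (forall i s, at_chart i s ->
        (a (gamma s).1) ^+ 2 * spatial_inner i s (vel i s) (vel i s) = C) &
      (forall s, D s ->
        derive1 (fun r => (gamma r).1) s
        = Num.sqrt (C - epsn * (a (gamma s).1) ^+ 2) / a (gamma s).1)].

(* tau inverts the time coordinate along gamma on ]0, t2]; in particular gamma is
   defined from the singularity up to and including t2 *)
Definition time_parametrization (tau : R -> R) (t2 : R) :=
  forall t, 0 < t <= t2 -> D (tau t) /\ (gamma (tau t)).1 = t.

Definition minkowski_form (k l : 'I_4) : R :=
  if k != l then 0 else if k == ord0 then -1 else 1.

Definition parallel_orthonormal_frame (E : 'I_4 -> vfield A) :=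
  [/\ (forall k, smooth_vfield D gamma (E k)),
      (forall i s, at_chart i s -> E ord0 i s = vel i s),
      (forall k l i s, at_chart i s -> ip i s (E k i s) (E l i s) = minkowski_form k l) &
      (forall k i s, at_chart i s -> D_tau (E k) i s = 0)].

(* B is the matrix A^k_l of the components along E_1, E_2, E_3 of the Jacobi
   fields J_1, J_2, J_3 based at gamma s2; b l is the component of J_l along E_0 *)
Definition timelike_jacobi_tensor (s2 : R) (B : R -> 'M[R]_3) :=
  exists (E : 'I_4 -> vfield A) (J : 'I_3 -> vfield A) (b : 'I_3 -> R -> R),
  [/\ parallel_orthonormal_frame E,
      (forall l, jacobi_field D gamma (J l)),
      (forall l i, dom i (gamma s2) ->
        J l i s2 = 0 /\ D_tau (J l) i s2 = E (lift ord0 l) i s2) &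
      (forall l i s, at_chart i s ->
        J l i s = b l s *: E ord0 i s + \sum_(k < 3) B s k l *: E (lift ord0 k) i s)].

(* E_1, E_2 are orthogonal to gamma', their classes form a basis of the quotient
   of the orthogonal of gamma' by gamma', and these classes are parallel *)
Definition parallel_quotient_frame (E : 'I_2 -> vfield A) :=
  [/\ (forall k, smooth_vfield D gamma (E k)),
      (forall k i s, at_chart i s -> ip i s (E k i s) (vel i s) = 0),
      (forall i s, at_chart i s ->
        row_free (col_mx (vel i s) (\matrix_(k < 2) E k i s))) &
      (forall k i s, at_chart i s -> (D_tau (E k) i s <= vel i s)%MS)].

(* Rb is the matrix in the frame of the endomorphism induced on the quotient by
   v |-> R(v, gamma') gamma' *)
Definition null_jacobi_tensor (s2 : R) (B : R -> 'M[R]_2) :=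
  exists (E : 'I_2 -> vfield A) (Rb : R -> 'M[R]_2),
  [/\ parallel_quotient_frame E,
      (forall l i s, at_chart i s ->
        (tidal gamma (E l) i s - \sum_(k < 2) Rb s k l *: E k i s <= vel i s)%MS),
      smooth1 D B,
      (forall s, D s -> derive1n 2 B s + Rb s *m B s = 0) &
      B s2 = 0 /\ derive1 B s2 = 1%:M].

End AlongGeodesic.

(* t' = 0 is the singularity *)
Definition degenerate_at (n : nat) (B : R -> 'M[R]_n) (tau : R -> R) (t' : R) :=
  (0 < t' -> \det (B (tau t')) = 0) /\
  (t' = 0 -> \det (B (tau t)) @[t --> 0^'+] --> (0 : R)).

(* gamma (tau t2) is conjugate to the point of gamma at time t', for a timelike
   (epsn = -1) or null (epsn = 0) geodesic.  The Jacobi tensor based at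
   gamma (tau t2) exists and is determined by the choice of a parallel frame, on
   which the vanishing of its determinant does not depend. *)
Definition conjugate (D : set R) (gamma : R -> R * Sigma) (epsn : R) (tau : R -> R)
    (t2 t' : R) :=
  (epsn = -1 -> forall B, timelike_jacobi_tensor D gamma (tau t2) B ->
     degenerate_at B tau t') /\
  (epsn = 0 -> forall B, null_jacobi_tensor D gamma (tau t2) B ->
     degenerate_at B tau t').

(* (1 / a) (a'' / a - a'^2 / a^2 - kappa / a^2) *)
Definition bracket (kappa t : R) : R :=
  (a t)^-1 * (derive1n 2 a t / a t - derive1 a t ^+ 2 / a t ^+ 2 - kappa / a t ^+ 2).

Definition f_fun (kappa C t : R) : R :=
  3 * derive1n 2 a t + 2 * C * bracket kappa t.

End Spacetime.

(* Main.v *)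
Require Import Defs.
From HB Require Import structures.
From mathcomp Require Import all_boot all_order all_algebra.
From mathcomp Require Import all_classical all_reals all_analysis.
From mathcomp Require Import ring lra.
Import Order.TTheory GRing.Theory Num.Theory.
Import numFieldNormedType.Exports.
Local Open Scope classical_set_scope.
Local Open Scope ring_scope.

(* Every geodesic point is conjugate to the singularity itself (t' = 0): the
   determinant of the Jacobi tensor always tends to 0 there.  By isotropy the
   Jacobi operator of a non-comoving geodesic has at most two eigenvalues.  In
   the directions orthogonal to the plane of the time direction and the
   velocity, a solution is y = a q, where q solves q'' = - kappa q in the
   comoving distance chi, dchi = sqrt C / a^2 dtau.  For kappa > 0 the function
   q is bounded; for kappa = 0 it is affine in chi, and a chi -> 0 because a is
   increasing near 0; for eps >= 1 it grows at most like a power of - log t,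
   since chi = O(log (- log t)).  Hence y -> 0 with a in all cases.  In the
   timelike case the remaining, radial, direction of the plane satisfies
   y'' = (a''/a) y, of which sqrt (C + a^2) is a positive solution; the
   Wronskian then shows that every solution is bounded.  So the Jacobi tensor is
   a bounded rank one matrix plus a matrix tending to 0.

   The radial direction is not constructed as a vector field: its components in
   a parallel frame E_k are c_k = a E_k^0 / sqrt C, and these are constant along
   the geodesic.

   For the integrals, the bracket is at most - c / (t^2 a) near 0, which is
   compared with the derivative of 1 / (t a); and f <= 0 near 0. *)

(** Constant curvature is assumed only for sectional curvatures, and the spacetime metric is given
    only in charts. The eigenvalues are therefore reached by polarization, which needs the pair
    symmetry of the Riemann tensor (hence the symmetry of second partials), and by computing the
    connection of - dt^2 + a^2 h in coordinates.

    The c_k are constant because a d/dt is a closed conformal field: nabla_X (a d/dt) = a' X, so g(a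
    d/dt, E_k) has derivative a' g(gamma', E_k) = 0. They form a unit vector c, a constant
    eigenvector of the Jacobi operator in the frame. Hence the matrix B of the Jacobi tensor splits
    as c y + W, with y = c . B radial and W transverse. Every term of det B - det W contains one
    entry of y and a 2x2 minor of W, so boundedness of y is enough.

    In the null case the quotient by gamma' leaves only transverse directions, and each entry solves
    the scalar transverse equation.

    The affine parameter is eliminated by sqrt C <= a dt/dtau, that is, dchi <= dt / a; every
    estimate is then an estimate in t. *)

Set Implicit Arguments.
Unset Strict Implicit.
Unset Printing Implicit Defensive.

(** * Rules for directional derivatives and differentiability at a point *)

Section PointwiseDerivatives.
Variables (R : realType) (V : normedModType R).
Implicit Types (f g : V -> R) (x v : V).

Lemma is_derive_add f g x v df dg : is_derive x v f df -> is_derive x v g dg ->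
  is_derive x v (fun y => f y + g y) (df + dg).
Proof. by move=> Hf Hg; exact: is_deriveD. Qed.

Lemma is_derive_opp f x v df : is_derive x v f df ->
  is_derive x v (fun y => - f y) (- df).
Proof. by move=> Hf; exact: is_deriveN. Qed.

Lemma is_derive_sub f g x v df dg : is_derive x v f df -> is_derive x v g dg ->
  is_derive x v (fun y => f y - g y) (df - dg).
Proof. by move=> Hf Hg; exact: is_deriveB. Qed.

Lemma is_derive_mul f g x v df dg : is_derive x v f df -> is_derive x v g dg ->
  is_derive x v (fun y => f y * g y) (df * g x + f x * dg).
Proof.
move=> Hf Hg; have H := is_deriveM Hf Hg.
apply: (is_derive_eq H); by rewrite addrC [_ *: df]mulrC.
Qed.

Lemma is_derive_const (c : R) x v : is_derive x v (fun=> c) 0.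
Proof. exact: is_derive_cst. Qed.

Lemma is_derive_scale (c : R) f x v df : is_derive x v f df ->
  is_derive x v (fun y => c * f y) (c * df).
Proof.
move=> Hf; have H := is_derive_mul (is_derive_const c x v) Hf.
apply: (is_derive_eq H); by rewrite mul0r add0r.
Qed.

Lemma is_derive_inv f x v df : f x != 0 -> is_derive x v f df ->
  is_derive x v (fun y => (f y)^-1) (- df / f x ^+ 2).
Proof.
move=> fx [Hf <-]; apply: DeriveDef; first exact: derivableV.
by rewrite deriveV// scaleNr mulNr; congr (- _); rewrite [RHS]mulrC.
Qed.

Lemma is_derive_exp f n x v df : is_derive x v f df ->
  is_derive x v (fun y => f y ^+ n) (n%:R * f x ^+ n.-1 * df).
Proof.
move=> Hf; have -> : (fun y => f y ^+ n) = f ^+ n by rewrite exprfctE.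
exact: is_deriveX.
Qed.

Lemma is_derive_big (I : Type) (s : seq I) (P : pred I) (F : I -> V -> R)
    (dF : I -> R) x v : (forall i, is_derive x v (F i) (dF i)) ->
  is_derive x v (fun y => \sum_(i <- s | P i) F i y) (\sum_(i <- s | P i) dF i).
Proof.
move=> H; elim: s => [|i s IH].
  rewrite big_nil; under eq_fun do rewrite big_nil; exact: is_derive_const.
rewrite big_cons; under eq_fun do rewrite big_cons.
by case: (P i) => //; exact: is_derive_add.
Qed.

Lemma differentiable_big_sum (I : Type) (s : seq I) (P : pred I) (F : I -> V -> R) x :
  (forall i, differentiable (F i) x) ->
  differentiable (fun y => \sum_(i <- s | P i) F i y) x.
Proof.
move=> H; elim: s => [|i s IH].
  under eq_fun do rewrite big_nil; exact: differentiable_cst.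
under eq_fun do rewrite big_cons.
by case: (P i) => //; exact: differentiableD.
Qed.

Lemma differentiable_big_prod (I : Type) (s : seq I) (P : pred I) (F : I -> V -> R) x :
  (forall i, differentiable (F i) x) ->
  differentiable (fun y => \prod_(i <- s | P i) F i y) x.
Proof.
move=> H; elim: s => [|i s IH].
  under eq_fun do rewrite big_nil; exact: differentiable_cst.
under eq_fun do rewrite big_cons.
by case: (P i) => //; exact: differentiableM.
Qed.

Lemma differentiable_det n (A : V -> 'M[R]_n) x :
  (forall i j, differentiable (fun y => A y i j) x) ->
  differentiable (fun y => \det (A y)) x.
Proof.
move=> H; rewrite /determinant; apply: differentiable_big_sum => s.
apply: differentiableM; first exact: differentiable_cst.
by apply: differentiable_big_prod.
Qed.

(** The first-order expansion of [f] is also one of [g], and [diff_unique] identifies its linear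
    part as the differential. This is what allows formulas valid only inside a chart domain to be
    differentiated there. *)
Lemma differentiable_near (W : normedModType R) (f g : V -> W) x :
  (\near x, f x = g x) -> differentiable f x -> differentiable g x.
Proof.
move=> fg df.
have exp : g \o shift x = cst (g x) + 'd f x +o_ 0 id.
  apply/eqaddoP => _/posnumP[eps].
  have /eqaddoP/(_ _ (gt0 eps)) H := diff_locally df.
  have fg0 : \forall h \near 0, f (h + x) = g (h + x).
    by move: fg; rewrite (near_shift 0) => fg; near=> h; rewrite -[x in h + x](subr0 x); near: h.
  by near=> h; rewrite !fctE /= -(nbhs_singleton fg) -(near fg0 h)//; near: h.
have e := diff_unique (diff_continuous df) exp.
by apply/diff_locallyP; rewrite e; split => //; exact: diff_continuous.
Unshelve. all: by end_near. Qed.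

End PointwiseDerivatives.

(** * Symmetry of second partials and the chain rule along a curve *)

Section PartialDerivatives.
Variables (R : realType) (n : nat).
Implicit Types (f : 'rV[R]_n -> R) (x v : 'rV[R]_n) (U : set 'rV[R]_n).

Lemma is_derive_line f x v (s d : R) : is_derive (x + s *: v) v f d ->
  is_derive s (1 : R) (fun r => f (x + r *: v)) d.
Proof.
have e : (fun h : R => h^-1 *: ((f \o shift (x + s *: v)) (h *: v) - f (x + s *: v))) =
   (fun h : R => h^-1 *: (((fun r => f (x + r *: v)) \o shift s) (h *: (1 : R))
        - f (x + s *: v))).
  apply/funext => h /=; congr (_ *: (f _ - _)).
  by rewrite [h *: 1]mulr1 scalerDl addrCA.
move=> [H <-]; apply: DeriveDef.
  by move: H; rewrite /derivable e.
by rewrite /derive e.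
Qed.

Lemma derive_translate f x v w : 'D_v (fun y => f (y + w)) x = 'D_v f (x + w).
Proof.
rewrite /derive; set d := (fun h : R => _); set d' := (fun h : R => _).
suff -> : d = d' by [].
by apply/funext => h; rewrite /d /d' /= addrA.
Qed.

Lemma MVT_partial f x (j : 'I_n) (h : R) : 0 < h ->
  (forall s, 0 <= s <= h -> differentiable f (x + s *: delta_mx 0 j)) ->
  exists2 s, 0 <= s <= h &
    f (x + h *: delta_mx 0 j) - f x = h * partial j f (x + s *: delta_mx 0 j).
Proof.
move=> h0 df; set e := delta_mx 0 j in df *.
have D s : 0 <= s <= h ->
    is_derive s (1 : R) (fun r => f (x + r *: e)) (partial j f (x + s *: e)).
  by move=> /df H; apply: is_derive_line; apply/derivableP/diff_derivable.
have [||c + H] := @MVT R (fun r => f (x + r *: e)) (fun s => partial j f (x + s *: e)) 0 h h0.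
- by move=> s /itvP H; apply: D; rewrite !H.
- apply: derivable_within_continuous => s /itvP H.
  by have /D[] : 0 <= s <= h by rewrite !H.
- rewrite in_itv /= => /andP[c0 ch]; exists c; first by rewrite !ltW.
  by rewrite scale0r addr0 subr0 in H; rewrite H mulrC.
Qed.

(** The mean value theorem is applied twice: to the increment [g] of [f] along [ek], in direction
    [ej], and then to [partial j f] in direction [ek]. The left-hand side is symmetric in [j] and
    [k], which makes the two orders of differentiation comparable. *)
Lemma second_difference f x (j k : 'I_n) (h : R) U : 0 < h -> smooth U f ->
  (forall s t, 0 <= s <= h -> 0 <= t <= h ->
     U (x + s *: delta_mx 0 j + t *: delta_mx 0 k)) ->
  exists s t, [/\ 0 <= s <= h, 0 <= t <= h &
    f (x + h *: delta_mx 0 j + h *: delta_mx 0 k) - f (x + h *: delta_mx 0 j)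
    - (f (x + h *: delta_mx 0 k) - f x)
    = h * (h * partial k (partial j f) (x + s *: delta_mx 0 j + t *: delta_mx 0 k))].
Proof.
move=> h0 sf HU; set ej := delta_mx 0 j in HU *; set ek := delta_mx 0 k in HU *.
pose g y := f (y + h *: ek) - f y.
have shiftd y : differentiable (fun y => y + h *: ek) y.
  by apply: differentiableD; [exact: ex_diff|exact: differentiable_cst].
have hh : 0 <= h <= h by rewrite lexx ltW.
have zh : 0 <= (0 : R) <= h by rewrite lexx ltW.
have df0 s : 0 <= s <= h -> differentiable f (x + s *: ej).
  by move=> sh; apply: (sf [::]); have := HU s 0 sh zh; rewrite scale0r addr0.
have dfh s : 0 <= s <= h -> differentiable f (x + s *: ej + h *: ek).
  by move=> sh; apply: (sf [::]); exact: HU.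
have dgh s : 0 <= s <= h -> differentiable (fun y => f (y + h *: ek)) (x + s *: ej).
  move=> sh; apply: (@differentiable_comp _ _ _ _ (fun y => y + h *: ek) f).
    exact: shiftd.
  exact: dfh.
have [s sh E] := @MVT_partial g x j h h0 (fun s sh => differentiableB (dgh s sh) (df0 s sh)).
have Eg : partial j g (x + s *: ej) =
    partial j f (x + s *: ej + h *: ek) - partial j f (x + s *: ej).
  have d1 : derivable (fun y => f (y + h *: ek)) (x + s *: ej) ej.
    by apply: diff_derivable; exact: dgh.
  have d2 : derivable f (x + s *: ej) ej by apply: diff_derivable; exact: df0.
  rewrite /partial; have -> := deriveB d1 d2.
  by rewrite derive_translate.
have [t th E2] := @MVT_partial (partial j f) (x + s *: ej) k h h0
  (fun t th => sf [:: j] _ (HU s t sh th)).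
exists s, t; split => //.
have -> : f (x + h *: ej + h *: ek) - f (x + h *: ej) - (f (x + h *: ek) - f x) =
  g (x + h *: ej) - g x by [].
by rewrite E Eg E2.
Qed.

(** Schwarz's theorem: both mixed partials, taken at suitable points of a small box, equal the same
    double difference over h^2, and both are continuous at [x]. *)
Lemma partial_swap U f x (j k : 'I_n) : open U -> smooth U f -> U x ->
  partial j (partial k f) x = partial k (partial j f) x.
Proof.
move=> oU sf Ux; set ej := delta_mx 0 j : 'rV[R]_n; set ek := delta_mx 0 k : 'rV[R]_n.
apply/eqP; rewrite -subr_eq0 -normr_le0; apply/ler_addgt0Pl => e e0.
rewrite addr0.
have e20 : 0 < e / 2 by rewrite divr_gt0.
have cjk := differentiable_continuous (sf [:: j; k] x Ux).
have ckj := differentiable_continuous (sf [:: k; j] x Ux).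
have near1 : \forall y \near x, [/\ U y,
     `|partial j (partial k f) x - partial j (partial k f) y| < e / 2 &
     `|partial k (partial j f) x - partial k (partial j f) y| < e / 2].
  move/cvgrPdist_lt : cjk => /(_ _ e20) n1.
  move/cvgrPdist_lt : ckj => /(_ _ e20) n2.
  have n0 := open_nbhs_nbhs (conj oU Ux).
  apply: filterS3 n0 n1 n2 => y u v w; exact: And3 u v w.
move/nbhs_ballP : near1 => [d /= d0 Hd].
(* With h = d / M, every point of the box is within h (|ej| + |ek|) < d of [x]; the added 1 keeps
   [M] positive and the inequality strict. *)
pose M := `|ej| + `|ek| + 1.
have M0 : 0 < M by rewrite ltr_wpDl// addr_ge0.
pose h := d / M.
have h0 : 0 < h by rewrite divr_gt0.
have box s t : 0 <= s <= h -> 0 <= t <= h -> ball x d (x + s *: ej + t *: ek).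
  move=> /andP[s0 sh] /andP[t0 th]; rewrite -ball_normE /= -addrA opprD addNKr.
  rewrite normrN (le_lt_trans (ler_normD _ _))// !normrZ !ger0_norm//.
  rewrite (@le_lt_trans _ _ (h * (`|ej| + `|ek|)))//.
    by rewrite mulrDr lerD// ler_wpM2r.
  by rewrite /h -mulrA gtr_pMr// mulrC ltr_pdivrMr// mul1r /M ltrDl.
have [s [t [sh th E1]]] := @second_difference f x j k h U h0 sf
  (fun s t sh th => let: And3 u _ _ := Hd _ (box s t sh th) in u).
have box' s' t' : 0 <= s' <= h -> 0 <= t' <= h -> U (x + s' *: ek + t' *: ej).
  by move=> ? ?; rewrite addrAC; have [] := Hd _ (box t' s' _ _).
have [t' [s' [th' sh' E2]]] := @second_difference f x k j h U h0 sf box'.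
rewrite -/ej -/ek in E1 E2.
have [_ _ H1] := Hd _ (box s t sh th).
have [_ H2 _] := Hd _ (box s' t' sh' th').
have {E1 E2} E : partial k (partial j f) (x + s *: ej + t *: ek) =
    partial j (partial k f) (x + s' *: ej + t' *: ek).
  move: E1 E2; rewrite [x + h *: ek + h *: ej]addrAC.
  rewrite [x + t' *: ek + s' *: ej]addrAC.
  move: (f (x + h *: ej + h *: ek)) (f (x + h *: ej)) (f (x + h *: ek)) (f x).
  move: (partial k (partial j f) _) (partial j (partial k f) _) => p q c1 c2 c3 c4 E1 E2.
  have hn0 : h != 0 by rewrite gt_eqF.
  by apply: (mulfI hn0); apply: (mulfI hn0); rewrite -E1 -E2; ring.
move: H1 H2; rewrite E.
move: (partial j (partial k f) (x + s' *: ej + t' *: ek)).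
move: (partial j (partial k f) x) (partial k (partial j f) x) => p q r H1 H2.
have -> : p - q = (p - r) - (q - r) by ring.
apply: (le_trans (ler_normB _ _)); rewrite [leRHS]splitr; exact: lerD (ltW H2) (ltW H1).
Qed.

Lemma partialE k f x : partial k f x = 'D_(delta_mx 0 k) f x.
Proof. by []. Qed.

Lemma near_eq_partial k f f' x : (\near x, f x = f' x) -> partial k f x = partial k f' x.
Proof. exact: near_eq_derive. Qed.

Lemma is_derive_partial f x k : differentiable f x ->
  is_derive x (delta_mx 0 k) f (partial k f x).
Proof. by move=> df; apply/derivableP/diff_derivable. Qed.

Lemma derive_partial f x k d : is_derive x (delta_mx 0 k) f d -> partial k f x = d.
Proof. by move=> df; exact: derive_val. Qed.

Lemma is_derive_curve f (c : R -> 'rV[R]_n) (s : R) (dc : 'rV[R]_n) :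
  differentiable f (c s) -> is_derive s (1 : R) c dc ->
  is_derive s (1 : R) (f \o c) (\sum_m partial m f (c s) * dc 0 m).
Proof.
move=> df [/derivable1_diffP dcs Ec].
have dfc : differentiable (f \o c) s by exact: differentiable_comp.
apply: DeriveDef; first exact: diff_derivable.
have {}Ec : 'd c s 1 = dc by rewrite -deriveE.
rewrite deriveE// diff_comp//= Ec.
rewrite [in LHS](row_sum_delta dc) linear_sum; apply: eq_bigr => m _.
by rewrite linearZ /partial deriveE// mulrC.
Qed.

End PartialDerivatives.

(** * The Levi-Civita connection in coordinates and the pair symmetry of its curvature *)

Section MetricInCoordinates.
Variables (R : realType) (n : nat) (U : set 'rV[R]_n) (g : 'rV[R]_n -> 'M[R]_n).
Hypothesis (oU : open U) (gsmooth : forall k l, smooth U (fun x => g x k l)).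
Hypothesis gsym : forall x, U x -> (g x)^T = g x.
Hypothesis gunit : forall x, U x -> g x \in unitmx.

(** Christoffel symbols of the first kind. Curvature identities are checked with the index lowered,
    where the inverse metric does not occur. *)
Definition christoffel_lower (p j k : 'I_n) (x : 'rV[R]_n) : R :=
  2^-1 * (partial j (fun y => g y p k) x + partial k (fun y => g y p j) x
          - partial p (fun y => g y j k) x).

Local Notation Gam := (christoffel g).
Local Notation GamL := christoffel_lower.

Lemma christoffelE x i j k :
  Gam i j k x = \sum_l invmx (g x) i l * GamL l j k x.
Proof.
rewrite /christoffel mulr_sumr; apply: eq_bigr => l _.
by rewrite /christoffel_lower mulrCA.
Qed.

Lemma riemannE x i j k l : riemann g i j k l x =
  partial k (Gam i l j) x - partial l (Gam i k j) x
  + \sum_m (Gam i k m x * Gam m l j x - Gam i l m x * Gam m k j x).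
Proof. by []. Qed.

Local Opaque partial christoffel riemann.

Lemma metric_entry_sym x k l : U x -> g x k l = g x l k.
Proof. by move=> /gsym E; rewrite -[in LHS]E mxE. Qed.

Lemma near_domain x (P : 'rV[R]_n -> Prop) : U x -> (forall y, U y -> P y) ->
  \forall y \near x, P y.
Proof. by move=> Ux H; near=> y; apply: H; near: y; exact: open_nbhs_nbhs.
Unshelve. all: by end_near. Qed.

Lemma partial_metric_sym x m k l : U x ->
  partial m (fun y => g y k l) x = partial m (fun y => g y l k) x.
Proof.
move=> Ux; apply: near_eq_partial; apply: near_domain => // y Uy.
exact: metric_entry_sym.
Qed.

Lemma christoffel_lowerE x p j k : U x ->
  \sum_i g x p i * Gam i j k x = GamL p j k x.
Proof.
move=> Ux; pose c := \col_l GamL l j k x.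
transitivity ((g x *m (invmx (g x) *m c)) p 0).
  rewrite mxE; apply: eq_bigr => i _; congr (_ * _).
  by rewrite christoffelE// mxE; apply: eq_bigr => l _; rewrite mxE.
by rewrite mulKVmx ?gunit// mxE.
Qed.

Lemma christoffel_lower_sym x p j k : U x -> GamL p j k x = GamL p k j x.
Proof.
move=> Ux; rewrite /christoffel_lower (partial_metric_sym p j k)//.
by congr (_ * (_ - _)); rewrite addrC.
Qed.

Lemma christoffel_sym x i j k : U x -> Gam i j k x = Gam i k j x.
Proof.
move=> Ux; rewrite !christoffelE//; apply: eq_bigr => l _.
by rewrite christoffel_lower_sym.
Qed.

(** Metric compatibility of the connection, in coordinates. *)
Lemma partial_metric x m k l : U x ->
  partial m (fun y => g y k l) x = GamL k m l x + GamL l m k x.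
Proof.
move=> Ux; rewrite /christoffel_lower (partial_metric_sym m l k)//.
rewrite (partial_metric_sym l k m)// (partial_metric_sym k l m)//.
by field.
Qed.

Lemma differentiable_christoffel_lower x p j k : U x -> differentiable (GamL p j k) x.
Proof.
move=> Ux; apply: differentiableM; first exact: differentiable_cst.
apply: differentiableB; first apply: differentiableD.
- exact: (gsmooth p k [:: j]).
- exact: (gsmooth p j [:: k]).
- exact: (gsmooth j k [:: p]).
Qed.

Lemma differentiable_invmx x i l : U x -> differentiable (fun y => invmx (g y) i l) x.
Proof.
move=> Ux.
(* Cramer's formula expresses the inverse through determinants of entries of [g]. *)
apply: (@differentiable_near _ _ _ (fun y => (\det (g y))^-1 * cofactor (g y) l i)).
  by apply: near_domain => // y Uy; rewrite /invmx gunit// !mxE.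
have dg k m : differentiable (fun y => g y k m) x by exact: (gsmooth k m [::]).
apply: differentiableM.
  apply: differentiableV; first exact: differentiable_det.
  by rewrite -unitfE -unitmxE gunit.
apply: differentiableM; first exact: differentiable_cst.
apply: differentiable_det => k m.
by under eq_fun do rewrite !mxE.
Qed.

Lemma differentiable_christoffel x i j k : U x -> differentiable (Gam i j k) x.
Proof.
move=> Ux.
apply: (@differentiable_near _ _ _ (fun y => \sum_l invmx (g y) i l * GamL l j k y)).
  by apply: near_domain => // y Uy; rewrite christoffelE.
apply: differentiable_big_sum => l; apply: differentiableM.
  exact: differentiable_invmx.
exact: differentiable_christoffel_lower.
Qed.

Lemma partial_christoffel_lower x k p l j : U x ->
  partial k (GamL p l j) x =
  2^-1 * (partial k (partial l (fun y => g y p j)) x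
          + partial k (partial j (fun y => g y p l)) x
          - partial k (partial p (fun y => g y l j)) x).
Proof.
move=> Ux; apply: derive_partial.
apply: is_derive_scale; apply: is_derive_sub; first apply: is_derive_add.
- exact: is_derive_partial (gsmooth p j [:: l] Ux).
- exact: is_derive_partial (gsmooth p l [:: j] Ux).
- exact: is_derive_partial (gsmooth l j [:: p] Ux).
Qed.

(** Differentiating the lowering relation [christoffel_lowerE] by the product rule gives the lowered
    derivative of the symbols without differentiating the inverse metric. *)
Lemma partial_christoffel x k p l j : U x ->
  \sum_i g x p i * partial k (Gam i l j) x =
  partial k (GamL p l j) x - \sum_i (GamL p k i x + GamL i k p x) * Gam i l j x.
Proof.
move=> Ux.
have -> : partial k (GamL p l j) x =
    \sum_i (partial k (fun y => g y p i) x * Gam i l j x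
            + g x p i * partial k (Gam i l j) x).
  transitivity (partial k (fun y => \sum_i g y p i * Gam i l j y) x).
    apply: near_eq_partial; apply: near_domain => // y Uy.
    by rewrite christoffel_lowerE.
  apply: derive_partial.
  apply: is_derive_big => i; apply: is_derive_mul.
    exact: is_derive_partial (gsmooth p i [::] Ux).
  exact: is_derive_partial (differentiable_christoffel i l j Ux).
rewrite big_split /= addrAC -[LHS]add0r; congr (_ + _).
rewrite -sumrB big1// => i _.
by rewrite partial_metric// subrr.
Qed.

Definition riemann_lower (p j k l : 'I_n) (x : 'rV[R]_n) : R :=
  \sum_i g x p i * riemann g i j k l x.

(** Half of the terms that arise when the index is lowered inside the derivatives cancel against the
    quadratic part of the curvature. What remains pairs two Christoffel symbols through the
    metric. *)
Lemma riemann_lowerE x p j k l : U x ->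
  riemann_lower p j k l x =
  partial k (GamL p l j) x - partial l (GamL p k j) x
  - \sum_i GamL i k p x * Gam i l j x + \sum_i GamL i l p x * Gam i k j x.
Proof.
move=> Ux; rewrite /riemann_lower.
under eq_bigr do rewrite riemannE mulrDr mulrBr.
rewrite big_split sumrB /=.
rewrite [X in X - _ + _](partial_christoffel k p l j Ux).
rewrite [X in _ - X + _](partial_christoffel l p k j Ux).
have swapsum a b : \sum_i g x p i * (\sum_m Gam i a m x * Gam m b j x) =
    \sum_m GamL p a m x * Gam m b j x.
  under eq_bigr do rewrite mulr_sumr.
  rewrite exchange_big; apply: eq_bigr => m _.
  by rewrite -(christoffel_lowerE p a m Ux) mulr_suml; apply: eq_bigr => i _; rewrite mulrA.
have quad : \sum_i g x p i * (\sum_m (Gam i k m x * Gam m l j x - Gam i l m x * Gam m k j x))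
   = \sum_m GamL p k m x * Gam m l j x - \sum_m GamL p l m x * Gam m k j x.
  by rewrite -!swapsum -sumrB; apply: eq_bigr => i _; rewrite sumrB mulrBr.
rewrite [X in _ + X]quad.
have split_lower a b : \sum_i (GamL p a i x + GamL i a p x) * Gam i b j x =
    \sum_i GamL p a i x * Gam i b j x + \sum_i GamL i a p x * Gam i b j x.
  by rewrite -big_split; apply: eq_bigr => i _; rewrite mulrDl.
rewrite (split_lower k l) (split_lower l k).
set s1 := \sum_i GamL p k i x * _; set s2 := \sum_i GamL p l i x * _.
set s3 := \sum_i GamL i k p x * _; set s4 := \sum_i GamL i l p x * _.
by move: (partial k _ x) (partial l _ x) => d1 d2; ring.
Qed.

(** The second derivatives of the metric match by [partial_swap] and the symmetry of [g]. The
    quadratic terms match because each is a scalar product of two Christoffel vectors, which may be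
    exchanged. *)
Lemma riemann_lower_pair x p j k l : U x ->
  riemann_lower p j k l x = riemann_lower k l p j x.
Proof.
move=> Ux; rewrite !riemann_lowerE// !partial_christoffel_lower//.
have sw a b c d : partial a (partial b (fun y => g y c d)) x =
    partial b (partial a (fun y => g y c d)) x.
  by apply: (partial_swap _ _ oU) => //; exact: gsmooth.
have sy a b c d : partial a (partial b (fun y => g y c d)) x =
    partial a (partial b (fun y => g y d c)) x.
  by apply: near_eq_partial; apply: near_domain => // y Uy; exact: partial_metric_sym.
have quad a b c d : \sum_i GamL i a b x * Gam i c d x =
    \sum_i GamL i d c x * Gam i b a x.
  transitivity (\sum_i \sum_m g x i m * Gam m a b x * Gam i c d x).
    by apply: eq_bigr => i _; rewrite -christoffel_lowerE// mulr_suml.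
  rewrite exchange_big; apply: eq_bigr => m _.
  rewrite [Gam m b a x]christoffel_sym// christoffel_lower_sym//.
  rewrite -(christoffel_lowerE m c d Ux) mulr_suml.
  by apply: eq_bigr => i _; rewrite (metric_entry_sym i m Ux); ring.
have lsym : \sum_i GamL i k p x * Gam i l j x = \sum_i GamL i p k x * Gam i j l x.
  by apply: eq_bigr => i _; rewrite christoffel_lower_sym// [Gam i l j x]christoffel_sym.
rewrite lsym (quad l p k j).
rewrite (sw k l p j) (sw p j k l) (sw k j p l) (sw k p l j) (sy p k l j).
rewrite (sw l j p k) (sy j l p k) (sw l p k j).
set s1 := \sum_i _; set s2 := \sum_i _.
move: (partial l (partial k (fun y => g y p j)) x) => d1.
move: (partial j (partial k (fun y => g y p l)) x) => d2.
move: (partial p (partial k (fun y => g y j l)) x) => d3.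
move: (partial j (partial l (fun y => g y k p)) x) => d4.
move: (partial p (partial l (fun y => g y k j)) x) => d5.
move: (partial j (partial p (fun y => g y k l)) x) => d6.
ring.
Qed.

End MetricInCoordinates.

(** * Linear algebra of the metric and of the curvature at a point *)

Section InnerProduct.
Variables (R : realType) (n : nat) (g : 'rV[R]_n -> 'M[R]_n) (x : 'rV[R]_n).
Implicit Types u v w e : 'rV[R]_n.

Lemma innerE u v : inner g x u v = \sum_i \sum_j g x i j * u 0 i * v 0 j.
Proof.
rewrite /inner mxE exchange_big; apply: eq_bigr => j _.
by rewrite !mxE mulr_suml; apply: eq_bigr => i _; rewrite [u 0 i * _]mulrC.
Qed.

Lemma innerDl u v w : inner g x (u + v) w = inner g x u w + inner g x v w.
Proof. by rewrite /inner !mulmxDl mxE. Qed.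

Lemma innerDr u v w : inner g x w (u + v) = inner g x w u + inner g x w v.
Proof. by rewrite /inner linearD /= mulmxDr mxE. Qed.

Lemma innerZl c u v : inner g x (c *: u) v = c * inner g x u v.
Proof. by rewrite /inner -!scalemxAl mxE. Qed.

Lemma innerZr c u v : inner g x u (c *: v) = c * inner g x u v.
Proof. by rewrite /inner linearZ /= -scalemxAr mxE. Qed.

Lemma inner0l v : inner g x 0 v = 0.
Proof. by rewrite /inner !mul0mx mxE. Qed.

Lemma innerBl u v w : inner g x (u - v) w = inner g x u w - inner g x v w.
Proof. by rewrite innerDl -scaleN1r innerZl mulN1r. Qed.

Lemma innerBr u v w : inner g x w (u - v) = inner g x w u - inner g x w v.
Proof. by rewrite innerDr -scaleN1r innerZr mulN1r. Qed.

Lemma inner_suml (I : finType) (F : I -> 'rV[R]_n) v :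
  inner g x (\sum_i F i) v = \sum_i inner g x (F i) v.
Proof. by apply: (big_morph (inner g x ^~ v)) => [u w|]; rewrite ?innerDl ?inner0l. Qed.

Lemma innerC u v : (g x)^T = g x -> inner g x u v = inner g x v u.
Proof.
move=> gs; rewrite !innerE exchange_big; apply: eq_bigr => j _; apply: eq_bigr => i _.
by rewrite -[in LHS]gs mxE mulrAC.
Qed.

Lemma posdef_unitmx : (forall u, u != 0 -> 0 < inner g x u u) -> g x \in unitmx.
Proof.
move=> pos; rewrite -row_free_unit -kermx_eq0; apply/eqP/row_matrixP => i.
rewrite row0; apply/eqP; apply: contraT => /pos.
by rewrite /inner -row_mul mulmx_ker row0 mul0mx mxE ltxx.
Qed.

Lemma curvatureE u v w i : curvature g x u v w 0 i =
  \sum_j \sum_k \sum_l riemann g i j k l x * w 0 j * u 0 k * v 0 l.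
Proof. by rewrite mxE. Qed.

Local Opaque riemann.

Lemma curvatureDl u u' v w :
  curvature g x (u + u') v w = curvature g x u v w + curvature g x u' v w.
Proof.
apply/rowP => i; rewrite [RHS]mxE !curvatureE -big_split; apply: eq_bigr => j _.
rewrite -big_split; apply: eq_bigr => k _; rewrite -big_split; apply: eq_bigr => l _.
by rewrite /= mxE mulrDr mulrDl.
Qed.

Lemma curvatureZl c u v w : curvature g x (c *: u) v w = c *: curvature g x u v w.
Proof.
apply/rowP => i; rewrite [RHS]mxE !curvatureE mulr_sumr; apply: eq_bigr => j _.
rewrite mulr_sumr; apply: eq_bigr => k _; rewrite mulr_sumr; apply: eq_bigr => l _.
by rewrite mxE; ring.
Qed.

Lemma riemann_antisym i j k l : riemann g i j k l x = - riemann g i j l k x.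
Proof.
rewrite !riemannE opprD opprB; congr (_ + _).
by rewrite -sumrN; apply: eq_bigr => m _; rewrite opprB.
Qed.

Lemma curvature_diag v w : curvature g x v v w = 0.
Proof.
apply/rowP => i; rewrite curvatureE mxE big1// => j _.
set s := \sum_k _.
have sN : s = - s.
  rewrite {1}/s exchange_big -sumrN; apply: eq_bigr => l _.
  rewrite -sumrN; apply: eq_bigr => k _.
  by rewrite (riemann_antisym i j k l) -!mulrA [v 0 l * _]mulrC; ring.
lra.
Qed.

Lemma curvature0r u w : curvature g x u 0 w = 0.
Proof.
apply/rowP => i; rewrite curvatureE mxE big1// => j _; rewrite big1// => k _.
by rewrite big1// => l _; rewrite mxE mulr0.
Qed.

End InnerProduct.

(** * From constant sectional curvature to the full Jacobi operator *)

Section ConstantCurvature.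
Variables (R : realType) (n : nat) (U : set 'rV[R]_n) (g : 'rV[R]_n -> 'M[R]_n).
Hypothesis (oU : open U) (gsmooth : forall k l, smooth U (fun x => g x k l)).
Hypothesis gsym : forall x, U x -> (g x)^T = g x.
Hypothesis gpos : forall x, U x -> forall u, u != 0 -> 0 < inner g x u u.

Let gunit x (Ux : U x) : g x \in unitmx := posdef_unitmx (gpos Ux).
Local Opaque riemann partial christoffel.

Lemma inner_curvature x u v w z : U x ->
  inner g x (curvature g x u v w) z =
  \sum_p \sum_j \sum_k \sum_l riemann_lower g p j k l x * w 0 j * u 0 k * v 0 l * z 0 p.
Proof.
move=> Ux; rewrite innerE exchange_big; apply: eq_bigr => p _.
under eq_bigr do rewrite curvatureE mulr_sumr mulr_suml.
rewrite exchange_big; apply: eq_bigr => j _.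
under eq_bigr do rewrite mulr_sumr mulr_suml.
rewrite exchange_big; apply: eq_bigr => k _.
under eq_bigr do rewrite mulr_sumr mulr_suml.
rewrite exchange_big; apply: eq_bigr => l _.
rewrite /riemann_lower !mulr_suml; apply: eq_bigr => i _.
by rewrite (metric_entry_sym gsym p i Ux) !mulrA.
Qed.

(** Pair symmetry makes [v] |-> R(v, e) e self-adjoint, so that its quadratic form determines it. *)
Lemma jacobi_operator_sym x v w e : U x ->
  inner g x (curvature g x v e e) w = inner g x (curvature g x w e e) v.
Proof.
move=> Ux; rewrite !inner_curvature//.
rewrite [RHS](eq_bigr (fun p => \sum_k \sum_j \sum_l
   riemann_lower g p j k l x * e 0 j * w 0 k * e 0 l * v 0 p)); last first.
  by move=> p _; rewrite exchange_big.
rewrite [RHS]exchange_big; apply: eq_bigr => p _.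
rewrite exchange_big; apply: eq_bigr => k _ /=.
rewrite exchange_big; apply: eq_bigr => l _ ; apply: eq_bigr => j _ /=.
by rewrite (riemann_lower_pair oU gsmooth gsym gunit p j k l Ux); ring.
Qed.

Variable kappa : R.
Hypothesis curv : forall x, U x -> forall u v, plane_area2 g x u v != 0 ->
  sectional_curvature g x u v = kappa.

(** The curvature hypothesis covers nondegenerate planes only. When the area vanishes, either [e] is
    0 or, by the equality case of Cauchy-Schwarz, [v] is a multiple of [e]; both sides are then
    0. *)
Lemma jacobi_operator_quadratic x v e : U x ->
  inner g x (curvature g x v e e) v =
  kappa * (inner g x v v * inner g x e e - inner g x v e ^+ 2).
Proof.
move=> Ux; have [a0|a0] := eqVneq (plane_area2 g x v e) 0; last first.
  by rewrite -(curv Ux a0) /sectional_curvature -/(plane_area2 g x v e) divfK.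
have [->|e0] := eqVneq e 0.
  by rewrite curvature0r inner0l -(scale0r v) !innerZr !mul0r mulr0 expr0n subrr mulr0.
rewrite -/(plane_area2 g x v e) a0 mulr0.
have ee0 : inner g x e e != 0 by rewrite gt_eqF// gpos.
pose c := inner g x v e / inner g x e e.
suff -> : v = c *: e by rewrite curvatureZl curvature_diag scaler0 inner0l.
apply/eqP; rewrite -subr_eq0; apply: contraT => /(gpos Ux).
have -> : inner g x (v - c *: e) (v - c *: e) = plane_area2 g x v e / inner g x e e.
  rewrite innerBl !innerBr !innerZl !innerZr (innerC e v (gsym Ux)) /c /plane_area2.
  by field.
by rewrite a0 mul0r ltxx.
Qed.

(** Polarization of the quadratic identity at [v + w], using self-adjointness. *)
Lemma jacobi_operator_bilinear x v w e : U x ->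
  inner g x (curvature g x v e e) w =
  kappa * (inner g x v w * inner g x e e - inner g x v e * inner g x w e).
Proof.
move=> Ux; have := jacobi_operator_quadratic (v + w) e Ux.
rewrite curvatureDl !innerDl !innerDr !jacobi_operator_quadratic//.
rewrite (jacobi_operator_sym w v e Ux) (innerC w v (gsym Ux)).
lra.
Qed.

Lemma jacobi_operator_constant_curvature x v e : U x ->
  curvature g x v e e = kappa *: (inner g x e e *: v - inner g x v e *: e).
Proof.
move=> Ux; apply/eqP; rewrite -subr_eq0; apply: contraT => /(gpos Ux).
set d := _ - _; have -> : inner g x d d = inner g x (curvature g x v e e) d
  - kappa * (inner g x e e * inner g x v d - inner g x v e * inner g x e d).
  by rewrite {1}/d innerBl innerZl innerBl !innerZl.
rewrite jacobi_operator_bilinear// (innerC e d (gsym Ux)).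
by rewrite [_ - _](_ : _ = 0) ?ltxx//; ring.
Qed.

End ConstantCurvature.

(** * Coordinates split into time and space *)

Section SplitCoordinates.
Variables (R : realType) (n : nat).
Implicit Types (f : 'rV[R]_(1 + n) -> R) (x : 'rV[R]_(1 + n)).

Definition time_index : 'I_(1 + n) := lshift n ord0.

Lemma lsubmxE x : lsubmx x 0 0 = x 0 time_index.
Proof. by rewrite mxE. Qed.

Lemma big_time_space (F : 'I_(1 + n) -> R) :
  \sum_i F i = F time_index + \sum_(i < n) F (rshift 1 i).
Proof. by rewrite big_split_ord big_ord1. Qed.

Lemma partial_time f x d :
  is_derive (lsubmx x 0 0) (1 : R) (fun s => f (row_mx s%:M (rsubmx x))) d ->
  partial time_index f x = d.
Proof.
move=> H; rewrite partialE -(@derive_val _ _ _ _ _ _ _ H).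
rewrite /derive; set g1 := (fun h : R => _); set g2 := (fun h : R => _).
suff -> : g1 = g2 by [].
apply/funext => h; rewrite /g1 /g2 /=; congr (_ *: (f _ - f _)); last first.
  rewrite -[LHS]hsubmxK; congr row_mx; apply/rowP => i.
  by rewrite !ord1 !mxE eqxx.
rewrite -[LHS]hsubmxK; congr row_mx; apply/rowP => i; rewrite !mxE.
  by rewrite !ord1 !eqxx /= mulr1n mulr1; congr (_ + _); rewrite [RHS]mulr1.
by rewrite eq_rlshift andbF mulr0 add0r.
Qed.

Lemma partial_space f x (k : 'I_n) :
  partial (rshift 1 k) f x = partial k (fun z => f (row_mx (lsubmx x) z)) (rsubmx x).
Proof.
rewrite !partialE /derive; set g1 := (fun h : R => _); set g2 := (fun h : R => _).
suff -> : g1 = g2 by [].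
apply/funext => h; rewrite /g1 /g2 /=; congr (_ *: (f _ - f _)); last by rewrite hsubmxK.
rewrite -[LHS]hsubmxK; congr row_mx; apply/rowP => i; rewrite !mxE.
  by rewrite eq_lrshift andbF mulr0 add0r.
by rewrite eq_rshift.
Qed.

Variable (U : set 'rV[R]_n).
Definition split_domain : set 'rV[R]_(1 + n) :=
  [set x | 0 < lsubmx x 0 0 /\ U (rsubmx x)].

Hypothesis oU : open U.

Lemma open_split_domain : open split_domain.
Proof.
apply: openI.
  apply: (@open_comp _ _ (fun x : 'rV[R]_(1 + n) => lsubmx x 0 0) [set t | 0 < t]); last exact: open_gt.
  move=> x _; apply: differentiable_continuous.
  apply: (@differentiable_comp _ _ _ _ (fun x : 'rV[R]_(1 + n) => lsubmx x) (fun y : 'rV[R]_1 => y 0 0)).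
    exact: differentiable_lsubmx.
  exact: differentiable_coord.
apply: (@open_comp _ _ (fun x : 'rV[R]_(1 + n) => rsubmx x) U) => //.
by move=> x _; apply: differentiable_continuous; exact: differentiable_rsubmx.
Qed.

(** The metric entries and Christoffel symbols of the warped product are all constants or products
    of a function of time and a function of position; this lemma and the two after it differentiate
    them. *)
Lemma partial_time_prod f (F : R -> R) (H : 'rV[R]_n -> R) dF x : split_domain x ->
  (forall y, split_domain y -> f y = F (lsubmx y 0 0) * H (rsubmx y)) ->
  is_derive (lsubmx x 0 0) (1 : R) F dF ->
  partial time_index f x = dF * H (rsubmx x).
Proof.
move=> Wx fE DF.
rewrite (@near_eq_partial _ _ _ f (fun y => F (lsubmx y 0 0) * H (rsubmx y))); last first.
  exact: (near_domain open_split_domain Wx fE).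
apply: partial_time.
have -> : (fun s : R => F (lsubmx (row_mx s%:M (rsubmx x)) 0 0) *
     H (rsubmx (row_mx s%:M (rsubmx x)))) = fun s => F s * H (rsubmx x).
  by apply/funext => s; rewrite row_mxKl row_mxKr mxE eqxx.
have E := is_derive_mul DF (is_derive_const (H (rsubmx x)) _ (1 : R)).
apply: (is_derive_eq E); by rewrite mulr0 addr0.
Qed.

Lemma partial_space_prod f (F : R -> R) (H : 'rV[R]_n -> R) k x : split_domain x ->
  (forall y, split_domain y -> f y = F (lsubmx y 0 0) * H (rsubmx y)) ->
  differentiable H (rsubmx x) ->
  partial (rshift 1 k) f x = F (lsubmx x 0 0) * partial k H (rsubmx x).
Proof.
move=> Wx fE DH.
rewrite (@near_eq_partial _ _ _ f (fun y => F (lsubmx y 0 0) * H (rsubmx y))); last first.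
  exact: (near_domain open_split_domain Wx fE).
rewrite partial_space; apply: derive_partial.
have -> : (fun z : 'rV[R]_n => F (lsubmx (row_mx (lsubmx x) z) 0 0) *
     H (rsubmx (row_mx (lsubmx x) z))) = fun z => F (lsubmx x 0 0) * H z.
  by apply/funext => z; rewrite row_mxKl row_mxKr.
exact: is_derive_scale (is_derive_partial k DH).
Qed.

Lemma partial_prod_const f (c : R) k x : split_domain x ->
  (forall y, split_domain y -> f y = c) -> partial k f x = 0.
Proof.
move=> Wx fE; rewrite (@near_eq_partial _ _ _ f (fun=> c)); last first.
  exact: (near_domain open_split_domain Wx fE).
exact: derive_partial (is_derive_const _ _ _).
Qed.

End SplitCoordinates.

(** * Connection and curvature of the metric - dt^2 + a(t)^2 m *)

Section WarpedProduct.
Variables (R : realType) (n : nat) (U : set 'rV[R]_n) (m : 'rV[R]_n -> 'M[R]_n).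
Variables (a : R -> R).
Hypothesis (oU : open U) (msmooth : forall k l, smooth U (fun x => m x k l)).
Hypothesis msym : forall x, U x -> (m x)^T = m x.
Hypothesis munit : forall x, U x -> m x \in unitmx.
Hypothesis apos : forall t : R, 0 < t -> 0 < a t.
Hypothesis asmooth : smooth1 `]0, +oo[ a.

Definition warped_metric (x : 'rV[R]_(1 + n)) : 'M[R]_(1 + n) :=
  block_mx (- 1)%:M 0 0 ((a (lsubmx x 0 0)) ^+ 2 *: m (rsubmx x)).

Local Notation G := warped_metric.
Local Notation W := (split_domain U).
Local Notation T := (time_index n).
Local Notation S := (rshift 1).
Local Notation a1 := (derive1 a).
Local Notation a2 := (derive1n 2 a).
Local Notation Gam := (christoffel G).
Local Notation time x := (lsubmx x 0 0).
Local Notation pos x := (rsubmx x).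

Lemma scale_factor_derive (t : R) : 0 < t -> is_derive t (1 : R) a (a1 t).
Proof.
move=> t0; rewrite derive1E; apply: derivableP.
by apply: (@asmooth 0%N t); rewrite /= in_itv /= t0.
Qed.

Lemma scale_factor_derive2 (t : R) : 0 < t -> is_derive t (1 : R) a1 (a2 t).
Proof.
move=> t0; have -> : a2 t = 'D_1 a1 t := derive1E a1 t; apply: derivableP.
by apply: (@asmooth 1%N t); rewrite /= in_itv /= t0.
Qed.

Lemma scale_factor_neq0 (t : R) : 0 < t -> a t != 0.
Proof. by move=> /apos; rewrite lt0r => /andP[]. Qed.

Lemma warped_metric_TT x : G x T T = - 1.
Proof. by rewrite block_mxEul mxE eqxx. Qed.
Lemma warped_metric_TS x k : G x T (S k) = 0.
Proof. by rewrite block_mxEur mxE. Qed.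
Lemma warped_metric_ST x k : G x (S k) T = 0.
Proof. by rewrite block_mxEdl mxE. Qed.
Lemma warped_metric_SS x k l : G x (S k) (S l) = a (time x) ^+ 2 * m (pos x) k l.
Proof. by rewrite block_mxEdr mxE. Qed.

Lemma warped_metric_sym x : W x -> (G x)^T = G x.
Proof.
move=> [_ Ux]; rewrite /G tr_block_mx !trmx0 tr_scalar_mx.
by rewrite linearZ /= msym.
Qed.

Local Opaque partial christoffel riemann.

Lemma mentry_diff k l z : U z -> differentiable (fun y => m y k l) z.
Proof. exact: (msmooth k l [::]). Qed.

Lemma partial_T_SS x k l : W x ->
  partial T (fun y => G y (S k) (S l)) x = 2 * a (time x) * a1 (time x) * m (pos x) k l.
Proof.
move=> Wx; have [t0 Ux] := Wx.
apply: (@partial_time_prod _ _ _ oU _ (fun s => a s ^+ 2) (fun z => m z k l)) => //.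
  by move=> y _; rewrite warped_metric_SS.
have E := is_derive_mul (scale_factor_derive t0) (scale_factor_derive t0).
by apply: (is_derive_eq E); ring.
Qed.

Lemma partial_S_SS x j k l : W x ->
  partial (S j) (fun y => G y (S k) (S l)) x =
  a (time x) ^+ 2 * partial j (fun z => m z k l) (pos x).
Proof.
move=> Wx; have [t0 Ux] := Wx.
apply: (@partial_space_prod _ _ _ oU _ (fun s => a s ^+ 2) (fun z => m z k l)) => //.
  by move=> y _; rewrite warped_metric_SS.
exact: mentry_diff.
Qed.

Lemma partial_TT x i : W x -> partial i (fun y => G y T T) x = 0.
Proof. by move=> Wx; apply: (partial_prod_const oU i Wx) => y _; exact: warped_metric_TT. Qed.
Lemma partial_TS x i k : W x -> partial i (fun y => G y T (S k)) x = 0.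
Proof. by move=> Wx; apply: (partial_prod_const oU i Wx) => y _; exact: warped_metric_TS. Qed.
Lemma partial_ST x i k : W x -> partial i (fun y => G y (S k) T) x = 0.
Proof. by move=> Wx; apply: (partial_prod_const oU i Wx) => y _; exact: warped_metric_ST. Qed.

Let warped_inverse (x : 'rV[R]_(1 + n)) :=
  block_mx (- 1)%:M 0 0 ((a (time x) ^+ 2)^-1 *: invmx (m (pos x))) : 'M[R]_(1 + n).

Let warped_mulV x : W x -> G x *m warped_inverse x = 1%:M.
Proof.
move=> [t0 Ux].
rewrite /G /warped_inverse mulmx_block !mul0mx !mulmx0 !addr0 !add0r -scalar_mxM mulrNN mulr1.
rewrite -scalemxAl -scalemxAr mulmxV ?munit// scalerA mulfV ?scale1r -?scalar_mx_block//.
by rewrite expf_eq0 /= scale_factor_neq0.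
Qed.

Lemma warped_metric_unit x : W x -> G x \in unitmx.
Proof. by move=> /warped_mulV/mulmx1_unit[]. Qed.

Let invmx_warped x : W x -> invmx (G x) = warped_inverse x.
Proof.
by move=> Wx; rewrite -[RHS](mulKmx (warped_metric_unit Wx)) warped_mulV// mulmx1.
Qed.

Let invTT x : W x -> invmx (G x) T T = - 1.
Proof. by move=> Wx; rewrite invmx_warped// block_mxEul mxE eqxx. Qed.
Let invTS x k : W x -> invmx (G x) T (S k) = 0.
Proof. by move=> Wx; rewrite invmx_warped// block_mxEur mxE. Qed.
Let invST x k : W x -> invmx (G x) (S k) T = 0.
Proof. by move=> Wx; rewrite invmx_warped// block_mxEdl mxE. Qed.
Let invSS x k l : W x -> invmx (G x) (S k) (S l) =
  (a (time x) ^+ 2)^-1 * invmx (m (pos x)) k l.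
Proof. by move=> Wx; rewrite invmx_warped// block_mxEdr mxE. Qed.

Lemma invmx_metric_sum x i k (b : R) : U x ->
  \sum_l invmx (m x) i l * (b * m x l k) = b * (i == k)%:R.
Proof.
move=> Ux; under eq_bigr do rewrite mulrCA.
rewrite -mulr_sumr; congr (_ * _).
by have /matrixP/(_ i k) := mulVmx (munit Ux); rewrite !mxE.
Qed.

Lemma christoffel_T x j k : W x ->
  Gam T j k x = - christoffel_lower G T j k x.
Proof.
move=> Wx; rewrite christoffelE big_time_space invTT// mulN1r big1 ?addr0// => l _.
by rewrite invTS// mul0r.
Qed.

Lemma christoffel_S x i j k : W x -> Gam (S i) j k x =
  \sum_l (a (time x) ^+ 2)^-1 * (invmx (m (pos x)) i l * christoffel_lower G (S l) j k x).
Proof.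
move=> Wx; rewrite christoffelE big_time_space invST// mul0r add0r.
by apply: eq_bigr => l _; rewrite invSS// -mulrA.
Qed.

(** In this family of names, the letters give the type (time or space) of the upper index and then
    of the lower indices; the curvature lemmas follow the same scheme. *)
Lemma christoffel_TTT x : W x -> Gam T T T x = 0.
Proof.
by move=> Wx; rewrite christoffel_T// /christoffel_lower !partial_TT// addr0 subr0 mulr0 oppr0.
Qed.

Lemma christoffel_TTS x k : W x -> Gam T T (S k) x = 0.
Proof.
move=> Wx; rewrite christoffel_T// /christoffel_lower partial_TT// !partial_TS//.
by rewrite addr0 subr0 mulr0 oppr0.
Qed.

Lemma christoffel_TST x k : W x -> Gam T (S k) T x = 0.
Proof.
move=> Wx; rewrite christoffel_T// /christoffel_lower partial_TT// partial_TS// partial_ST//.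
by rewrite addr0 subr0 mulr0 oppr0.
Qed.

Lemma christoffel_TSS x j k : W x ->
  Gam T (S j) (S k) x = a (time x) * a1 (time x) * m (pos x) j k.
Proof.
move=> Wx; rewrite christoffel_T// /christoffel_lower !partial_TS// partial_T_SS//.
by field.
Qed.

Lemma christoffel_STT x i : W x -> Gam (S i) T T x = 0.
Proof.
move=> Wx; rewrite christoffel_S// big1// => l _.
by rewrite /christoffel_lower partial_TT// !partial_ST// addr0 subr0 !mulr0.
Qed.

Lemma christoffel_STS x i k : W x ->
  Gam (S i) T (S k) x = a1 (time x) / a (time x) * (i == k)%:R.
Proof.
move=> Wx; have [t0 Ux] := Wx; have a0 := scale_factor_neq0 t0.
rewrite christoffel_S// -mulr_sumr.
transitivity ((a (time x) ^+ 2)^-1 * \sum_l invmx (m (pos x)) i l *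
   ((a (time x) * a1 (time x)) * m (pos x) l k)).
  congr (_ * _); apply: eq_bigr => l _; congr (_ * _).
  by rewrite /christoffel_lower partial_T_SS// partial_ST// partial_TS//; field.
by rewrite invmx_metric_sum//; field.
Qed.

Lemma christoffel_SST x i k : W x ->
  Gam (S i) (S k) T x = a1 (time x) / a (time x) * (i == k)%:R.
Proof.
move=> Wx; rewrite -christoffel_STS//.
exact: (christoffel_sym (open_split_domain oU) warped_metric_sym).
Qed.

Lemma christoffel_SSS x i j k : W x ->
  Gam (S i) (S j) (S k) x = christoffel m i j k (pos x).
Proof.
move=> Wx; have [t0 Ux] := Wx; have a0 := scale_factor_neq0 t0.
rewrite christoffel_S// christoffelE; apply: eq_bigr => l _.
rewrite /christoffel_lower !partial_S_SS//.
move: (partial _ _ _) (partial _ _ _) (partial _ _ _) => d1 d2 d3.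
by field.
Qed.

Lemma differentiable_split_prod (F : R -> R) (H : 'rV[R]_n -> R) dF f x : W x ->
  (forall y, W y -> f y = F (time y) * H (pos y)) ->
  is_derive (time x) (1 : R) F dF -> differentiable H (pos x) -> differentiable f x.
Proof.
move=> Wx fE [DF _] DH.
apply: (@differentiable_near _ _ _ (fun y => F (time y) * H (pos y))).
  by apply: (near_domain (open_split_domain oU) Wx) => y Wy; rewrite fE.
apply: differentiableM.
  apply: (@differentiable_comp _ _ _ _ (fun y : 'rV[R]_(1 + n) => time y) F).
    apply: (@differentiable_comp _ _ _ _ (fun y : 'rV[R]_(1 + n) => lsubmx y) (fun y : 'rV[R]_1 => y 0 0)).
      exact: differentiable_lsubmx.
    exact: differentiable_coord.
  by apply/derivable1_diffP.
apply: (@differentiable_comp _ _ _ _ (fun y : 'rV[R]_(1 + n) => rsubmx y) H) => //.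
exact: differentiable_rsubmx.
Qed.

Lemma differentiable_split_const (c : R) f x : W x -> (forall y, W y -> f y = c) ->
  differentiable f x.
Proof.
move=> Wx fE; apply: (@differentiable_near _ _ _ (fun=> c)); last exact: differentiable_cst.
by apply: (near_domain (open_split_domain oU) Wx) => y Wy; rewrite fE.
Qed.

Variant time_space_spec : 'I_(1 + n) -> Type :=
 | IsTime : time_space_spec T
 | IsSpace k : time_space_spec (S k).

Lemma time_spaceP i : time_space_spec i.
Proof. by case: (split_ordP i) => j ->; [rewrite ord1; left|right]. Qed.

Lemma differentiable_warped_metric x i j : W x -> differentiable (fun y => G y i j) x.
Proof.
move=> Wx; have [t0 Ux] := Wx; case: (time_spaceP i) => [|k]; case: (time_spaceP j) => [|l].
- by apply: (@differentiable_split_const (-1)) => // y _; exact: warped_metric_TT.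
- by apply: (@differentiable_split_const 0) => // y _; exact: warped_metric_TS.
- by apply: (@differentiable_split_const 0) => // y _; exact: warped_metric_ST.
apply: (@differentiable_split_prod (fun s => a s ^+ 2) (fun z => m z k l)) => //.
- by move=> y _; rewrite warped_metric_SS.
- exact: is_derive_mul (scale_factor_derive t0) (scale_factor_derive t0).
- exact: mentry_diff.
Qed.

Lemma is_derive_hubble (t : R) : 0 < t ->
  is_derive t (1 : R) (fun s => a1 s / a s) (a2 t / a t - (a1 t / a t) ^+ 2).
Proof.
move=> t0; have a0 := scale_factor_neq0 t0.
have E := is_derive_mul (scale_factor_derive2 t0) (is_derive_inv a0 (scale_factor_derive t0)).
by apply: (is_derive_eq E); field.
Qed.

Lemma is_derive_a_a1 (t : R) : 0 < t ->
  is_derive t (1 : R) (fun s => a s * a1 s) (a1 t ^+ 2 + a t * a2 t).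
Proof.
move=> t0.
by apply: (is_derive_eq (is_derive_mul (scale_factor_derive t0) (scale_factor_derive2 t0))); ring.
Qed.

Lemma differentiable_warped_christoffel x i j k : W x -> differentiable (Gam i j k) x.
Proof.
move=> Wx; have [t0 Ux] := Wx.
have hubble (p q : 'I_n) f : (forall y, W y -> f y = a1 (time y) / a (time y) * (p == q)%:R) ->
    differentiable f x.
  move=> fE; apply: (@differentiable_split_prod (fun s => a1 s / a s) (fun=> (p == q)%:R) _ _ _ Wx fE).
    exact: is_derive_hubble.
  exact: differentiable_cst.
case: (time_spaceP i) => [|p]; case: (time_spaceP j) => [|q]; case: (time_spaceP k) => [|r].
- by apply: (@differentiable_split_const 0) => // y Wy; exact: christoffel_TTT.
- by apply: (@differentiable_split_const 0) => // y Wy; exact: christoffel_TTS.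
- by apply: (@differentiable_split_const 0) => // y Wy; exact: christoffel_TST.
- apply: (@differentiable_split_prod (fun s => a s * a1 s) (fun z => m z q r)) => //.
  + by move=> y Wy; exact: christoffel_TSS.
  + exact: is_derive_a_a1.
  + exact: mentry_diff.
- by apply: (@differentiable_split_const 0) => // y Wy; exact: christoffel_STT.
- by apply: hubble => y Wy; exact: christoffel_STS.
- by apply: hubble => y Wy; exact: christoffel_SST.
- apply: (@differentiable_split_prod (fun=> 1) (christoffel m p q r) 0) => //.
  + by move=> y Wy; rewrite christoffel_SSS// mul1r.
  + exact: (differentiable_christoffel oU msmooth munit).
Qed.


Lemma sum_delta (F : 'I_n -> R) k : \sum_q F q * (q == k)%:R = F k.
Proof.
rewrite (bigD1 k)//= eqxx mulr1 big1 ?addr0// => q /negPf ->.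
by rewrite mulr0.
Qed.

Lemma partial_T_christoffel_TSS x j k : W x -> partial T (Gam T (S j) (S k)) x =
  (a1 (time x) ^+ 2 + a (time x) * a2 (time x)) * m (pos x) j k.
Proof.
move=> Wx; have [t0 Ux] := Wx.
apply: (@partial_time_prod _ _ _ oU _ (fun s => a s * a1 s) (fun z => m z j k)) => //.
  by move=> y Wy; exact: christoffel_TSS.
exact: is_derive_a_a1.
Qed.

Lemma partial_S_christoffel_TSS x l j k : W x -> partial (S l) (Gam T (S j) (S k)) x =
  a (time x) * a1 (time x) * partial l (fun z => m z j k) (pos x).
Proof.
move=> Wx; have [t0 Ux] := Wx.
apply: (@partial_space_prod _ _ _ oU _ (fun s => a s * a1 s) (fun z => m z j k)) => //.
  by move=> y Wy; exact: christoffel_TSS.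
exact: mentry_diff.
Qed.

Lemma partial_T_christoffel_SST x i k : W x -> partial T (Gam (S i) (S k) T) x =
  (a2 (time x) / a (time x) - (a1 (time x) / a (time x)) ^+ 2) * (i == k)%:R.
Proof.
move=> Wx; have [t0 Ux] := Wx.
apply: (@partial_time_prod _ _ _ oU _ (fun s => a1 s / a s) (fun=> (i == k)%:R)) => //.
  by move=> y Wy; exact: christoffel_SST.
exact: is_derive_hubble.
Qed.

Lemma partial_S_hubble x l f (c : R) : W x ->
  (forall y, W y -> f y = a1 (time y) / a (time y) * c) -> partial (S l) f x = 0.
Proof.
move=> Wx fE.
rewrite (@partial_space_prod _ _ _ oU _ (fun s => a1 s / a s) (fun=> c) l _ Wx fE).
  by rewrite (derive_partial (is_derive_const _ _ _)) mulr0.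
exact: differentiable_cst.
Qed.

Lemma partial_T_christoffel_SSS x i j k : W x -> partial T (Gam (S i) (S j) (S k)) x = 0.
Proof.
move=> Wx.
rewrite (@partial_time_prod _ _ _ oU _ (fun=> 1) (christoffel m i j k) 0) ?mul0r//.
by move=> y Wy; rewrite christoffel_SSS// mul1r.
Qed.

Lemma partial_S_christoffel_SSS x l i j k : W x ->
  partial (S l) (Gam (S i) (S j) (S k)) x = partial l (christoffel m i j k) (pos x).
Proof.
move=> Wx; have [t0 Ux] := Wx.
rewrite (@partial_space_prod _ _ _ oU _ (fun=> 1) (christoffel m i j k)) ?mul1r//.
  by move=> y Wy; rewrite christoffel_SSS// mul1r.
exact: (differentiable_christoffel oU msmooth munit).
Qed.

Lemma riemann_TTTS x l : W x -> riemann G T T T (S l) x = 0.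
Proof.
move=> Wx; rewrite riemannE (partial_prod_const oU T Wx (@christoffel_TST ^~ l)).
rewrite (partial_prod_const oU (S l) Wx christoffel_TTT) subr0 add0r.
rewrite big_time_space !christoffel_TTT// christoffel_TST// !mul0r subr0 add0r.
by rewrite big1// => q _; rewrite christoffel_TTS// christoffel_STT// mul0r mulr0 subr0.
Qed.

Lemma riemann_TTSS x k l : W x -> riemann G T T (S k) (S l) x = 0.
Proof.
move=> Wx; have [t0 Ux] := Wx.
rewrite riemannE (partial_prod_const oU (S k) Wx (@christoffel_TST ^~ l)).
rewrite (partial_prod_const oU (S l) Wx (@christoffel_TST ^~ k)) subr0 add0r.
rewrite big_time_space !christoffel_TST// !mul0r subr0 add0r.
under eq_bigr do rewrite !christoffel_TSS// !christoffel_SST// !mulrA.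
by rewrite sumrB !sum_delta (metric_entry_sym msym k l Ux) subrr.
Qed.

Lemma riemann_TSTS x j l : W x ->
  riemann G T (S j) T (S l) x = a (time x) * a2 (time x) * m (pos x) l j.
Proof.
move=> Wx; have [t0 Ux] := Wx; have a0 := scale_factor_neq0 t0.
rewrite riemannE partial_T_christoffel_TSS//.
rewrite (partial_prod_const oU (S l) Wx (@christoffel_TTS ^~ j)) subr0.
rewrite big_time_space christoffel_TTT// christoffel_TST// !mul0r subr0 add0r.
under eq_bigr do rewrite christoffel_TTS// mul0r sub0r christoffel_TSS// christoffel_STS// mulrA.
by rewrite sumrN sum_delta; field.
Qed.

(** The Codazzi equation: the second fundamental form of a slice is a multiple of its metric, so the
    derivatives of the metric cancel once the symbols are lowered. *)
Lemma riemann_TSSS x j k l : W x -> riemann G T (S j) (S k) (S l) x = 0.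
Proof.
move=> Wx; have [t0 Ux] := Wx.
rewrite riemannE !partial_S_christoffel_TSS//.
rewrite big_time_space !christoffel_TST// !mul0r subr0 add0r.
under eq_bigr do rewrite !christoffel_TSS// !christoffel_SSS// -!mulrA.
rewrite sumrB -!mulr_sumr.
rewrite (christoffel_lowerE munit k l j Ux) (christoffel_lowerE munit l k j Ux).
rewrite /christoffel_lower (partial_metric_sym oU msym j k l Ux).
by move: (partial k _ _) (partial l _ _) (partial j _ _) => d1 d2 d3; field.
Qed.

Lemma riemann_STTS x i l : W x ->
  riemann G (S i) T T (S l) x = a2 (time x) / a (time x) * (i == l)%:R.
Proof.
move=> Wx; have [t0 Ux] := Wx; have a0 := scale_factor_neq0 t0.
rewrite riemannE partial_T_christoffel_SST//.
rewrite (partial_prod_const oU (S l) Wx (@christoffel_STT ^~ i)) subr0.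
rewrite big_time_space christoffel_STT// christoffel_TTT// mul0r mulr0 subr0 add0r.
under eq_bigr do rewrite christoffel_STT// mulr0 subr0 christoffel_STS// christoffel_SST// mulrA.
by rewrite sum_delta; field.
Qed.

Lemma riemann_STSS x i k l : W x -> riemann G (S i) T (S k) (S l) x = 0.
Proof.
move=> Wx; have [t0 Ux] := Wx.
rewrite riemannE (partial_S_hubble k Wx (fun y => @christoffel_SST y i l)).
rewrite (partial_S_hubble l Wx (fun y => @christoffel_SST y i k)) subr0 add0r.
rewrite big_time_space !christoffel_TST// !mulr0 subr0 add0r.
under eq_bigr do rewrite !christoffel_SSS// !christoffel_SST// !mulrA.
rewrite sumrB !sum_delta (christoffel_sym oU msym i k l Ux) subrr//.
Qed.

Lemma riemann_SSTS x i j l : W x -> riemann G (S i) (S j) T (S l) x = 0.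
Proof.
move=> Wx; have [t0 Ux] := Wx.
rewrite riemannE partial_T_christoffel_SSS//.
rewrite (partial_S_hubble l Wx (fun y => @christoffel_STS y i j)) subr0 add0r.
rewrite big_time_space christoffel_STT// christoffel_TTS// mul0r mulr0 subr0 add0r.
under eq_bigr do rewrite !christoffel_SSS// !christoffel_STS//.
set H := a1 _ / _; transitivity (\sum_q H * christoffel m q l j (pos x) * (q == i)%:R
  - \sum_q H * christoffel m i l q (pos x) * (q == j)%:R); last by rewrite !sum_delta subrr.
by rewrite -sumrB; apply: eq_bigr => q _; rewrite [i == q]eq_sym; ring.
Qed.

(** The Gauss equation. Since the normal of the slices is timelike, the extrinsic term adds a'^2 to
    the curvature of [m]; this is the origin of the factor kappa + a'^2 below. *)
Lemma riemann_SSSS x i j k l : W x -> riemann G (S i) (S j) (S k) (S l) x =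
  riemann m i j k l (pos x) + a1 (time x) ^+ 2 *
   ((i == k)%:R * m (pos x) l j - (i == l)%:R * m (pos x) k j).
Proof.
move=> Wx; have [t0 Ux] := Wx; have a0 := scale_factor_neq0 t0.
rewrite !riemannE !partial_S_christoffel_SSS// big_time_space !christoffel_SST// !christoffel_TSS//.
under eq_bigr do rewrite !christoffel_SSS//.
move: (\sum_q _) (partial _ _ _) (partial _ _ _) => d1 d2 d3.
by field.
Qed.

Lemma sum3_time_space (F : 'I_(1 + n) -> 'I_(1 + n) -> 'I_(1 + n) -> R) :
  \sum_j \sum_k \sum_l F j k l =
  F T T T + \sum_l F T T (S l) + \sum_k F T (S k) T + \sum_k \sum_l F T (S k) (S l)
  + \sum_j F (S j) T T + \sum_j \sum_l F (S j) T (S l) + \sum_j \sum_k F (S j) (S k) T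
  + \sum_j \sum_k \sum_l F (S j) (S k) (S l).
Proof.
rewrite big_time_space big_time_space big_time_space.
under [X in _ + X + _]eq_bigr do rewrite big_time_space.
under [X in _ + X]eq_bigr do rewrite big_time_space big_time_space.
rewrite big_split /= !big_split /=.
under [X in _ + (_ + X)]eq_bigr do under eq_bigr do rewrite big_time_space.
under [X in _ + (_ + X)]eq_bigr do rewrite big_split.
by rewrite big_split /= !addrA.
Qed.

Lemma riemann_diag_zero x i j k : riemann G i j k k x = 0.
Proof. by have := riemann_antisym G x i j k k; lra. Qed.

Lemma curvature_warped_T x V u : W x -> curvature G x V u u 0 T =
  a (time x) * a2 (time x) *
  (inner m (pos x) (rsubmx u) (rsubmx u) * V 0 T - inner m (pos x) (rsubmx V) (rsubmx u) * u 0 T).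
Proof.
move=> Wx; rewrite curvatureE sum3_time_space riemann_diag_zero !mul0r add0r.
rewrite big1 => [|l _]; last by rewrite riemann_TTTS// !mul0r.
rewrite big1 => [|k _]; last by rewrite riemann_antisym riemann_TTTS// oppr0 !mul0r.
rewrite big1 => [|k _]; last by rewrite big1// => l _; rewrite riemann_TTSS// !mul0r.
rewrite big1 => [|j _]; last by rewrite riemann_diag_zero !mul0r.
rewrite !add0r [X in _ + X]big1 => [|j _]; last first.
  by rewrite big1// => k _; rewrite big1// => l _; rewrite riemann_TSSS// !mul0r.
rewrite addr0 mulrBr; congr (_ + _).
  rewrite innerE [in RHS]exchange_big mulr_suml mulr_sumr; apply: eq_bigr => j _.
  rewrite mulr_suml mulr_sumr; apply: eq_bigr => l _.
  by rewrite riemann_TSTS// !mxE; ring.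
rewrite innerE [in RHS]exchange_big mulr_suml mulr_sumr -sumrN; apply: eq_bigr => j _.
rewrite mulr_suml mulr_sumr -sumrN; apply: eq_bigr => k _.
by rewrite riemann_antisym riemann_TSTS// !mxE; ring.
Qed.

Lemma curvature_warped_S x V u i : W x -> curvature G x V u u 0 (S i) =
  a2 (time x) / a (time x) * (u 0 T * V 0 T * u 0 (S i) - u 0 T ^+ 2 * V 0 (S i))
  + curvature m (pos x) (rsubmx V) (rsubmx u) (rsubmx u) 0 i
  + a1 (time x) ^+ 2 * (inner m (pos x) (rsubmx u) (rsubmx u) * V 0 (S i)
                        - inner m (pos x) (rsubmx V) (rsubmx u) * u 0 (S i)).
Proof.
move=> Wx; rewrite curvatureE sum3_time_space riemann_diag_zero !mul0r add0r.
rewrite [X in _ + _ + X + _ + _ + _ + _]big1 => [|k _]; last first.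
  by rewrite big1// => l _; rewrite riemann_STSS// !mul0r.
rewrite [X in _ + _ + _ + X + _ + _ + _]big1 => [|j _]; last by rewrite riemann_diag_zero !mul0r.
rewrite [X in _ + _ + _ + _ + X + _ + _]big1 => [|j _]; last first.
  by rewrite big1// => l _; rewrite riemann_SSTS// !mul0r.
rewrite [X in _ + _ + _ + _ + _ + X + _]big1 => [|j _]; last first.
  by rewrite big1// => k _; rewrite riemann_antisym riemann_SSTS// oppr0 !mul0r.
rewrite !addr0 -[RHS]addrA; congr (_ + _).
  transitivity (\sum_q (a2 (time x) / a (time x) * (u 0 T * V 0 T * u 0 (S q)
      - u 0 T ^+ 2 * V 0 (S q))) * (q == i)%:R); last by rewrite sum_delta.
  rewrite -big_split; apply: eq_bigr => l _; rewrite [LHS]/=.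
  by rewrite (riemann_antisym G x (S i) T (S l) T) !riemann_STTS// [i == l]eq_sym; ring.
transitivity (\sum_j \sum_k \sum_l (riemann m i j k l (pos x) * u 0 (S j) * V 0 (S k) * u 0 (S l)
    + a1 (time x) ^+ 2 * ((i == k)%:R * m (pos x) l j - (i == l)%:R * m (pos x) k j)
       * u 0 (S j) * V 0 (S k) * u 0 (S l))).
  apply: eq_bigr => j _; apply: eq_bigr => k _; apply: eq_bigr => l _.
  by rewrite riemann_SSSS//; ring.
rewrite curvatureE.
under eq_bigr do under eq_bigr do rewrite big_split.
under eq_bigr do rewrite big_split.
rewrite big_split /=; congr (_ + _).
  apply: eq_bigr => j _; apply: eq_bigr => k _; apply: eq_bigr => l _.
  by rewrite ![rsubmx _ 0 _]mxE.
rewrite mulrBr.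
transitivity (\sum_j ((\sum_k (a1 (time x) ^+ 2 * V 0 (S k) *
      (\sum_l m (pos x) l j * u 0 (S l) * u 0 (S j))) * (k == i)%:R)
    - \sum_l (a1 (time x) ^+ 2 * u 0 (S l) *
      (\sum_k m (pos x) k j * V 0 (S k) * u 0 (S j))) * (l == i)%:R)).
  apply: eq_bigr => j _.
  under [X in _ = _ - X]eq_bigr do rewrite mulr_sumr mulr_suml.
  rewrite [X in _ = _ - X]exchange_big -sumrB; apply: eq_bigr => k _ /=.
  rewrite mulr_sumr mulr_suml -sumrB; apply: eq_bigr => l _.
  by rewrite ![i == _]eq_sym; ring.
under eq_bigr do rewrite !sum_delta.
have innerS (w : 'rV[R]_(1 + n)) : \sum_j \sum_l m (pos x) l j * w 0 (S l) * u 0 (S j) =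
    inner m (pos x) (rsubmx w) (rsubmx u).
  rewrite innerE exchange_big; apply: eq_bigr => l _; apply: eq_bigr => j _.
  by rewrite ![rsubmx _ 0 _]mxE.
rewrite sumrB -!mulr_sumr !innerS; ring.
Qed.

Lemma inner_warped x V Z : inner G x V Z =
  - (V 0 T * Z 0 T) + a (time x) ^+ 2 * inner m (pos x) (rsubmx V) (rsubmx Z).
Proof.
rewrite !innerE big_time_space big_time_space warped_metric_TT.
rewrite [X in _ + X + _]big1 => [|l _]; last by rewrite warped_metric_TS !mul0r.
rewrite addr0 !mulN1r mulNr; congr (_ + _); rewrite mulr_sumr; apply: eq_bigr => k _.
rewrite big_time_space warped_metric_ST !mul0r add0r mulr_sumr; apply: eq_bigr => l _.
by rewrite warped_metric_SS ![rsubmx _ 0 _]mxE !mulrA.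
Qed.

Lemma christoffel_vec_T x u v : W x -> christoffel_vec G x u v 0 T =
  a (time x) * a1 (time x) * inner m (pos x) (rsubmx u) (rsubmx v).
Proof.
move=> Wx; rewrite mxE big_time_space big_time_space christoffel_TTT// !mul0r add0r.
rewrite big1 => [|k _]; last by rewrite christoffel_TTS// !mul0r.
rewrite add0r innerE mulr_sumr; apply: eq_bigr => j _.
rewrite big_time_space christoffel_TST// !mul0r add0r mulr_sumr; apply: eq_bigr => k _.
by rewrite christoffel_TSS// ![rsubmx _ 0 _]mxE !mulrA.
Qed.

End WarpedProduct.

(** * Differentiation of the metric along a curve *)

Section AlongCurves.
Variables (R : realType) (n : nat).

Lemma is_derive_coord p (V : R -> 'rV[R]_p) (s : R) dV i :
  is_derive s (1 : R) V dV -> is_derive s (1 : R) (fun r => V r 0 i) (dV 0 i).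
Proof.
move=> [HV <-]; rewrite derive_mx// mxE; apply: derivableP.
by have /derivable_mxP := HV.
Qed.

Lemma derivable_coords p (V : R -> 'rV[R]_p) (s : R) :
  (forall i, derivable (fun r => V r 0 i) s 1) -> derivable V s 1.
Proof. by move=> H; apply/derivable_mxP => i j; rewrite ord1. Qed.

Variables (U : set 'rV[R]_n) (g : 'rV[R]_n -> 'M[R]_n).
Hypothesis oU : open U.
Hypothesis gsym : forall x, U x -> (g x)^T = g x.
Hypothesis gunit : forall x, U x -> g x \in unitmx.
Hypothesis gdiff : forall x k l, U x -> differentiable (fun y => g y k l) x.
Local Opaque partial christoffel.

Lemma inner_christoffel_vec x u v w : U x ->
  inner g x (christoffel_vec g x u v) w =
  \sum_m \sum_k \sum_j christoffel_lower g j m k x * u 0 m * v 0 k * w 0 j.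
Proof.
move=> Ux; rewrite innerE.
transitivity (\sum_i \sum_j \sum_m \sum_k g x i j * christoffel g i m k x * u 0 m * v 0 k * w 0 j).
  apply: eq_bigr => i _; apply: eq_bigr => j _.
  rewrite mxE mulr_sumr mulr_suml; apply: eq_bigr => m _.
  by rewrite mulr_sumr mulr_suml; apply: eq_bigr => k _; rewrite !mulrA.
under eq_bigr do rewrite exchange_big.
rewrite exchange_big; apply: eq_bigr => m _.
under eq_bigr do rewrite exchange_big.
rewrite exchange_big; apply: eq_bigr => k _ /=.
rewrite exchange_big; apply: eq_bigr => j _ /=.
rewrite -(christoffel_lowerE gunit j m k Ux) !mulr_suml; apply: eq_bigr => i _.
by rewrite (metric_entry_sym gsym i j Ux).
Qed.

(** The product rule; the derivative of the metric along the curve splits by [partial_metric] into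
    the two Christoffel terms that complete [dV] and [dZ] to covariant derivatives. *)
Lemma is_derive_inner (c V Z : R -> 'rV[R]_n) (s : R) u dV dZ : U (c s) ->
  is_derive s (1 : R) c u -> is_derive s (1 : R) V dV -> is_derive s (1 : R) Z dZ ->
  is_derive s (1 : R) (fun r => inner g (c r) (V r) (Z r))
   (inner g (c s) (dV + christoffel_vec g (c s) u (V s)) (Z s)
    + inner g (c s) (V s) (dZ + christoffel_vec g (c s) u (Z s))).
Proof.
move=> Uc Hc HV HZ.
have -> : (fun r => inner g (c r) (V r) (Z r)) =
    fun r => \sum_i \sum_j g (c r) i j * V r 0 i * Z r 0 j.
  by apply/funext => r; rewrite innerE.
have H : is_derive s (1 : R) (fun r => \sum_i \sum_j g (c r) i j * V r 0 i * Z r 0 j)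
  (\sum_i \sum_j (((\sum_m partial m (fun y => g y i j) (c s) * u 0 m) * V s 0 i
      + g (c s) i j * dV 0 i) * Z s 0 j + g (c s) i j * V s 0 i * dZ 0 j)).
  apply: is_derive_big => i; apply: is_derive_big => j.
  apply: is_derive_mul (is_derive_coord j HZ); apply: is_derive_mul (is_derive_coord i HV).
  exact: is_derive_curve (gdiff i j Uc) Hc.
apply: (is_derive_eq H); rewrite innerDl innerDr.
rewrite (innerC (V s) (christoffel_vec _ _ _ _) (gsym Uc)) !inner_christoffel_vec//.
transitivity (\sum_i \sum_j (g (c s) i j * dV 0 i * Z s 0 j + g (c s) i j * V s 0 i * dZ 0 j)
  + \sum_i \sum_j \sum_m partial m (fun y => g y i j) (c s) * u 0 m * V s 0 i * Z s 0 j).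
  rewrite -big_split; apply: eq_bigr => i _; rewrite -big_split; apply: eq_bigr => j _ /=.
  by rewrite -!mulr_suml mulrDl; ring.
under eq_bigr do rewrite big_split.
rewrite big_split /= -!innerE -!addrA; congr (_ + _); rewrite [RHS]addrCA; congr (_ + _).
under eq_bigr do rewrite exchange_big.
rewrite exchange_big -big_split; apply: eq_bigr => m _ /=.
rewrite [X in _ = _ + X]exchange_big -big_split; apply: eq_bigr => i _.
rewrite -big_split; apply: eq_bigr => j _ /=.
by rewrite (partial_metric oU gsym m i j Uc); ring.
Qed.

Lemma derivable_christoffel_vec (c u V : R -> 'rV[R]_n) (s : R) :
  (forall i j k, differentiable (christoffel g i j k) (c s)) ->
  derivable c s 1 -> derivable u s 1 -> derivable V s 1 ->
  derivable (fun r => christoffel_vec g (c r) (u r) (V r)) s 1.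
Proof.
move=> dG /derivableP Hc /derivableP Hu /derivableP HV; apply: derivable_coords => i.
have -> : (fun r => christoffel_vec g (c r) (u r) (V r) 0 i) =
    fun r => \sum_j \sum_k christoffel g i j k (c r) * u r 0 j * V r 0 k.
  by apply/funext => r; rewrite mxE.
have H : is_derive s (1 : R) (fun r => \sum_j \sum_k christoffel g i j k (c r) * u r 0 j * V r 0 k)
  (\sum_j \sum_k (((\sum_m partial m (christoffel g i j k) (c s) * ('D_1 c s) 0 m) * u s 0 j
      + christoffel g i j k (c s) * ('D_1 u s) 0 j) * V s 0 k
      + christoffel g i j k (c s) * u s 0 j * ('D_1 V s) 0 k)).
  apply: is_derive_big => j; apply: is_derive_big => k.
  apply: is_derive_mul (is_derive_coord k HV); apply: is_derive_mul (is_derive_coord j Hu).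
  exact: is_derive_curve (dG i j k) Hc.
by have [] := H.
Qed.

End AlongCurves.

(** * Monotonicity on a segment from the sign of the derivative *)

Section OneVariable.
Variable R : realType.
Implicit Types (f df g : R -> R) (s t : R).

Lemma is_derive_chain f g s (k l : R) : is_derive (g s) (1 : R) f k ->
  is_derive s (1 : R) g l -> is_derive s (1 : R) (fun r => f (g r)) (k * l).
Proof. by move=> Hf Hg; exact: is_derive1_comp. Qed.

Lemma nondecreasing_segment f df s t : s <= t ->
  (forall x, s <= x <= t -> is_derive x (1 : R) f (df x)) ->
  (forall x, s <= x <= t -> 0 <= df x) -> f s <= f t.
Proof.
move=> st Hf df0; have [||c + E] := @MVT_segment R f df s t st.
- by move=> x /itvP H; apply: Hf; rewrite !H.
- apply: derivable_within_continuous => x /itvP H.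
  by have /Hf[] : s <= x <= t by rewrite !H.
rewrite in_itv /= => ct; rewrite -subr_ge0 E mulr_ge0 ?df0//.
by rewrite subr_ge0.
Qed.

Lemma constant_segment f s t : s <= t ->
  (forall x, s <= x <= t -> is_derive x (1 : R) f 0) -> f s = f t.
Proof.
move=> st Hf; apply/eqP; rewrite eq_le (nondecreasing_segment st Hf)//=.
rewrite -lerN2; apply: (@nondecreasing_segment (fun x => - f x) (fun=> - 0)) => //.
by move=> x /Hf; exact: is_derive_opp.
Qed.

Lemma near_right0 (P : R -> Prop) : (\forall t \near 0^'+, P t) ->
  exists2 d, 0 < d & forall t, 0 < t < d -> P t.
Proof.
move=> /nbhs_ballP[d /= d0 Hd]; exists d => // t /andP[t0 td].
by apply: Hd => //; rewrite -ball_normE /= sub0r normrN gtr0_norm.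
Qed.

End OneVariable.

(** * Scalar Jacobi equations along a geodesic and their solutions near the singularity *)

Section EvolutionAlongGeodesic.
Variables (R : realType) (D : set R) (T : R -> R) (a : R -> R) (C epsn kappa : R).
Local Notation a1 := (derive1 a).
Local Notation a2 := (derive1n 2 a).
Hypothesis Dint : is_interval D.
Hypothesis a_gt0 : forall t : R, 0 < t -> 0 < a t.
Hypothesis a_derive : forall t : R, 0 < t -> is_derive t (1 : R) a (a1 t).
Hypothesis a_derive2 : forall t : R, 0 < t -> is_derive t (1 : R) a1 (a2 t).
Hypothesis (C0 : 0 < C) (epsn0 : epsn <= 0).

(** [S] is a dt/dtau; in the timelike case it is sqrt (C + a^2), the positive solution of the radial
    equation. *)
Let S s := Num.sqrt (C - epsn * a (T s) ^+ 2).
Let A s := a (T s).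
Hypothesis T0 : forall s, D s -> 0 < T s.
Hypothesis T_derive : forall s, D s -> is_derive s (1 : R) T (S s / A s).

Let Apos s : D s -> 0 < A s. Proof. by move=> Ds; rewrite a_gt0// T0. Qed.
Let Sarg s : D s -> 0 < C - epsn * a (T s) ^+ 2.
Proof. by move=> Ds; rewrite subr_gt0 (le_lt_trans _ C0)// mulr_le0_ge0// sqr_ge0. Qed.
Let Spos s : D s -> 0 < S s. Proof. by move=> Ds; rewrite sqrtr_gt0 Sarg. Qed.
Let SS s : D s -> S s ^+ 2 = C - epsn * A s ^+ 2.
Proof. by move=> Ds; rewrite sqr_sqrtr// ltW// Sarg. Qed.
Let sqrtC_le s : D s -> Num.sqrt C <= S s.
Proof. by move=> Ds; rewrite ler_wsqrtr// lerBrDr gerDl mulr_le0_ge0// sqr_ge0. Qed.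

Lemma D_segment s t x : D s -> D t -> s <= x <= t -> D x.
Proof. by move=> Ds Dt sxt; exact: Dint Ds Dt _ sxt. Qed.

Lemma T_le s t : D s -> D t -> s <= t -> T s <= T t.
Proof.
move=> Ds Dt st; apply: (nondecreasing_segment st (df := fun s => S s / A s)).
  by move=> x /(D_segment Ds Dt)/T_derive.
by move=> x /(D_segment Ds Dt) Dx; rewrite divr_ge0 ?ltW ?Spos ?Apos.
Qed.

Lemma T_lt_reflect s t : D s -> D t -> T s < T t -> s <= t.
Proof. by move=> Ds Dt; case: (leP s t) => // /ltW /(T_le Dt Ds); rewrite leNgt => /negPf->. Qed.

Let A_derive s : D s -> is_derive s (1 : R) A (a1 (T s) * (S s / A s)).
Proof. by move=> Ds; exact: is_derive_chain (a_derive (T0 Ds)) (T_derive Ds). Qed.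

Let A1_derive s : D s -> is_derive s (1 : R) (fun r => a1 (T r)) (a2 (T s) * (S s / A s)).
Proof. by move=> Ds; exact: is_derive_chain (a_derive2 (T0 Ds)) (T_derive Ds). Qed.

Let S_derive s : D s -> is_derive s (1 : R) S (- epsn * a1 (T s)).
Proof.
move=> Ds; have s0 := Sarg Ds; have Sp := Spos Ds; have Ap := Apos Ds.
have H1 := is_derive_sub (is_derive_const C s (1 : R))
  (is_derive_scale epsn (is_derive_mul (A_derive Ds) (A_derive Ds))).
have H2 : is_derive (C - epsn * (A s * A s)) (1 : R) Num.sqrt (2 * S s)^-1.
  exact: is_derive1_sqrt.
have -> : S = fun r => Num.sqrt (C - epsn * (A r * A r)) by apply/funext => r; rewrite /S expr2.
have H3 := @is_derive_chain R Num.sqrt (fun r => C - epsn * (A r * A r)) s _ _ H2 H1.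
apply: (is_derive_eq H3).
by field; rewrite !gt_eqF.
Qed.

(** The transverse eigenvalue of V |-> R(V, gamma') gamma'. The factor C / a^2 - epsn is (dt/dtau)^2
    and comes with planes containing the time direction; C / a^4 is the squared norm of the spatial
    velocity for [h] and comes with spatial planes. *)
Definition transverse_coeff t := - (a2 t / a t) * (C / a t ^+ 2 - epsn)
  + (kappa + a1 t ^+ 2) * (C / a t ^+ 4).

Section Transverse.
Variables (Y Y1 : R -> R).
Hypothesis Y_derive : forall s, D s -> is_derive s (1 : R) Y (Y1 s).
Hypothesis Y1_derive : forall s, D s ->
  is_derive s (1 : R) Y1 (- transverse_coeff (T s) * Y s).

(** [rho] is dchi/dtau and [q1] is dq/dchi, so that q'' = - kappa q becomes the first-order system
    of [q_derive] and [q1_derive]. *)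
Let q s := Y s / A s.
Let q1 s := (Y1 s * A s - Y s * (a1 (T s) * (S s / A s))) / Num.sqrt C.
Let rho s := Num.sqrt C / A s ^+ 2.

Let rC : 0 < Num.sqrt C. Proof. by rewrite sqrtr_gt0. Qed.

Let q_derive s : D s -> is_derive s (1 : R) q (rho s * q1 s).
Proof.
move=> Ds; have Ap := Apos Ds.
have H := is_derive_mul (Y_derive Ds) (is_derive_inv (lt0r_neq0 Ap) (A_derive Ds)).
by apply: (is_derive_eq H); rewrite /rho /q1; field; rewrite !gt_eqF.
Qed.

Let q1_derive s : D s -> is_derive s (1 : R) q1 (- kappa * rho s * q s).
Proof.
move=> Ds; have Ap := Apos Ds; have Sp := Spos Ds.
have HA := is_derive_mul (A1_derive Ds)
  (is_derive_mul (S_derive Ds) (is_derive_inv (lt0r_neq0 Ap) (A_derive Ds))).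
have H := is_derive_scale (Num.sqrt C)^-1 (is_derive_sub
  (is_derive_mul (Y1_derive Ds) (A_derive Ds)) (is_derive_mul (Y_derive Ds) HA)).
have E : q1 = fun r => (Num.sqrt C)^-1 * (Y1 r * A r - Y r * (a1 (T r) * (S r / A r))).
  by apply/funext => r; rewrite /q1 mulrC.
rewrite E; apply: (is_derive_eq H); rewrite /rho /q /transverse_coeff -/(A s).
(* Writing C and epsn rationally in sqrt C, [S] and [A] removes the relation between these
   quantities and leaves an identity of rational functions. *)
have CC : C = Num.sqrt C ^+ 2 by rewrite sqr_sqrtr// ltW.
have eE : epsn = (C - S s ^+ 2) / A s ^+ 2 by rewrite SS//; field; rewrite gt_eqF.
move: CC eE; move: (Num.sqrt C) rC (S s) Sp (A s) Ap => c c0 S' S0 A' A0 CC eE.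
rewrite eE CC.
by field; rewrite !gt_eqF.
Qed.

Let rho_ge0 s : D s -> 0 <= rho s.
Proof. by move=> Ds; rewrite divr_ge0// ?ltW// exprn_gt0 ?Apos. Qed.

(** This is dchi <= dt / a, which holds because epsn <= 0; it turns bounds in the affine parameter
    into bounds in t. *)
Let rho_le s : D s -> rho s <= S s / A s / A s.
Proof.
move=> Ds; rewrite /rho -mulrA -invfM -expr2 ler_wpM2r ?sqrtC_le//.
by rewrite invr_ge0 ltW// exprn_gt0 ?Apos.
Qed.

Let YE s : D s -> Y s = A s * q s.
Proof. by move=> Ds; rewrite /q mulrCA divff ?mulr1// gt_eqF// Apos. Qed.

Hypothesis T_small : forall d, 0 < d -> exists2 s, D s & T s < d.
Hypothesis a_to0 : forall e, 0 < e -> \forall t \near 0^'+, a t < e.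

(** The limit is taken along small values of the time [T s], so that the end of [D] corresponding to
    the singularity need not be named. *)
Definition vanishes_at_singularity (Z : R -> R) :=
  forall e, 0 < e -> exists2 d, 0 < d & forall s, D s -> T s < d -> `|Z s| < e.

Let vanish_of_sqr (Phi : R -> R) sigma : D sigma ->
  (forall e, 0 < e -> \forall t \near 0^'+, Phi t < e) ->
  (forall s, D s -> s <= sigma -> Y s ^+ 2 <= Phi (T s)) ->
  vanishes_at_singularity Y.
Proof.
move=> Dsg Phi0 H e e0.
have [d d0 Hd] := near_right0 (Phi0 _ (exprn_gt0 2 e0)).
exists (Num.min d (T sigma)); first by rewrite lt_min d0 T0.
move=> s Ds; rewrite lt_min => /andP[sd ss].
rewrite -(ltr_pXn2r (n := 2))// ?nnegrE ?(ltW e0)// real_normK ?num_real//.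
apply: le_lt_trans (H s Ds (T_lt_reflect Ds Dsg ss)) _.
by apply: Hd; rewrite T0.
Qed.

(** The oscillator energy q1^2 + kappa q^2 is conserved, so q^2 is at most E / kappa. *)
Lemma transverse_vanish_pos : 0 < kappa -> vanishes_at_singularity Y.
Proof.
move=> k0; have [sg Dsg _] := T_small ltr01.
pose E s := q1 s * q1 s + kappa * (q s * q s).
have EE s : D s -> s <= sg -> E s = E sg.
  move=> Ds ss; apply: constant_segment => // x /(D_segment Ds Dsg) Dx.
  have H := is_derive_add (is_derive_mul (q1_derive Dx) (q1_derive Dx))
    (is_derive_scale kappa (is_derive_mul (q_derive Dx) (q_derive Dx))).
  by apply: (is_derive_eq H); ring.
have E0 : 0 <= E sg by rewrite /E; have := sqr_ge0 (q1 sg); have := sqr_ge0 (q sg); nra.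
apply: (@vanish_of_sqr (fun t => a t ^+ 2 * (E sg / kappa)) sg Dsg); last first.
  move=> s Ds ss; rewrite (YE Ds) exprMn ler_wpM2l ?sqr_ge0//.
  rewrite ler_pdivlMr// -(EE s Ds ss) /E; have := sqr_ge0 (q1 s); nra.
(* With M = E / kappa, the bounds a < 1 and a < e / (M + 1) give a^2 M < e; the added 1 covers M =
   0. *)
move=> e e0; have e1 : 0 < e / (E sg / kappa + 1).
  by rewrite divr_gt0// ltr_wpDl// divr_ge0// ltW.
near=> t; have t0 : 0 < t by near: t; exact: nbhs_right_gt.
have At0 := a_gt0 t0.
have At1 : a t < 1 by near: t; exact: a_to0.
have Ate : a t < e / (E sg / kappa + 1) by near: t; exact: a_to0.
rewrite ltr_pdivlMr in Ate; last by rewrite ltr_wpDl// divr_ge0// ltW.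
apply: le_lt_trans Ate; rewrite expr2 -mulrA ler_pM2l//.
have : 0 <= E sg / kappa by rewrite divr_ge0// ltW.
by move: (E sg / kappa) => M M0; nra.
Unshelve. all: by end_near. Qed.

Hypothesis a_incr : exists2 d, 0 < d & forall t t', 0 < t -> t <= t' -> t' < d -> a t <= a t'.

(** Here |q1| is a constant b. Since a is nondecreasing, 1 / a on [s, sg] is at most 1 / a(s), so q
    changes by at most b T(sg) / a(s) between s and sg. After multiplication by a(s) this is b
    T(sg), made small by the choice of sg; the remaining a(s) |q(sg)| is made small by the choice of
    s. *)
Lemma transverse_vanish_flat : kappa = 0 -> vanishes_at_singularity Y.
Proof.
move=> k0 e e0; have [sg0 Dsg0 _] := T_small ltr01; have [d d0 Hd] := a_incr.
(* The constant is read off at an auxiliary point [sg0], since the choice of [sg] depends on it. *)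
pose b := `|q1 sg0|.
have b0 : 0 <= b by rewrite normr_ge0.
have e2 : 0 < e / 2 / (b + 1) by rewrite !divr_gt0// ltr_wpDl.
have mn : 0 < Num.min (T sg0) (Num.min d (e / 2 / (b + 1))) by rewrite !lt_min T0// d0 e2.
have [sg Dsg] := T_small mn; rewrite !lt_min => /and3P[sg1 sg2 sg3].
have q1E s : D s -> s <= sg -> `|q1 s| = b.
  move=> Ds ss; congr (`| _ |); apply: constant_segment.
    by apply: le_trans ss _; exact: T_lt_reflect.
  move=> x /(D_segment Ds Dsg0) Dx; apply: (is_derive_eq (q1_derive Dx)).
  by rewrite k0 oppr0 !mul0r.
have qb s : D s -> s <= sg -> `|q s - q sg| <= b / A s * T sg.
  move=> Ds ss; have Ap := Apos Ds.
  have dq x : s <= x <= sg -> `|rho x * q1 x| <= b / A s * (S x / A x).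
    move=> xs; have Dx := D_segment Ds Dsg xs; have /andP[sx xsg] := xs.
    rewrite normrM q1E// mulrC -mulrA ler_wpM2l// ger0_norm ?rho_ge0//.
    apply: le_trans (rho_le Dx) _; rewrite [leRHS]mulrC ler_wpM2l//.
      by rewrite divr_ge0 ?ltW ?Spos ?Apos.
    rewrite lef_pV2 ?posrE ?Apos// Hd ?T0//; first exact: T_le.
    by apply: le_lt_trans sg2; exact: T_le.
  (* The slope b / a(s) is frozen at the left end, so that a linear function of T dominates q in
     both directions. *)
  have up : b / A s * T s - q s <= b / A s * T sg - q sg.
    apply: (@nondecreasing_segment _ (fun r => b / A s * T r - q r)
      (fun r => b / A s * (S r / A r) - rho r * q1 r)) => //.
      move=> x /(D_segment Ds Dsg) Dx.
      exact: is_derive_sub (is_derive_scale _ (T_derive Dx)) (q_derive Dx).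
    by move=> x xs; rewrite subr_ge0 (le_trans (ler_norm _))// dq.
  have lo : b / A s * T s + q s <= b / A s * T sg + q sg.
    apply: (@nondecreasing_segment _ (fun r => b / A s * T r + q r)
      (fun r => b / A s * (S r / A r) + rho r * q1 r)) => //.
      move=> x /(D_segment Ds Dsg) Dx.
      exact: is_derive_add (is_derive_scale _ (T_derive Dx)) (q_derive Dx).
    move=> x xs; rewrite -[X in _ + X]opprK subr_ge0 (le_trans (ler_norm _))// normrN dq//.
  have : 0 <= b / A s * T s by apply: mulr_ge0; [apply: divr_ge0 => //; exact: ltW|exact/ltW/T0].
  by rewrite ler_norml; lra.
have e4 : 0 < e / 2 / (`|q sg| + 1) by rewrite !divr_gt0// ltr_wpDl.
have [d' d'0 Hd'] := near_right0 (a_to0 e4).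
exists (Num.min d' (T sg)); first by rewrite lt_min d'0 T0.
move=> s Ds; rewrite lt_min => /andP[sd ss].
have {}ss := T_lt_reflect Ds Dsg ss; have Ap := Apos Ds.
have : A s < e / 2 / (`|q sg| + 1) by apply: Hd'; rewrite T0.
rewrite ltr_pdivlMr ?ltr_wpDl// => Ae.
rewrite (YE Ds) normrM gtr0_norm//.
have h1 : `|q s| <= `|q sg| + b / A s * T sg.
  by rewrite -[q s](subrK (q sg)) addrC (le_trans (ler_normD _ _))// lerD2l qb.
apply: (@le_lt_trans _ _ (A s * (`|q sg| + b / A s * T sg))); first by rewrite ler_pM2l.
have -> : A s * (`|q sg| + b / A s * T sg) = A s * `|q sg| + b * T sg.
  by field; rewrite gt_eqF.
rewrite [ltRHS]splitr; apply: ltr_leD.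
  by apply: le_lt_trans Ae; rewrite ler_pM2l// lerDl.
rewrite ltr_pdivlMr ?ltr_wpDl// in sg3.
by apply: le_trans (ltW sg3); rewrite mulrC ler_wpM2l ?lerDl// ltW ?T0.
Qed.

Section LogarithmicBound.
Hypothesis a_ge : \forall t \near 0^'+, t * - ln t <= a t.
Hypothesis a_log : forall (K : nat) e, 0 < e -> \forall t \near 0^'+, a t ^+ 2 * (- ln t) ^+ K < e.

(** A Gronwall estimate for F = q^2 + q1^2, whose derivative is at most K rho F in absolute value.
    As a >= t L with L = - ln t, rho is at most the rate at which ln L decreases along the geodesic.
    So F / L^K is nondecreasing, F is at most M L^K towards the singularity, and a^2 L^K tends to
    0. *)
Lemma transverse_vanish_log : vanishes_at_singularity Y.
Proof.
have [d d0 Hd] := near_right0 a_ge.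
have mn : 0 < Num.min d 1 by rewrite lt_min d0 ltr01.
have [sg Dsg] := T_small mn; rewrite lt_min => /andP[sgd sg1].
(* [K] bounds the factor |1 - kappa| of dF; a natural number keeps L^K an ordinary power. *)
have [K HK] : exists K : nat, 1 + `|kappa| <= K%:R.
  by exists (Num.bound (1 + `|kappa|)); rewrite ltW// archi_boundP// addr_ge0.
pose L s := - ln (T s).
pose F s := q s * q s + q1 s * q1 s.
pose dF s := 2 * rho s * (1 - kappa) * (q s * q1 s).
have F_derive s : D s -> is_derive s (1 : R) F (dF s).
  move=> Ds; have H := is_derive_add (is_derive_mul (q_derive Ds) (q_derive Ds))
    (is_derive_mul (q1_derive Ds) (q1_derive Ds)).
  by apply: (is_derive_eq H); rewrite /dF; ring.
have F0 s : 0 <= F s by rewrite /F; have := sqr_ge0 (q1 s); have := sqr_ge0 (q s); nra.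
have Lpos s : D s -> s <= sg -> 0 < L s.
  move=> Ds ss; rewrite /L oppr_gt0 ln_lt0// T0//=.
  by apply: le_lt_trans sg1; exact: T_le.
have L_derive s : D s -> is_derive s (1 : R) L (- ((T s)^-1 * (S s / A s))).
  move=> Ds; apply: is_derive_opp; apply: is_derive_chain (T_derive Ds).
  by apply: is_derive1_ln; exact: T0.
have dFb s : D s -> s <= sg -> - dF s <= K%:R * F s * ((T s)^-1 * (S s / A s) / L s).
  move=> Ds ss; have Lp := Lpos s Ds ss; have Tp := T0 Ds; have Ap := Apos Ds; have Sp := Spos Ds.
  have r1 : rho s <= (T s)^-1 * (S s / A s) / L s.
    apply: le_trans (rho_le Ds) _.
    have -> : (T s)^-1 * (S s / A s) / L s = S s / A s * (T s * L s)^-1.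
      by field; rewrite !gt_eqF.
    rewrite ler_pM2l ?divr_gt0// lef_pV2 ?posrE ?mulr_gt0//; apply: Hd; rewrite Tp /=.
    by apply: le_lt_trans sgd; exact: T_le.
  have r0 := rho_ge0 Ds.
  have k1 : `|1 - kappa| <= K%:R by rewrite (le_trans (ler_normB _ _))// normr1.
  have qq : 2 * `|q s * q1 s| <= F s.
    rewrite normrM /F -[q s * q s]ger0_norm -?expr2 ?sqr_ge0// -[q1 s ^+ 2]ger0_norm ?sqr_ge0//.
    rewrite !normrX; have := sqr_ge0 (`|q s| - `|q1 s|); nra.
  apply: (@le_trans _ _ (rho s * (K%:R * F s))); last first.
    by rewrite mulrC ler_wpM2l// mulr_ge0.
  rewrite (le_trans (ler_norm _))// normrN /dF.
  have -> : `|2 * rho s * (1 - kappa) * (q s * q1 s)| =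
     rho s * (`|1 - kappa| * (2 * `|q s * q1 s|)).
    move: (rho s) r0 => r r0; move: (q s * q1 s) (1 - kappa) => x y.
    by rewrite !normrM (ger0_norm r0) (@ger0_norm _ 2)//; ring.
  by rewrite ler_wpM2l// ler_pM// mulr_ge0.
pose M := F sg * (L sg)^-1 ^+ K.
have FM s : D s -> s <= sg -> F s * (L s)^-1 ^+ K <= M.
  move=> Ds ss; pose dG r := dF r * (L r)^-1 ^+ K
     + F r * (K%:R * (L r)^-1 ^+ K * ((T r)^-1 * (S r / A r) / L r)).
  apply: (@nondecreasing_segment _ (fun r => F r * (L r)^-1 ^+ K) dG) => //.
    move=> x xs; have Dx := D_segment Ds Dsg xs; have /andP[_ xsg] := xs.
    have Lp := Lpos x Dx xsg.
    have H1 := is_derive_inv (lt0r_neq0 Lp) (L_derive x Dx).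
    have H2 : is_derive x (1 : R) (fun r => (L r)^-1 ^+ K)
       (K%:R * (L x)^-1 ^+ K * ((T x)^-1 * (S x / A x) / L x)).
      apply: (is_derive_eq (is_derive_exp K H1)).
      case: (K) => [|k]; first by rewrite !mul0r.
      rewrite [_.+1.-1]/= [_ ^+ k.+1]exprS; move: ((L x)^-1 ^+ k) => Z.
      by have Tp := T0 Dx; have Ap := Apos Dx; field; rewrite !gt_eqF.
    exact: is_derive_mul (F_derive x Dx) H2.
  move=> x xs; have Dx := D_segment Ds Dsg xs; have /andP[_ xsg] := xs.
  have := dFb x Dx xsg; have Lk : 0 <= (L x)^-1 ^+ K by rewrite exprn_ge0// invr_ge0 ltW// Lpos.
  rewrite /dG; set B := _ / L x => H.
  have -> : dF x * (L x)^-1 ^+ K + F x * (K%:R * (L x)^-1 ^+ K * B) =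
    (L x)^-1 ^+ K * (K%:R * F x * B + dF x) by ring.
  by rewrite mulr_ge0//; lra.
have M0 : 0 <= M by rewrite mulr_ge0// exprn_ge0// invr_ge0 ltW// Lpos.
apply: (@vanish_of_sqr (fun t => (M + 1) * (a t ^+ 2 * (- ln t) ^+ K)) sg Dsg).
  move=> e e0; have e1 : 0 < e / (M + 1) by rewrite divr_gt0// ltr_wpDl.
  near=> t; rewrite mulrC -ltr_pdivlMr ?ltr_wpDl//.
  by near: t; exact: a_log.
move=> s Ds ss; have Lp := Lpos s Ds ss.
have h1 : q s ^+ 2 <= F s by rewrite /F; have := sqr_ge0 (q1 s); nra.
have h2 : F s <= M * L s ^+ K.
  by have := FM s Ds ss; rewrite exprVn ler_pdivrMr ?exprn_gt0.
rewrite (YE Ds) exprMn /= -/(L s) [leRHS]mulrCA ler_wpM2l ?sqr_ge0//.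
apply: (le_trans h1); apply: (le_trans h2); rewrite ler_wpM2r ?exprn_ge0 ?(ltW Lp)//.
by rewrite lerDl.
Unshelve. all: by end_near. Qed.

End LogarithmicBound.
End Transverse.

Section Radial.
Variables (Y Y1 : R -> R).
Hypothesis epsnN1 : epsn = -1.
Hypothesis Y_derive : forall s, D s -> is_derive s (1 : R) Y (Y1 s).
Hypothesis Y1_derive : forall s, D s ->
  is_derive s (1 : R) Y1 (a2 (T s) / A s * Y s).
Hypothesis T_small : forall d, 0 < d -> exists2 s, D s & T s < d.
Hypothesis a_to0 : forall e, 0 < e -> \forall t \near 0^'+, a t < e.

(** The quotient z = Y / S has derivative w / S^2 with w the constant Wronskian. This is at most |w|
    / C and, since a <= S, at most b dt/dtau; hence z varies by at most b T(sg). The solution [S] is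
    itself bounded by sqrt (C + 1) once a < 1. *)
Lemma radial_bounded : exists M d : R, 0 < d /\
  forall s, D s -> T s < d -> `|Y s| <= M.
Proof.
have [d d0 Hd] := near_right0 (a_to0 ltr01).
have [sg Dsg sgd] := T_small d0.
pose w s := Y1 s * S s - Y s * a1 (T s).
have S1_derive s : D s -> is_derive s (1 : R) S (a1 (T s)).
  by move=> Ds; apply: (is_derive_eq (S_derive Ds)); rewrite epsnN1 opprK mul1r.
have wE s : D s -> s <= sg -> w s = w sg.
  move=> Ds ss; apply: constant_segment => // x /(D_segment Ds Dsg) Dx.
  have H := is_derive_sub (is_derive_mul (Y1_derive Dx) (S1_derive x Dx))
    (is_derive_mul (Y_derive Dx) (A1_derive Dx)).
  by apply: (is_derive_eq H); ring.
pose z s := Y s / S s.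
have z_derive s : D s -> is_derive s (1 : R) z (w s / S s ^+ 2).
  move=> Ds; have Sp := Spos Ds.
  have H := is_derive_mul (Y_derive Ds) (is_derive_inv (lt0r_neq0 Sp) (S1_derive s Ds)).
  by apply: (is_derive_eq H); rewrite /w; field; rewrite gt_eqF.
pose b := `|w sg| / C.
have b0 : 0 <= b by rewrite divr_ge0// ltW.
have zb s : D s -> s <= sg -> `|w s / S s ^+ 2| <= b * (S s / A s).
  move=> Ds ss; have Sp := Spos Ds; have Ap := Apos Ds.
  have S2 := SS Ds; rewrite epsnN1 in S2.
  rewrite normrM wE// /b -mulrA ler_wpM2l// ger0_norm ?invr_ge0 ?sqr_ge0//.
  apply: (@le_trans _ _ C^-1).
    by rewrite lef_pV2 ?posrE ?exprn_gt0// S2; nra.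
  apply: ler_peMr; first by rewrite invr_ge0 ltW.
  rewrite ler_pdivlMr// mul1r.
  have : A s ^+ 2 <= S s ^+ 2 by rewrite S2 mulN1r opprK lerDr ltW.
  by rewrite ler_pXn2r// nnegrE ltW.
exists (Num.sqrt (C + 1) * (`|z sg| + b * T sg)), (T sg); split; first exact: T0.
move=> s Ds ts; have ss := T_lt_reflect Ds Dsg ts; have Sp := Spos Ds; have Ap := Apos Ds.
have up : b * T s - z s <= b * T sg - z sg.
  apply: (@nondecreasing_segment _ (fun r => b * T r - z r)
    (fun r => b * (S r / A r) - w r / S r ^+ 2)) => //.
    move=> x /(D_segment Ds Dsg) Dx.
    exact: is_derive_sub (is_derive_scale _ (T_derive Dx)) (z_derive x Dx).
  move=> x xs; have Dx := D_segment Ds Dsg xs; have /andP[_ xsg] := xs.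
  by rewrite subr_ge0 (le_trans (ler_norm _))// zb.
have lo : b * T s + z s <= b * T sg + z sg.
  apply: (@nondecreasing_segment _ (fun r => b * T r + z r)
    (fun r => b * (S r / A r) + w r / S r ^+ 2)) => //.
    move=> x /(D_segment Ds Dsg) Dx.
    exact: is_derive_add (is_derive_scale _ (T_derive Dx)) (z_derive x Dx).
  move=> x xs; have Dx := D_segment Ds Dsg xs; have /andP[_ xsg] := xs.
  by rewrite -[X in _ + X]opprK subr_ge0 (le_trans (ler_norm _))// normrN zb.
have bT : 0 <= b * T s by rewrite mulr_ge0// ltW// T0.
have zs : `|z s| <= `|z sg| + b * T sg.
  by have /ler_normlP[] := lexx `|z sg|; rewrite ler_norml; lra.
have -> : Y s = S s * z s by rewrite /z mulrCA divff ?mulr1// gt_eqF.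
rewrite normrM (gtr0_norm Sp); apply: ler_pM => //; first exact: ltW.
have A1 : A s < 1 by apply: Hd; rewrite T0//= (lt_trans ts).
by rewrite /S; apply: ler_wsqrtr; rewrite epsnN1 -/(A s); nra.
Qed.

End Radial.
End EvolutionAlongGeodesic.

(** * Powers against logarithms near 0 *)

Section LogarithmNearZero.
Variable R : realType.
Implicit Types (t M : R).

Lemma near_log_gt M : \forall t \near (0 : R)^'+, M < - ln t.
Proof.
have /cvgrNyPlt/(_ (- M)) H := @lnNy R.
by near=> t; rewrite ltrNr; near: t.
Unshelve. all: by end_near. Qed.

(** The power splits into K + 1 factors t^b. Each of K of them absorbs one logarithm, because - b ln
    t <= t^(-b), and the last one tends to 0. *)
Lemma near_powR_log (alpha : R) (K : nat) e : 0 < alpha -> 0 < e ->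
  \forall t \near (0 : R)^'+, t `^ alpha * (- ln t) ^+ K < e.
Proof.
move=> al0 e0; pose b := alpha / K.+1%:R.
have b0 : 0 < b by rewrite divr_gt0// ltr0n.
have c0 : 0 < e * b ^+ K by rewrite mulr_gt0// exprn_gt0.
have nb : \forall t \near (0 : R)^'+, t `^ b < e * b ^+ K.
  move: (e * b ^+ K) c0 => z z0; have := @powR_cvg0 R b b0.
  move=> /cvgrPdist_lt/(_ z z0); apply: filterS => t.
  by rewrite sub0r normrN ger0_norm// powR_ge0.
near=> t.
have t0 : 0 < t by near: t; exact: nbhs_right_gt.
have L0 : 0 < - ln t by near: t; exact: near_log_gt.
have tb : t `^ b < e * b ^+ K by near: t.
have Lb : b * - ln t <= (t `^ b)^-1.
  rewrite -powRN mulrN -mulNr -ln_powR ltW// ln_sublinear//.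
  exact: powR_gt0.
have tp : 0 < t `^ b by exact: powR_gt0.
have al : t `^ alpha = t `^ b * (t `^ b) ^+ K.
  rewrite -exprS -powR_mulrn ?powR_ge0// -powRrM /b divfK//.
have LK : (b * - ln t) ^+ K <= (t `^ b)^-1 ^+ K.
  by rewrite lerXn2r// nnegrE ?invr_ge0 ?ltW// mulr_gt0.
rewrite al -(ltr_pM2r (exprn_gt0 K b0)); apply: le_lt_trans tb.
rewrite -!mulrA -[leRHS]mulr1 ler_pM2l// -exprMn [- ln t * b]mulrC.
apply: (@le_trans _ _ ((t `^ b) ^+ K * (t `^ b)^-1 ^+ K)).
  by rewrite ler_wpM2l// exprn_ge0// ltW.
by rewrite -exprMn divff ?expr1n// gt_eqF.
Unshelve. all: by end_near. Qed.

End LogarithmNearZero.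

(** * Asymptotics of a = t^p (- ln t), p = 1 / eps, of its derivatives, of the bracket and of f *)

Section LogScaleFactor.
Variables (R : realType) (p : R) (a : R -> R).
Implicit Types (t y x e : R).
Local Notation a1 := (derive1 a).
Local Notation a2 := (derive1n 2 a).
Local Notation L t := (- ln t).
Hypothesis p0 : 0 < p.
Hypothesis a_log_form : exists2 delta : R, 0 < delta < 1 &
  forall t, 0 < t < delta -> a t = - (t `^ p * ln t).

Lemma near_scale_factorE : \forall t \near 0^'+, [/\ 0 < t < 1, a t = t `^ p * L t,
  a1 t = t `^ p / t * (p * L t - 1) &
  a2 t = t `^ p / t ^+ 2 * (p * (p - 1) * L t - (2 * p - 1))].
Proof.
have [delta /andP[d0 d1] Ha] := a_log_form.
have pw t : 0 < t -> is_derive t (1 : R) (fun y => y `^ p) (p * (t `^ p / t)).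
  move=> t0; apply: (is_derive_eq (is_derive1_powR p t0)).
  rewrite powRB; first by rewrite powRr1// ltW.
  by apply/implyP => _; rewrite gt_eqF.
have nearI t (P : R -> Prop) : 0 < t < delta -> (forall y, 0 < y < delta -> P y) ->
    \forall y \near t, P y.
  move=> td HP; near=> y; apply: HP.
  have : y \in `]0, delta[ by near: y; apply: near_in_itvoo; rewrite in_itv.
  by rewrite in_itv.
have D1 t : 0 < t < delta -> is_derive t (1 : R) a (t `^ p / t * (p * L t - 1)).
  move=> td; have /andP[t0 _] := td.
  apply: (@near_eq_is_derive _ _ _ (fun y => - (y `^ p * ln y))).
    by apply: nearI td _ => y yd; rewrite Ha.
  apply: (is_derive_eq (is_derive_opp (is_derive_mul (pw t t0) (is_derive1_ln t0)))).
  by field; rewrite gt_eqF.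
have E1 t : 0 < t < delta -> a1 t = t `^ p / t * (p * L t - 1).
  by move=> /D1 H; rewrite derive1E; exact: derive_val.
have D2 t : 0 < t < delta ->
    is_derive t (1 : R) a1 (t `^ p / t ^+ 2 * (p * (p - 1) * L t - (2 * p - 1))).
  move=> td; have /andP[t0 _] := td.
  apply: (@near_eq_is_derive _ _ _ (fun y => y `^ p * y^-1 * (p * - ln y - 1))).
    by apply: nearI td _ => y yd; rewrite E1.
  have H := is_derive_mul (is_derive_mul (pw t t0)
      (is_derive_inv (lt0r_neq0 t0) (is_derive_id t 1)))
    (is_derive_sub (is_derive_scale p (is_derive_opp (is_derive1_ln t0)))
      (is_derive_const 1 t (1 : R))).
  by apply: (is_derive_eq H); field; rewrite gt_eqF.
have E2 t : 0 < t < delta -> a2 t = t `^ p / t ^+ 2 * (p * (p - 1) * L t - (2 * p - 1)).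
  move=> /D2 H; have -> : a2 t = 'D_1 a1 t := derive1E a1 t; exact: derive_val.
near=> t; have td : 0 < t < delta.
  by apply/andP; split; near: t; [exact: nbhs_right_gt|exact: nbhs_right_lt].
split; [|by rewrite Ha// mulrN|exact: E1|exact: E2].
by have /andP[-> /lt_trans ->] := td.
Unshelve. all: by end_near. Qed.

Lemma near_scale_factor_lt e : 0 < e -> \forall t \near 0^'+, a t < e.
Proof.
move=> e0; near=> t; have [_ -> _ _] : [/\ 0 < t < 1, a t = t `^ p * L t,
  a1 t = t `^ p / t * (p * L t - 1) &
  a2 t = t `^ p / t ^+ 2 * (p * (p - 1) * L t - (2 * p - 1))].
  by near: t; exact: near_scale_factorE.
by rewrite -[L t]expr1; near: t; exact: near_powR_log.
Unshelve. all: by end_near. Qed.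

Lemma near_scale_factor_log (K : nat) e : 0 < e ->
  \forall t \near 0^'+, a t ^+ 2 * L t ^+ K < e.
Proof.
move=> e0; near=> t; have [_ aE _ _] : [/\ 0 < t < 1, a t = t `^ p * L t,
  a1 t = t `^ p / t * (p * L t - 1) &
  a2 t = t `^ p / t ^+ 2 * (p * (p - 1) * L t - (2 * p - 1))].
  by near: t; exact: near_scale_factorE.
have a1 : a t < 1 by near: t; exact: near_scale_factor_lt.
have L0 : 0 < L t by near: t; exact: near_log_gt.
have pe : t `^ p * L t ^+ K.+1 < e by near: t; exact: near_powR_log.
have a0 : 0 <= a t by rewrite aE mulr_ge0 ?powR_ge0// ltW.
apply: le_lt_trans pe; have -> : t `^ p * L t ^+ K.+1 = a t * L t ^+ K by rewrite aE exprS mulrA.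
by rewrite ler_pM2r ?exprn_gt0// expr2 ler_piMr// ltW.
Unshelve. all: by end_near. Qed.

Lemma near_scale_factor_ge : p <= 1 -> \forall t \near 0^'+, t * L t <= a t.
Proof.
move=> p1; near=> t; have [/andP[t0 t1] aE _ _] : [/\ 0 < t < 1, a t = t `^ p * L t,
  a1 t = t `^ p / t * (p * L t - 1) &
  a2 t = t `^ p / t ^+ 2 * (p * (p - 1) * L t - (2 * p - 1))].
  by near: t; exact: near_scale_factorE.
have L0 : 0 < L t by near: t; exact: near_log_gt.
by rewrite aE ler_pM2r// ger1_powR// t0 ltW.
Unshelve. all: by end_near. Qed.

Hypothesis a_derive : forall t : R, 0 < t -> is_derive t (1 : R) a (a1 t).

Lemma scale_factor_nondecreasing_near :
  exists2 d, 0 < d & forall t t', 0 < t -> t <= t' -> t' < d -> a t <= a t'.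
Proof.
have : \forall t \near 0^'+, 0 <= a1 t.
  near=> t; have [/andP[t0 t1] _ -> _] : [/\ 0 < t < 1, a t = t `^ p * L t,
  a1 t = t `^ p / t * (p * L t - 1) &
  a2 t = t `^ p / t ^+ 2 * (p * (p - 1) * L t - (2 * p - 1))].
    by near: t; exact: near_scale_factorE.
  rewrite mulr_ge0 ?divr_ge0 ?powR_ge0 ?(ltW t0)// subr_ge0 -ler_pdivrMl// mulr1.
  by rewrite ltW//; near: t; exact: near_log_gt.
move=> /near_right0[d d0 Hd]; exists d => // t t' t0 tt' t'd.
apply: (nondecreasing_segment tt' (df := a1)) => x /andP[tx xt'].
  by apply: a_derive; exact: lt_le_trans tx.
by apply: Hd; rewrite (lt_le_trans t0)//= (le_lt_trans xt').
Unshelve. all: by end_near. Qed.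

Variable kappa : R.
Hypothesis case_kappa : 0 <= kappa \/ p <= 1.

(** The difference a''/a - a'^2/a^2 is (ln a)'' = (- p + 1/L - 1/L^2) / t^2 with L = - ln t. The
    curvature term is nonpositive if kappa >= 0; if p <= 1, then a >= t L makes it at most |kappa| /
    (t^2 L). Either way - p / t^2 dominates. *)
Lemma near_bracket_le :
  \forall t \near 0^'+, bracket a kappa t <= - (p / 2) / (t ^+ 2 * a t).
Proof.
pose k := `|kappa|; have k0 : 0 <= k by exact: normr_ge0.
have nge : \forall t \near 0^'+, p <= 1 -> t * L t <= a t.
  have [p1|p1] := leP p 1; last by near=> t.
  by apply: filterS (near_scale_factor_ge p1) => t.
near=> t; have [/andP[t0 t1] aE a1E a2E] : [/\ 0 < t < 1, a t = t `^ p * L t,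
  a1 t = t `^ p / t * (p * L t - 1) &
  a2 t = t `^ p / t ^+ 2 * (p * (p - 1) * L t - (2 * p - 1))].
  by near: t; exact: near_scale_factorE.
have L1 : 1 < L t by near: t; exact: near_log_gt.
(* This makes the error (1 + k) / L at most p / 2, so half of the leading term survives. *)
have Lk : (1 + k) / (p / 2) < L t by near: t; exact: near_log_gt.
have L0 : 0 < L t by exact: lt_trans L1.
have a0 : 0 < a t by rewrite aE mulr_gt0// powR_gt0.
have ln0 : ln t != 0 by rewrite lt_eqF// -oppr_gt0.
have tn0 : t != 0 by rewrite gt_eqF.
have tge : p <= 1 -> t * L t <= a t by near: t.
have kb : - kappa / a t ^+ 2 <= k / (t ^+ 2 * L t).
  have [kp|p1] := case_kappa.
    apply: (@le_trans _ _ 0); first by rewrite mulNr oppr_le0 divr_ge0// sqr_ge0.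
    by rewrite divr_ge0// mulr_ge0 ?sqr_ge0// ltW.
  apply: (@le_trans _ _ (k / a t ^+ 2)).
    by rewrite ler_wpM2r ?invr_ge0 ?sqr_ge0// /k -normrN ler_norm.
  rewrite ler_wpM2l// lef_pV2 ?posrE ?mulr_gt0 ?exprn_gt0//.
  have tL : t * L t <= a t by apply: tge.
  apply: (@le_trans _ _ ((t * L t) ^+ 2)).
    by rewrite exprMn ler_pM2l ?exprn_gt0// expr2 ler_peMr// ltW.
  by rewrite lerXn2r// nnegrE ltW// mulr_gt0.
rewrite /bracket mulrC.
have -> : - (p / 2) / (t ^+ 2 * a t) = (- (p / 2) / t ^+ 2) / a t.
  by rewrite invfM mulrA.
rewrite ler_pM2r ?invr_gt0//.
have -> : a2 t / a t - a1 t ^+ 2 / a t ^+ 2 = (- p + (L t)^-1 - (L t)^-1 ^+ 2) / t ^+ 2.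
  rewrite a2E a1E aE; have tp : t `^ p != 0 by rewrite gt_eqF// powR_gt0.
  by field; rewrite ?tp ?ln0 ?tn0.
apply: (@le_trans _ _ ((- p + (L t)^-1 - (L t)^-1 ^+ 2) / t ^+ 2 + k / (t ^+ 2 * L t))).
  by rewrite lerD2l; apply: le_trans kb; rewrite mulNr.
have -> : (- p + (L t)^-1 - (L t)^-1 ^+ 2) / t ^+ 2 + k / (t ^+ 2 * L t) =
   (- p + (1 + k) / L t - (L t)^-1 ^+ 2) / t ^+ 2.
  by field; rewrite ?tn0 ?ln0.
rewrite ler_pM2r ?invr_gt0 ?exprn_gt0//.
have : (1 + k) / L t <= p / 2.
  rewrite ltr_pdivrMr ?divr_gt0// in Lk.
  by rewrite ler_pdivrMr// mulrC ltW.
by have := sqr_ge0 (L t)^-1; lra.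
Unshelve. all: by end_near. Qed.

Lemma near_f_fun_le0 C : 0 < C -> \forall t \near 0^'+, f_fun a kappa C t <= 0.
Proof.
(* The term 3 a'' is at most 3 (p^2 + 1) a / t^2, while the bracket contributes at most - C p / (t^2
   a). The sum is nonpositive once 3 (p^2 + 1) a^2 <= C p; with a < 1 it is enough to bound a
   instead of a^2. *)
move=> C0; pose e := Num.min 1 (C * p / (3 * (p ^+ 2 + 1))).
have pp : 0 < 3 * (p ^+ 2 + 1) by rewrite mulr_gt0// ltr_wpDl// sqr_ge0.
have e0 : 0 < e by rewrite lt_min ltr01 divr_gt0// mulr_gt0.
near=> t; have [/andP[t0 t1] aE a1E a2E] : [/\ 0 < t < 1, a t = t `^ p * L t,
  a1 t = t `^ p / t * (p * L t - 1) &
  a2 t = t `^ p / t ^+ 2 * (p * (p - 1) * L t - (2 * p - 1))].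
  by near: t; exact: near_scale_factorE.
have L1 : 1 < L t by near: t; exact: near_log_gt.
have L0 : 0 < L t by exact: lt_trans L1.
have a0 : 0 < a t by rewrite aE mulr_gt0// powR_gt0.
have : a t < e by near: t; exact: near_scale_factor_lt.
rewrite lt_min => /andP[ae1 ae2].
have Hb : bracket a kappa t <= - (p / 2) / (t ^+ 2 * a t).
  by near: t; exact: near_bracket_le.
have a2b : a2 t <= (p ^+ 2 + 1) * a t / t ^+ 2.
  have -> : (p ^+ 2 + 1) * a t / t ^+ 2 = t `^ p / t ^+ 2 * ((p ^+ 2 + 1) * L t).
    by rewrite aE; ring.
  rewrite a2E ler_pM2l ?divr_gt0 ?powR_gt0 ?exprn_gt0//.
  by have : 0 < p * L t; [rewrite mulr_gt0|move: (ltW L1); nra].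
rewrite /f_fun.
apply: (@le_trans _ _ (3 * ((p ^+ 2 + 1) * a t / t ^+ 2) + 2 * C * (- (p / 2) / (t ^+ 2 * a t)))).
  by rewrite lerD// ler_pM2l// mulr_gt0.
have -> : 3 * ((p ^+ 2 + 1) * a t / t ^+ 2) + 2 * C * (- (p / 2) / (t ^+ 2 * a t)) =
  (3 * (p ^+ 2 + 1) * a t ^+ 2 - C * p) / (t ^+ 2 * a t).
  by field; rewrite !gt_eqF.
rewrite pmulr_lle0 ?invr_gt0 ?mulr_gt0 ?exprn_gt0// subr_le0.
rewrite ltr_pdivlMr// in ae2; apply: le_trans (ltW ae2).
rewrite mulrC ler_pM2r// expr2 ger_pMl// ltW//.
Unshelve. all: by end_near. Qed.

End LogScaleFactor.

(** * Lebesgue integrals of derivatives over a segment *)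

Section SegmentIntegrals.
Variable R : realType.
Local Notation mu := (@lebesgue_measure R).
Implicit Types (f F : R -> R) (s t x : R).

Lemma continuous_segment_integrable f s t :
  {within `[s, t], continuous f} -> mu.-integrable `[s, t] (EFin \o f).
Proof. by move=> cf; apply: continuous_compact_integrable => //; exact: segment_compact. Qed.

Lemma derivable_within f s t : (forall x, s <= x <= t -> derivable f x 1) ->
  {within `[s, t], continuous f}.
Proof.
move=> df; apply: derivable_within_continuous => x; rewrite in_itv /= => H; exact: df.
Qed.

Lemma Rintegral_derivative F f s t : s <= t ->
  (forall x, s <= x <= t -> is_derive x (1 : R) F (f x)) ->
  (forall x, s <= x <= t -> derivable f x 1) ->
  (\int[mu]_(x in `[s, t]) f x)%R = F t - F s.
Proof.
rewrite le_eqVlt => /predU1P[<- _ _|st HF df].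
  by rewrite set_itv1 Rintegral_set1 subrr.
have cont x : s <= x <= t -> {for x, continuous F}.
  by move=> /HF[H _]; apply: differentiable_continuous; apply/derivable1_diffP.
rewrite /Rintegral (continuous_FTC2 st (derivable_within df) (F := F))//.
- split.
  + move=> x; rewrite in_itv /= => /andP[sx xt].
    by have [] : is_derive x (1 : R) F (f x) by apply: HF; rewrite !ltW.
  + by apply: cvg_at_right_filter; apply: cont; rewrite lexx ltW.
  + by apply: cvg_at_left_filter; apply: cont; rewrite lexx ltW.
- move=> x; rewrite in_itv /= => /andP[sx xt]; rewrite derive1E.
  by apply: derive_val; apply: HF; rewrite !ltW.
Qed.

End SegmentIntegrals.

(** * Divergence of the double integral and vanishing of the integral of f_+ *)

Section ConjugatePointCriterion.
Variables (R : realType) (p : R) (a : R -> R) (kappa : R).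
Local Notation mu := (@lebesgue_measure R).
Local Notation a1 := (derive1 a).
Local Notation a2 := (derive1n 2 a).
Implicit Types (s t x C : R).
Hypothesis p0 : 0 < p.
Hypothesis a_log_form : exists2 delta : R, 0 < delta < 1 &
  forall t, 0 < t < delta -> a t = - (t `^ p * ln t).
Hypothesis a_gt0 : forall t, 0 < t -> 0 < a t.
Hypothesis asmooth : smooth1 `]0, +oo[ a.
Hypothesis case_kappa : 0 <= kappa \/ p <= 1.

Let D0 t : 0 < t -> is_derive t (1 : R) a (a1 t).
Proof.
move=> t0; rewrite derive1E; apply: derivableP.
by apply: (@asmooth 0%N t); rewrite /= in_itv /= t0.
Qed.
Let D1 t : 0 < t -> is_derive t (1 : R) a1 (a2 t).
Proof.
move=> t0; have -> : a2 t = 'D_1 a1 t := derive1E a1 t; apply: derivableP.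
by apply: (@asmooth 1%N t); rewrite /= in_itv /= t0.
Qed.
Let D2 t : 0 < t -> is_derive t (1 : R) a2 ('D_1 a2 t).
Proof.
move=> t0; apply: derivableP.
by apply: (@asmooth 2%N t); rewrite /= in_itv /= t0.
Qed.

Lemma derivable_bracket t : 0 < t -> derivable (bracket a kappa) t 1.
Proof.
move=> t0; have an := lt0r_neq0 (a_gt0 t0).
have an2 : a t ^+ 2 != 0 by rewrite expf_neq0.
have I := is_derive_inv an (D0 t0).
have I2 := @is_derive_inv R _ (fun y : R => a y ^+ 2) t 1 _ an2 (is_derive_exp 2 (D0 t0)).
have [] := is_derive_mul I (is_derive_sub (is_derive_sub (is_derive_mul (D2 t0) I)
  (is_derive_mul (is_derive_exp 2 (D1 t0)) I2)) (is_derive_scale kappa I2)).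
by [].
Qed.

Lemma exists_t1 C : 0 < C -> exists2 t1, 0 < t1 & forall t, 0 < t <= t1 ->
  [/\ 0 < t < 1, t * a1 t <= p * a t, a t <= a t1,
      bracket a kappa t <= - (p / 2) / (t ^+ 2 * a t) & f_fun a kappa C t <= 0].
Proof.
move=> C0.
have [d1 d10 H1] := near_right0 (near_scale_factorE a_log_form).
have [d2 d20 H2] := scale_factor_nondecreasing_near p0 a_log_form D0.
have [d3 d30 H3] := near_right0 (near_bracket_le p0 a_log_form case_kappa).
have [d4 d40 H4] := near_right0 (near_f_fun_le0 p0 a_log_form case_kappa C0).
pose d := Num.min (Num.min d1 d2) (Num.min d3 d4).
have d0 : 0 < d by rewrite !lt_min d10 d20 d30.
exists (d / 2); first by rewrite divr_gt0.
move=> t /andP[t0 td].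
have dd : d / 2 < d by rewrite ltr_pdivrMr// ltr_pMr// ltr1n.
have : d / 2 < d by []. rewrite {2}/d !lt_min => /andP[/andP[e1 e2] /andP[e3 e4]].
have [t01 aE a1E _] := H1 t (introT andP (conj t0 (le_lt_trans td e1))).
split => //.
- have tn0 : t != 0 by rewrite gt_eqF.
  rewrite a1E aE -subr_ge0.
  (* The logarithmic terms of p a and t a' cancel, and the difference is exactly t^p. *)
  have -> : p * (t `^ p * - ln t) - t * (t `^ p / t * (p * - ln t - 1)) = t `^ p by field.
  exact: powR_ge0.
- by apply: H2.
- by apply: H3; rewrite t0 (le_lt_trans td).
- by apply: H4; rewrite t0 (le_lt_trans td).
Qed.

(** Let psi = 1 / (s a). From s a' <= p a follows psi' >= - (1 + p) / (s^2 a), so the bracket is at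
    most c psi' with c = (p / 2) / (1 + p). The inner integral is thus at most c (psi(t1) - psi(s));
    multiplied by a(s) <= a(t1) this is at most c (1/t1 - 1/s), whose integral is logarithmic. *)
Lemma double_integral_le t1 : 0 < t1 ->
  (forall t, 0 < t <= t1 -> [/\ t * a1 t <= p * a t, a t <= a t1 &
      bracket a kappa t <= - (p / 2) / (t ^+ 2 * a t)]) ->
  forall t, 0 < t <= t1 ->
  (\int[mu]_(s in `[t, t1]) (a s * \int[mu]_(r in `[s, t1]) bracket a kappa r))%R
  <= p / 2 / (1 + p) * (1 - (ln t1 - ln t)).
Proof.
move=> t10 Ht1 t /andP[t0 tt1].
pose c := p / 2 / (1 + p).
have c0 : 0 < c by rewrite !divr_gt0// ltr_wpDl.
pose psi s := (s * a s)^-1.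
pose dpsi s := - (a s + s * a1 s) / (s * a s) ^+ 2.
have sa s : 0 < s -> s * a s != 0 by move=> s0; rewrite gt_eqF// mulr_gt0 ?a_gt0.
have psi_derive s : 0 < s -> is_derive s (1 : R) psi (dpsi s).
  move=> s0; have H := is_derive_mul (is_derive_id s (1 : R)) (D0 s0).
  have E := @is_derive_inv R _ (fun y : R => y * a y) s 1 _ (sa s s0) H.
  rewrite /psi /dpsi; apply: (is_derive_eq E).
  by rewrite mul1r.
have dpsi_derivable s : 0 < s -> derivable dpsi s 1.
  move=> s0; have H := is_derive_mul (is_derive_id s (1 : R)) (D0 s0).
  have H' := is_derive_mul (is_derive_id s (1 : R)) (D1 s0).
  have n2 : (s * a s) ^+ 2 != 0 by rewrite expf_neq0// sa.
  by have [] := is_derive_mul (is_derive_opp (is_derive_add (D0 s0) H'))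
    (@is_derive_inv R _ (fun y : R => (y * a y) ^+ 2) s 1 _ n2 (is_derive_exp 2 H)).
have mitv s : measurable (`[s, t1]%classic : set R) by exact: measurable_itv.
have intB s : 0 < s -> mu.-integrable `[s, t1] (EFin \o bracket a kappa).
  move=> s0; apply: continuous_segment_integrable; apply: derivable_within => x /andP[sx _].
  by apply: derivable_bracket; exact: lt_le_trans sx.
have inner_le s : 0 < s <= t1 ->
    (\int[mu]_(r in `[s, t1]) bracket a kappa r)%R <= c * (psi t1 - psi s).
  move=> /andP[s0 st1].
  have cd x : s <= x <= t1 -> is_derive x (1 : R) (fun r => c * psi r) (c * dpsi x).
    by move=> /andP[sx _]; apply: is_derive_scale; apply: psi_derive; exact: lt_le_trans sx.
  have dd x : s <= x <= t1 -> derivable (fun r => c * dpsi r) x 1.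
    move=> /andP[sx _]; have x0 := lt_le_trans s0 sx.
    by have [] := is_derive_scale c (derivableP (dpsi_derivable x x0)).
  have E := Rintegral_derivative st1 cd dd; rewrite mulrBr -E.
  apply: le_Rintegral => //; first exact: intB.
    by apply: continuous_segment_integrable; exact: derivable_within.
  move=> x /=; rewrite in_itv /= => /andP[sx xt1]; have x0 := lt_le_trans s0 sx.
  have [h1 h2 h3] : [/\ x * a1 x <= p * a x, a x <= a t1 &
      bracket a kappa x <= - (p / 2) / (x ^+ 2 * a x)] by apply: Ht1; rewrite x0.
  apply: (le_trans h3); have ax := a_gt0 x0.
  have -> : - (p / 2) / (x ^+ 2 * a x) = - (c * ((1 + p) * a x)) / (x * a x) ^+ 2.
    by rewrite /c; field; rewrite !gt_eqF// ltr_wpDl.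
  rewrite /= /dpsi [leRHS]mulrA ler_pM2r ?invr_gt0 ?exprn_gt0 ?mulr_gt0//.
  by rewrite mulrN lerN2 ler_pM2l//; lra.
have outer_le s : t <= s <= t1 ->
    a s * (\int[mu]_(r in `[s, t1]) bracket a kappa r)%R <= c * (t1^-1 - s^-1).
  move=> /andP[ts st1]; have s0 := lt_le_trans t0 ts; have as0 := a_gt0 s0.
  have a10 := a_gt0 t10.
  apply: (@le_trans _ _ (a s * (c * (psi t1 - psi s)))).
    by rewrite ler_pM2l// inner_le// s0.
  rewrite mulrCA ler_pM2l// mulrBr lerB//.
    rewrite /psi invfM mulrCA ler_piMr ?invr_ge0 ?(ltW t10)//.
    rewrite ler_pdivrMr// mul1r.
    by have [] : [/\ s * a1 s <= p * a s, a s <= a t1 &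
      bracket a kappa s <= - (p / 2) / (s ^+ 2 * a s)] by apply: Ht1; rewrite s0.
  by rewrite /psi invfM mulrCA divff ?mulr1// gt_eqF.
(* The inner integral is rewritten with its variable in the upper limit, [K - P s]; continuity of
   the primitive [P] then gives integrability of the outer integrand. *)
pose K := (\int[mu]_(r in `[t, t1]) bracket a kappa r)%R.
pose P s := (\int[mu]_(r in `[t, s]) bracket a kappa r)%R.
have PE s : t <= s <= t1 -> (\int[mu]_(r in `[s, t1]) bracket a kappa r)%R = K - P s.
  move=> /andP[ts st1]; rewrite /K /P Rintegral_itvB//; last exact: intB.
  rewrite Rintegral_itv_obnd_cbnd//.
  apply: integrableS (intB s (lt_le_trans t0 ts)) => //.
  by apply: subset_itvr; rewrite bnd_simp.
have contP : {within `[t, t1], continuous (fun s => a s * (K - P s))}.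
  have cP : {within `[t, t1], continuous P}.
    by apply: parameterized_integral_continuous => //; exact: intB.
  have ca : {within `[t, t1], continuous a}.
    by apply: derivable_within => x /andP[tx _]; have [] := D0 (lt_le_trans t0 tx).
  move=> x; apply: cvgM; first exact: ca.
  by apply: cvgB; [exact: cvg_cst|exact: cP].
have -> : (\int[mu]_(s in `[t, t1]) (a s * \int[mu]_(r in `[s, t1]) bracket a kappa r))%R =
    (\int[mu]_(s in `[t, t1]) (a s * (K - P s)))%R.
  by apply: eq_Rintegral => s; rewrite inE /= in_itv /= => ts; rewrite PE.
have lnE x : t <= x <= t1 -> is_derive x (1 : R) (fun r => c * (t1^-1 * r - ln r)) (c * (t1^-1 - x^-1)).
  move=> /andP[tx _]; have x0 := lt_le_trans t0 tx.
  apply: is_derive_scale; apply: is_derive_sub; last exact: is_derive1_ln.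
  have H := is_derive_scale t1^-1 (is_derive_id x (1 : R)).
  by apply: (is_derive_eq H); rewrite mulr1.
have lnD x : t <= x <= t1 -> derivable (fun r : R => c * (t1^-1 - r^-1)) x 1.
  move=> /andP[tx _]; have x0 := lt_le_trans t0 tx.
  by have [] := is_derive_scale c (is_derive_sub (is_derive_const t1^-1 x (1 : R))
    (is_derive_inv (lt0r_neq0 x0) (is_derive_id x (1 : R)))).
apply: (@le_trans _ _ (\int[mu]_(s in `[t, t1]) (c * (t1^-1 - s^-1)))%R).
  apply: le_Rintegral => //.
  - exact: continuous_segment_integrable.
  - by apply: continuous_segment_integrable; exact: derivable_within.
  - by move=> s /=; rewrite in_itv /= => ts; rewrite -PE// outer_le.
rewrite (Rintegral_derivative tt1 lnE lnD) -mulrBr ler_pM2l//.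
rewrite mulVf ?gt_eqF//.
have : 0 <= t1^-1 * t by apply: mulr_ge0; rewrite ?invr_ge0 ltW.
lra.
Qed.

Lemma divergence_and_positive_part C : 0 < C -> exists t1 : R,
    [/\ 0 < t1,
        (\int[mu]_(s in `[t, t1]) (a s * \int[mu]_(r in `[s, t1]) bracket a kappa r))
          @[t --> 0^'+] --> -oo &
        exists2 l : R, 0 <= l &
          (\int[mu]_(s in `[t, t1]) Num.max (f_fun a kappa C s) 0) @[t --> 0^'+] --> l].
Proof.
move=> C0; have [t1 t10 Ht1] := exists_t1 C0; exists t1; split => //.
  have c0 : 0 < p / 2 / (1 + p) by rewrite !divr_gt0// ltr_wpDl.
  apply/cvgrNyPle => M.
  have /cvgrNyPle/(_ (M / (p / 2 / (1 + p)) - 1 + ln t1)) H := @lnNy R.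
  near=> t; apply: (@le_trans _ _ (p / 2 / (1 + p) * (1 - (ln t1 - ln t)))).
    apply: double_integral_le => //; first by move=> x /Ht1[].
    by apply/andP; split; [near: t; exact: nbhs_right_gt|near: t; exact: nbhs_right_le].
  rewrite mulrC -ler_pdivlMr//.
  have : ln t <= M / (p / 2 / (1 + p)) - 1 + ln t1 by near: t.
  lra.
exists 0 => //; apply: (@cvg_trans _ (cst (0 : R) t @[t --> 0^'+])); last exact: cvg_cst.
apply: near_eq_cvg; near=> t.
have t0 : 0 < t by near: t; exact: nbhs_right_gt.
rewrite [LHS]/=; transitivity (\int[mu]_(s in `[t, t1]) (0 : R))%R.
  by rewrite Rintegral_cst//= mul0r.
apply/esym/eq_Rintegral => s; rewrite inE /= in_itv /= => /andP[ts st1].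
have [_ _ _ _ f0] : [/\ 0 < s < 1, s * a1 s <= p * a s, a s <= a t1,
      bracket a kappa s <= - (p / 2) / (s ^+ 2 * a s) & f_fun a kappa C s <= 0].
  by apply: Ht1; rewrite (lt_le_trans t0 ts).
by apply/max_idPr.
Unshelve. all: by end_near. Qed.

End ConjugatePointCriterion.

(** * The Jacobi operator of the warped product along a timelike or null vector *)

Section TidalOperator.
Variables (R : realType) (n : nat) (U : set 'rV[R]_n) (m : 'rV[R]_n -> 'M[R]_n).
Variables (a : R -> R) (kappa : R).
Hypothesis (oU : open U) (msmooth : forall k l, smooth U (fun x => m x k l)).
Hypothesis msym : forall x, U x -> (m x)^T = m x.
Hypothesis mpos : forall x, U x -> forall u, u != 0 -> 0 < inner m x u u.
Hypothesis mcurv : forall x, U x -> forall u v, plane_area2 m x u v != 0 ->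
  sectional_curvature m x u v = kappa.
Hypothesis apos : forall t : R, 0 < t -> 0 < a t.
Hypothesis asmooth : smooth1 `]0, +oo[ a.

Local Notation G := (warped_metric m a).
Local Notation T := (time_index n).
Local Notation a1 := (derive1 a).
Local Notation a2 := (derive1n 2 a).
Local Notation time x := (lsubmx x 0 0).
Local Notation pos x := (rsubmx x).
Local Notation sp x u v := (inner m (pos x) (rsubmx u) (rsubmx v)).
Local Opaque partial christoffel riemann curvature.

Let munit x (Ux : U x) : m x \in unitmx := posdef_unitmx (mpos Ux).

Lemma tidal_space x V u : split_domain U x ->
  rsubmx (curvature G x V u u) =
  (a2 (time x) / a (time x)) *: ((u 0 T * V 0 T) *: rsubmx u - u 0 T ^+ 2 *: rsubmx V)
  + (kappa + a1 (time x) ^+ 2) *: (sp x u u *: rsubmx V - sp x V u *: rsubmx u).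
Proof.
move=> Wx; have [_ Ux] := Wx; apply/rowP => i; rewrite mxE.
rewrite (curvature_warped_S oU msmooth msym munit apos asmooth)//.
rewrite (jacobi_operator_constant_curvature oU msmooth msym mpos mcurv)//.
by rewrite !mxE; ring.
Qed.

Variables (C epsn : R) (x u : 'rV[R]_(1 + n)).
Hypothesis Wx : split_domain U x.
Hypothesis norm_u : inner G x u u = epsn.
Hypothesis C_u : a (time x) ^+ 2 * (a (time x) ^+ 2 * sp x u u) = C.

Let b0 : a (time x) != 0. Proof. by have [t0 _] := Wx; rewrite gt_eqF// apos. Qed.

Let spE : sp x u u = (u 0 T ^+ 2 + epsn) / a (time x) ^+ 2.
Proof. by move: norm_u; rewrite inner_warped => <-; field. Qed.

Let CE : C = (u 0 T ^+ 2 + epsn) * a (time x) ^+ 2.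
Proof. by rewrite -C_u spE; field. Qed.

(** The operator is scalar up to a rank one term. The factor V_T + g(V, u) u_T is the time component
    of the projection of [V] orthogonal to [u], and on that orthogonal space the time component
    vanishes exactly on the transverse directions. On the radial direction the two terms add up to -
    a''/a. *)
Lemma tidal_inner V Z : epsn = -1 -> inner G x Z u = 0 ->
  inner G x (curvature G x V u u) Z =
  transverse_coeff a C epsn kappa (time x) * inner G x V Z
  + (V 0 T + inner G x V u * u 0 T) * Z 0 T *
    (a2 (time x) / a (time x) - (kappa + a1 (time x) ^+ 2) / a (time x) ^+ 2).
Proof.
move=> eN1; have [_ Ux] := Wx; rewrite inner_warped => Zu.
have spZ : sp x u Z = Z 0 T * u 0 T / a (time x) ^+ 2.
  rewrite (innerC _ _ (msym Ux)); apply/eqP; rewrite eq_sym -subr_eq0 -(mulrI_eq0 _ (mulfI (expf_neq0 2 b0))).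
  by apply/eqP; rewrite mulrBr mulrCA divff ?expf_neq0// mulr1 -[RHS]oppr0 -Zu; ring.
rewrite !inner_warped tidal_space// (curvature_warped_T oU msmooth msym munit apos asmooth)//.
rewrite innerDl !innerZl !innerBl !innerZl spZ spE /transverse_coeff CE eN1.
move: b0; move: (a (time x)) (sp x V u) (sp x V Z) (u 0 T) (V 0 T) (Z 0 T) (a1 _) (a2 _).
by move=> b P Q u0 V0 Z0 h1 h2 bn; field.
Qed.

Lemma tidal_null V : epsn = 0 -> 0 < C -> inner G x V u = 0 ->
  (curvature G x V u u - transverse_coeff a C epsn kappa (time x) *: V <= u)%MS.
Proof.
move=> e0 C0; rewrite inner_warped => Vu.
have un : u 0 T != 0.
  apply/eqP => u0; move: C0; rewrite CE u0 e0 expr0n addr0 mul0r ltxx//.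
have spV : sp x V u = V 0 T * u 0 T / a (time x) ^+ 2.
  apply: (mulfI (expf_neq0 2 b0)); rewrite mulrCA divff ?expf_neq0// mulr1.
  by apply/eqP; rewrite -subr_eq0 addrC Vu.
(* R(V, u) u has zero time component here, which forces this multiple of [u]. *)
apply/sub_rVP; exists (- transverse_coeff a C epsn kappa (time x) * V 0 T / u 0 T).
have KT := curvature_warped_T oU msmooth msym munit apos asmooth V u Wx.
have KS := tidal_space V u Wx.
move: (curvature G x V u u) KT KS => K KT KS.
rewrite -[LHS]hsubmxK -[RHS]hsubmxK; congr row_mx.
  apply/rowP => i; rewrite !ord1 !mxE -/T KT -?(lsubmxE x).
  rewrite spV spE /transverse_coeff CE e0.
  move: b0 un; move: (a (time x)) (u 0 T) (V 0 T) (a1 _) (a2 _) => b u0 V0 h1 h2 bn un'.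
  by field; rewrite ?bn ?un'.
have subE c d (v w : 'rV[R]_(1 + n)) : rsubmx (v - c *: w) = rsubmx v - c *: rsubmx w /\
    rsubmx (d *: w) = d *: rsubmx w by rewrite linearB /= !linearZ.
rewrite (subE _ 0 _ _).1 (subE 0 _ 0 _).2 KS.
apply/rowP => i; rewrite !mxE -?(lsubmxE x).
rewrite spV spE /transverse_coeff CE e0.
move: b0 un; move: (a (time x)) (u 0 T) (V 0 T) (a1 _) (a2 _) => b u0 V0 h1 h2 bn un'.
by field; rewrite ?bn ?un'.
Qed.

Lemma velocity_time_sqr : u 0 T ^+ 2 = C / a (time x) ^+ 2 - epsn.
Proof. by rewrite CE; field. Qed.

End TidalOperator.

(* Inverting the Gram relation M G M^T = eta gives M^T eta M = G^-1, whose time-time entry is -1. *)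
Lemma orthonormal_time_components (R : realType) (m : 'rV[R]_3 -> 'M[R]_3) (a : R -> R)
    (x : 'rV[R]_(1 + 3)) (E : 'I_4 -> 'rV[R]_(1 + 3)) :
  (forall k l, inner (warped_metric m a) x (E k) (E l) = minkowski_form R k l) ->
  \sum_(k < 3) E (lift ord0 k) 0 (time_index 3) ^+ 2 = E ord0 0 (time_index 3) ^+ 2 - 1.
Proof.
move=> HE; set T := time_index 3; pose M : 'M[R]_4 := \matrix_k E k.
pose g : 'M[R]_4 := warped_metric m a x; pose eta : 'M[R]_4 := \matrix_(k, l) minkowski_form R k l.
have gram : M *m g *m M^T = eta.
  apply/matrixP => k l; rewrite [RHS]mxE -HE /inner.
  rewrite [LHS]mxE [RHS]mxE; apply: eq_bigr => j _.
  rewrite [M^T j l]mxE [(E l)^T _ _]mxE [M l j]mxE; congr (_ * _).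
  by rewrite [LHS]mxE [RHS]mxE; apply: eq_bigr => i _; rewrite [M k i]mxE.
have eta2 : eta *m eta = 1%:M.
  apply/matrixP => k l; rewrite !mxE (bigD1 k)//= !mxE big1 => [|j jk]; last first.
    by rewrite !mxE /minkowski_form eq_sym (negPf jk) /= mul0r.
  rewrite addr0 /minkowski_form eqxx /=.
  by case: (eqVneq k l) => _ /=; case: (k == ord0); rewrite ?mulr0 ?mulrNN ?mulr1.
have inv : M^T *m (eta *m (M *m g)) = 1%:M by apply: mulmx1C; rewrite -mulmxA gram.
have : (M^T *m eta *m M *m g) T T = 1 by rewrite -!mulmxA inv mxE eqxx.
rewrite mxE big_time_space warped_metric_TT big1 => [|j _]; last by rewrite warped_metric_ST mulr0.
rewrite addr0 mxE big_ord_recl.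
have P k : (M^T *m eta) T k = E k 0 T * minkowski_form R k k.
  rewrite mxE (bigD1 k)//= !mxE big1 ?addr0// => j jk.
  by rewrite !mxE /minkowski_form jk mulr0.
rewrite !P !mxE.
under eq_bigr do rewrite P mxE /minkowski_form eqxx /= mulr1 -expr2.
by rewrite /minkowski_form eqxx /=; lra.
Qed.

Lemma is_derive_entry (R : realType) p q (M : R -> 'M[R]_(p, q)) (s : R) dM i j :
  is_derive s (1 : R) M dM -> is_derive s (1 : R) (fun r => M r i j) (dM i j).
Proof.
move=> [HM <-]; rewrite derive_mx// mxE; apply: derivableP.
by have /derivable_mxP := HM.
Qed.

Lemma differentiable_coords (R : realType) n p (f : 'rV[R]_n -> 'rV[R]_p) x :
  (forall k, differentiable (fun y => f y 0 k) x) -> differentiable f x.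
Proof.
move=> H; have -> : f = \sum_(k < p) (fun y => f y 0 k *: delta_mx 0 k).
  by apply/funext => y; rewrite fct_sumE; exact: row_sum_delta.
by apply: differentiable_sum => k; apply: differentiableZl.
Qed.

(** * The Jacobi tensors as linear systems in a parallel frame *)

Section FLRWGeodesics.
Variables (R : realType) (Sigma : topologicalType) (a : R -> R).
Variables (h : metric_atlas R 3 Sigma) (kappa : R).
Hypothesis Hflrw : flrw a h kappa.
Variables (D : set R) (gamma : R -> R * Sigma) (epsn C : R).
Hypothesis Hgeo : flrw_geodesic a h D gamma epsn C.
Hypothesis C0 : 0 < C.

Local Notation A := (flrw_atlas a h).
Local Notation Tx := (time_index 3).
Local Notation a1 := (derive1 a).
Local Notation a2 := (derive1n 2 a).
Local Notation vel := (velocity (A := A) gamma).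
Local Notation U i := (@chart R 3 Sigma h i @` @dom R 3 Sigma h i).
Local Notation G i := (warped_metric (@metric R 3 Sigma h i) a).
Local Notation X i s := (@chart R (1 + 3) (R * Sigma)%type A i (gamma s)).
Local Notation at_chart i s := (D s /\ @dom R (1 + 3) (R * Sigma)%type A i (gamma s)).
Let T s := (gamma s).1.
Local Notation tc s := (transverse_coeff a C epsn kappa (T s)).

Let oU i : open (U i). Proof. by have [[_ _ _ H _] _ _ _ _] := Hflrw; have [] := H i. Qed.
Let msmooth i k l : smooth (U i) (fun x => @metric R 3 Sigma h i x k l).
Proof. by have [_ [H _ _] _ _ _] := Hflrw; exact: H. Qed.
Let msym i x : U i x -> (@metric R 3 Sigma h i x)^T = @metric R 3 Sigma h i x.
Proof. by have [_ [_ H _] _ _ _] := Hflrw; move=> /(H i)[]. Qed.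
Let mpos i x : U i x -> forall u, u != 0 -> 0 < inner (@metric R 3 Sigma h i) x u u.
Proof. by have [_ [_ H _] _ _ _] := Hflrw; move=> /(H i)[]. Qed.
Let munit i x (Ux : U i x) : @metric R 3 Sigma h i x \in unitmx := posdef_unitmx (mpos Ux).
Let mcurv i x : U i x -> forall u v, plane_area2 (@metric R 3 Sigma h i) x u v != 0 ->
  sectional_curvature (@metric R 3 Sigma h i) x u v = kappa.
Proof. by have [_ _ H _ _] := Hflrw; exact: H. Qed.
Let asmooth : smooth1 `]0, +oo[ a. Proof. by have [] := Hflrw. Qed.
Let apos (t : R) : 0 < t -> 0 < a t. Proof. by have [_ _ _ _ [H _]] := Hflrw; exact: H. Qed.

Let oD : open D. Proof. by have [[[]]] := Hgeo. Qed.
Lemma geodesic_domain_interval : is_interval D. Proof. by have [[[]]] := Hgeo. Qed.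
Let in_chart s : D s -> exists i : chart_index A, @dom _ _ _ A i (gamma s).
Proof. by have [[[_ _ H _ _] _] _ _ _] := Hgeo; exact: H. Qed.

Lemma geodesic_time_gt0 s : D s -> 0 < T s.
Proof. by move=> /in_chart[i []]. Qed.

Lemma chart_time i s : lsubmx (X i s) 0 0 = T s.
Proof. by rewrite /= row_mxKl mxE eqxx. Qed.

Lemma chart_split_domain i s : at_chart i s -> split_domain (U i) (X i s).
Proof.
move=> [_ [t0 di]]; split; first by rewrite chart_time.
by rewrite /= row_mxKr; exists (gamma s).2.
Qed.

Lemma near_chart i s : at_chart i s -> \forall r \near s, at_chart i r.
Proof.
move=> [Ds [t0 di]]; have [[[_ _ _ cg _] _] _ _ _] := Hgeo.
have [[_ _ _ H _] _ _ _ _] := Hflrw; have [od _ _ _ _] := H i.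
have c1 : (gamma r).1 @[r --> s] --> (gamma s).1.
  by apply: (cvg_comp _ _ (cg s Ds)); exact: cvg_fst.
have c2 : (gamma r).2 @[r --> s] --> (gamma s).2.
  by apply: (cvg_comp _ _ (cg s Ds)); exact: cvg_snd.
have n1 : \forall r \near s, 0 < (gamma r).1.
  by apply: (c1 [set t | 0 < t]); apply: open_nbhs_nbhs; split => //; exact: open_gt.
have n2 : \forall r \near s, @dom _ _ _ h i (gamma r).2.
  by apply: (c2 (@dom _ _ _ h i)); apply: open_nbhs_nbhs; split.
have n0 := open_nbhs_nbhs (conj oD Ds).
by apply: filterS3 n0 n1 n2 => r u v w; split.
Qed.

Lemma chart_derive i s : at_chart i s ->
  is_derive s (1 : R) (fun r => X i r) (vel i s).
Proof.
move=> Hs; have [[[_ _ _ _ sm] _] _ _ _] := Hgeo.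
rewrite /velocity derive1E; apply: derivableP; exact: (sm i 0%N s Hs).
Qed.

Lemma velocity_derivable i s : at_chart i s -> derivable (vel i) s 1.
Proof. by move=> Hs; have [[[_ _ _ _ sm] _] _ _ _] := Hgeo; exact: (sm i 1%N s Hs). Qed.

Lemma time_derive_chart i s : at_chart i s -> is_derive s (1 : R) T (vel i s 0 Tx).
Proof.
move=> Hs; have H := is_derive_coord Tx (chart_derive Hs).
suff <- : (fun r => X i r 0 Tx) = T by [].
by apply/funext => r; rewrite -lsubmxE chart_time.
Qed.

Lemma time_derive s : D s ->
  is_derive s (1 : R) T (Num.sqrt (C - epsn * a (T s) ^+ 2) / a (T s)).
Proof.
move=> Ds; have [_ _ _ H] := Hgeo; rewrite -H// derive1E.
have [i di] := in_chart Ds; have [HT _] := time_derive_chart (conj Ds di).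
exact: derivableP.
Qed.

Lemma velocity_norm i s : at_chart i s -> inner (G i) (X i s) (vel i s) (vel i s) = epsn.
Proof. by have [_ H _ _] := Hgeo; exact: H. Qed.

Lemma velocity_constant i s : at_chart i s ->
  a (lsubmx (X i s) 0 0) ^+ 2 * (a (lsubmx (X i s) 0 0) ^+ 2 *
   inner (@metric R 3 Sigma h i) (rsubmx (X i s)) (rsubmx (vel i s)) (rsubmx (vel i s))) = C.
Proof.
move=> Hs; have [_ _ H _] := Hgeo; rewrite chart_time -[RHS](H i s Hs); congr (_ * _).
rewrite /spatial_inner innerE mulr_sumr; apply: eq_bigr => j _; rewrite mulr_sumr.
apply: eq_bigr => k _; rewrite [metric i _ _ _]warped_metric_SS chart_time.
by rewrite ![rsubmx (vel i s) 0 _]mxE !mulrA.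
Qed.

Lemma null_jacobi_system s2 (B : R -> 'M[R]_2) : epsn = 0 ->
  null_jacobi_tensor a h D gamma s2 B -> forall k l s, D s ->
  is_derive s (1 : R) (fun r => B r k l) (derive1 B s k l) /\
  is_derive s (1 : R) (fun r => derive1 B r k l) (- tc s * B s k l).
Proof.
move=> e0 [E [Rb [[_ Eorth Efree _] Etidal Bsmooth Beq _]]] k l s Ds.
have [i di] := in_chart Ds; have Hs : at_chart i s by [].
(* Both matrices represent the tidal operator modulo the velocity. The coefficients of their
   difference form a row [v] killed by the independent rows vel, E_1, E_2, hence [v] is 0. *)
have RbE : Rb s = (tc s)%:M.
  apply/matrixP => q r; rewrite [RHS]mxE.
  have /sub_rVP[al Hal] := tidal_null (@oU i) (@msmooth i) (@msym i) (@mpos i) (@mcurv i)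
    apos asmooth (chart_split_domain Hs) (velocity_norm Hs) (velocity_constant Hs) e0 C0
    (Eorth r i s Hs).
  have /sub_rVP[be Hbe] := Etidal r i s Hs.
  rewrite chart_time in Hal.
  have comb : \sum_(k < 2) ((k == r)%:R * tc s - Rb s k r) *: E k i s = (be - al) *: vel i s.
    rewrite scalerBl -Hbe -Hal.
    rewrite [Y in Y - _ - _](_ : _ = curvature (G i) (X i s) (E r i s) (vel i s) (vel i s))//.
    have alg (x y z : 'rV[R]_(1 + 3)) : x - y - (x - z) = z - y.
      by rewrite opprB addrC addrA subrK.
    rewrite alg.
    under eq_bigr do rewrite scalerBl; rewrite sumrB; congr (_ - _).
    rewrite (bigD1 r)//= eqxx mul1r big1 ?addr0// => j /negPf ->.
    by rewrite mul0r scale0r.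
  pose v : 'rV[R]_(1 + 2) := row_mx (al - be)%:M (\row_k ((k == r)%:R * tc s - Rb s k r)).
  have v0 : v *m col_mx (vel i s) (\matrix_(k < 2) E k i s) = 0.
    rewrite mul_row_col mul_scalar_mx mulmx_sum_row.
    under eq_bigr do rewrite mxE rowK.
    by rewrite comb -scalerDl addrC subrKA subrr scale0r.
  have /row_freeP[N HN] := Efree i s Hs.
  have : v = 0 by rewrite -[v]mulmx1 -HN mulmxA v0 mul0mx.
  move=> /(congr1 (fun w : 'rV[R]_(1 + 2) => rsubmx w 0 q)).
  rewrite /v row_mxKr !mxE => /eqP; rewrite subr_eq0 => /eqP <-.
  by rewrite mulr_natl.
have H0 : is_derive s (1 : R) B (derive1 B s).
  by rewrite derive1E; apply: derivableP; exact: (Bsmooth 0%N s Ds).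
have H1 : is_derive s (1 : R) (derive1 B) (derive1n 2 B s).
  have -> : derive1n 2 B s = 'D_1 (derive1 B) s := derive1E (derive1 B) s.
  by apply: derivableP; exact: (Bsmooth 1%N s Ds).
split; first exact: is_derive_entry.
apply: (is_derive_eq (is_derive_entry k l H1)).
have -> : derive1n 2 B s = - (Rb s *m B s) by apply/eqP; rewrite -addr_eq0 Beq.
by rewrite RbE mul_scalar_mx !mxE mulNr.
Qed.

(** The transition maps of the product atlas fix the time coordinate. Hence the time component of a
    vector field does not depend on the chart, which makes the c_k functions on the whole
    geodesic. *)
Lemma transition_time_component (V : vfield A) i j s :
  smooth_vfield D gamma V -> at_chart i s -> at_chart j s -> V j s 0 Tx = V i s 0 Tx.
Proof.
move=> [_ Vtr] Hi Hj; have [Ds di] := Hi; have [_ dj] := Hj.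
rewrite (Vtr i j s Ds di dj).
have tE x : transition i j x = row_mx (lsubmx x 0 0)%:M
    (@chart _ _ _ h j (@param _ _ _ h i (rsubmx x))) by [].
have dtr : differentiable (transition i j) (X i s).
  apply: differentiable_coords => k; case: (time_spaceP k) => [|q].
    under eq_fun do rewrite tE row_mxEl mxE eqxx mulr1n lsubmxE.
    exact: differentiable_coord.
  under eq_fun do rewrite tE row_mxEr.
  apply: (@differentiable_comp _ _ _ _ (fun x : 'rV[R]_(1 + 3) => rsubmx x)
    (fun z => @transition R 3 Sigma h i j z 0 q)); first exact: differentiable_rsubmx.
  have [[_ _ _ _ H] _ _ _ _] := Hflrw; apply: (H i j q [::]).
  by rewrite /= row_mxKr; exists (gamma s).2 => //; split; [case: di|case: dj].
rewrite -deriveEjacobian// derive_mx; last exact: diff_derivable.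
rewrite mxE; under eq_fun do rewrite tE row_mxEl mxE eqxx mulr1n lsubmxE.
rewrite deriveE; last exact: differentiable_coord.
(* The time coordinate is a continuous linear form, hence its own differential. *)
pose f : 'rV[R]_(1 + 3) -> R := fun x => x 0 Tx.
have flin : linear f by move=> c x y; rewrite /f !mxE.
pose fL := GRing.isLinear.Build _ _ _ _ _ flin.
pose F : {linear 'rV[R]_(1 + 3) -> R} := HB.pack f fL.
have -> : (fun x : 'rV[R]_(1 + 3) => x 0 Tx) = F by [].
by rewrite diff_lin//; move=> x; exact: differentiable_continuous (differentiable_coord _ _ _).
Qed.

Lemma vfield_derive (V : vfield A) i s : smooth_vfield D gamma V -> at_chart i s ->
  is_derive s (1 : R) (V i) (derive1 (V i) s).
Proof.
move=> [HV _] Hs; rewrite derive1E; apply: derivableP; exact: (HV i 0%N s Hs).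
Qed.

Lemma covD_derive (V : vfield A) i s : smooth_vfield D gamma V -> at_chart i s ->
  is_derive s (1 : R) (covD gamma V i) (derive1 (covD gamma V i) s).
Proof.
move=> HVs Hs; have [HV _] := HVs; rewrite derive1E; apply: derivableP.
have d1 : derivable (derive1 (V i)) s 1 by exact: (HV i 1%N s Hs).
have d2 : derivable (fun r => christoffel_vec (G i) (X i r) (vel i r) (V i r)) s 1.
  apply: derivable_christoffel_vec.
  - move=> p q r; apply: (differentiable_warped_christoffel (@oU i) (@msmooth i) (@msym i)
      (@munit i) apos asmooth); exact: chart_split_domain.
  - by have [] := chart_derive Hs.
  - exact: velocity_derivable.
  - by have [] := vfield_derive HVs Hs.
exact: (derivableD d1 d2).
Qed.

Lemma inner_derive (V Z : vfield A) i s (dV dZ : 'rV[R]_(1 + 3)) : at_chart i s ->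
  is_derive s (1 : R) (V i) dV -> is_derive s (1 : R) (Z i) dZ ->
  is_derive s (1 : R) (fun r => inner (G i) (X i r) (V i r) (Z i r))
   (inner (G i) (X i s) (dV + christoffel_vec (G i) (X i s) (vel i s) (V i s)) (Z i s)
    + inner (G i) (X i s) (V i s) (dZ + christoffel_vec (G i) (X i s) (vel i s) (Z i s))).
Proof.
move=> Hs HV HZ; have Wx := chart_split_domain Hs.
have hs x : split_domain (U i) x -> (G i x)^T = G i x.
  by move=> Hx; apply: warped_metric_sym Hx; exact: msym.
have hu x : split_domain (U i) x -> G i x \in unitmx.
  by move=> Hx; apply: warped_metric_unit Hx; [exact: munit|exact: apos].
have hd x k l : split_domain (U i) x -> differentiable (fun y => G i y k l) x.
  by move=> Hx; apply: (differentiable_warped_metric (@oU i) (@msmooth i) asmooth).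
exact: (is_derive_inner (open_split_domain (@oU i)) hs hu hd Wx (chart_derive Hs) HV HZ).
Qed.

(** The vector [c] holds the frame components of the unit radial direction. The system has
    eigenvalue [tc] on the orthogonal of [c] and - a''/a on [c]. *)
Lemma timelike_jacobi_system s2 (B : R -> 'M[R]_3) : epsn = -1 -> D s2 ->
  timelike_jacobi_tensor a h D gamma s2 B ->
  exists2 c : 'I_3 -> R, \sum_k c k ^+ 2 = 1 & forall k l s, D s ->
  is_derive s (1 : R) (fun r => B r k l) (derive1 (fun r => B r k l) s) /\
  is_derive s (1 : R) (derive1 (fun r => B r k l))
    (- (tc s * B s k l + (- (a2 (T s) / a (T s)) - tc s) * (\sum_q c q * B s q l) * c k)).
Proof.
move=> eN1 Ds2 [E [J [b [[Esm E0 Eorth Epar] Jjac _ JE]]]].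
pose F (k : 'I_3) := E (lift ord0 k).
have [i2 di2] := in_chart Ds2.
(* One chart is chosen for each parameter, so that [e] below depends on the parameter alone; near
   any point it agrees with its expression in a fixed chart. *)
have [ch Hch] : {ch : R -> chart_index A & forall s, D s -> at_chart (ch s) s}.
  have ex s : exists i : chart_index A, D s -> at_chart i s.
    have [Ds|nDs] := pselect (D s); last by exists i2 => /nDs.
    by have [i di] := in_chart Ds; exists i.
  exact: choice ex.
have Fu k i s : at_chart i s -> inner (G i) (X i s) (F k i s) (vel i s) = 0.
  by move=> Hs; rewrite -(E0 i s Hs); exact: (Eorth (lift ord0 k) ord0 i s Hs).
have rC : 0 < Num.sqrt C by rewrite sqrtr_gt0.
pose e k r := F k (ch r) r 0 Tx * a (T r).
have eE k i s : at_chart i s -> e k s = F k i s 0 Tx * a (T s).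
  move=> Hs; have [Ds _] := Hs; congr (_ * _).
  exact: (transition_time_component (Esm (lift ord0 k)) Hs (Hch s Ds)).
have e_derive k s : D s -> is_derive s (1 : R) (e k) 0.
  move=> Ds; have Hs := Hch s Ds; set i := ch s in Hs; have Wx := chart_split_domain Hs.
  apply: (@near_eq_is_derive _ _ _ (fun r => F k i r 0 Tx * a (T r))).
    by apply: filterS (near_chart Hs) => r Hr; rewrite (eE k i r Hr).
  have t0 := geodesic_time_gt0 Ds.
  have Ha := is_derive_chain (scale_factor_derive asmooth t0) (time_derive_chart Hs).
  have HF := is_derive_coord Tx (vfield_derive (Esm (lift ord0 k)) Hs).
  apply: (is_derive_eq (is_derive_mul HF Ha)).
  have := Epar (lift ord0 k) i s Hs; move=> /(congr1 (fun v : 'rV[R]_(1 + 3) => v 0 Tx)).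
  rewrite /covD mxE.
  rewrite [christoffel_vec _ _ _ _ 0 Tx](christoffel_vec_T (@oU i) (@munit i) apos asmooth _ _ Wx).
  rewrite [(0 : 'rV[R]_(1 + 3)) 0 Tx]mxE chart_time => /eqP; rewrite addr_eq0 => /eqP ->.
  have := Fu k i s Hs; rewrite inner_warped chart_time.
  rewrite (innerC (rsubmx (F k i s)) _ (msym Wx.2)) => H.
  (* Parallel transport turns the derivative of [e k] into - a' g(F_k, gamma'), which is 0 by
     orthogonality. *)
  transitivity (- a1 (T s) * (- (F k i s 0 Tx * vel i s 0 Tx) + a (T s) ^+ 2 *
    inner (@metric R 3 Sigma h i) (rsubmx (X i s)) (rsubmx (vel i s)) (rsubmx (F k i s)))).
    by rewrite /F; ring.
  by rewrite H mulr0.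
have e_const k s : D s -> e k s = e k s2.
  move=> Ds; have Hint := geodesic_domain_interval.
  have [ss|ss] := leP s s2.
    by apply: constant_segment => // x xs; apply: e_derive; exact: Hint Ds Ds2 _ xs.
  apply/esym; apply: constant_segment; first exact: ltW.
  by move=> x xs; apply: e_derive; exact: Hint Ds2 Ds _ xs.
pose c k := e k s2 / Num.sqrt C.
have cE k i s : at_chart i s -> F k i s 0 Tx = c k * (Num.sqrt C / a (T s)).
  move=> Hs; have [Ds _] := Hs; rewrite /c -(e_const k s Ds) (eE k i s Hs).
  by field; rewrite !gt_eqF// apos// geodesic_time_gt0.
have sC : Num.sqrt C ^+ 2 = C by rewrite sqr_sqrtr// ltW.
have c1 : \sum_k c k ^+ 2 = 1.
  have Hs := Hch s2 Ds2; set i := ch s2 in Hs; have Wx := chart_split_domain Hs.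
  (* The squared time components of E_1, E_2, E_3 sum to (dt/dtau)^2 - 1 = C / a^2, and each
     component is c_k sqrt C / a. *)
  have := @orthonormal_time_components R (@metric R 3 Sigma h i) a (X i s2) (fun k => E k i s2)
    (fun k l => Eorth k l i s2 Hs).
  rewrite E0// (velocity_time_sqr apos Wx (velocity_norm Hs) (velocity_constant Hs)) chart_time eN1 opprK addrK.
  under eq_bigr do rewrite (cE _ i s2 Hs) exprMn.
  rewrite -mulr_suml expr_div_n sC => H; have q0 : C / a (T s2) ^+ 2 != 0.
    by rewrite gt_eqF// divr_gt0// exprn_gt0// apos// geodesic_time_gt0.
  by apply: (mulIf q0); rewrite mul1r; exact: H.
exists c => // k l s Ds.
have JB i r k' : at_chart i r -> inner (G i) (X i r) (J l i r) (F k' i r) = B r k' l.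
  move=> Hr; rewrite JE// innerDl innerZl inner_suml.
  have EE p q := Eorth p q i r Hr.
  rewrite [inner _ _ (E ord0 i r) _](EE ord0 (lift ord0 k')) /minkowski_form /= mulr0 add0r.
  rewrite (bigD1 k')//= innerZl [inner _ _ _ _](EE (lift ord0 k') (lift ord0 k')).
  rewrite /minkowski_form eqxx /= mulr1 big1 ?addr0// => q qk.
  rewrite innerZl [inner _ _ _ _](EE (lift ord0 q) (lift ord0 k')) /minkowski_form.
  by rewrite (inj_eq lift_inj) qk mulr0.
have [Jsm Jeq] := Jjac l.
have B1 i r k' : at_chart i r -> is_derive r (1 : R) (fun r => B r k' l)
    (inner (G i) (X i r) (covD gamma (J l) i r) (F k' i r)).
  move=> Hr; apply: (@near_eq_is_derive _ _ _ (fun r => inner (G i) (X i r) (J l i r) (F k' i r))).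
    by apply: filterS (near_chart Hr) => r' Hr'; rewrite JB.
  apply: (is_derive_eq (inner_derive Hr (vfield_derive Jsm Hr)
    (vfield_derive (Esm (lift ord0 k')) Hr))).
  rewrite [Y in _ + inner _ _ _ Y](Epar (lift ord0 k') i r Hr).
  by rewrite -(scale0r (F k' i r)) innerZr mul0r addr0.
have Hs := Hch s Ds; set i := ch s in Hs; have Wx := chart_split_domain Hs.
split; first by rewrite derive1E; apply: derivableP; have [] := B1 i s k Hs.
apply: (@near_eq_is_derive _ _ _ (fun r => inner (G i) (X i r) (covD gamma (J l) i r) (F k i r))).
  apply: filterS (near_chart Hs) => r Hr; rewrite derive1E.
  by apply/esym; apply: derive_val; exact: B1.
apply: (is_derive_eq (inner_derive Hs (covD_derive Jsm Hs) (vfield_derive (Esm (lift ord0 k)) Hs))).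
rewrite [Y in _ + inner _ _ _ Y](Epar (lift ord0 k) i s Hs).
rewrite -[Y in _ + inner _ _ _ Y](scale0r (F k i s)) innerZr mul0r addr0.
have -> : derive1 (covD gamma (J l) i) s + christoffel_vec (G i) (X i s) (vel i s) (covD gamma (J l) i s)
   = - 1 *: curvature (G i) (X i s) (J l i s) (vel i s) (vel i s).
  by rewrite scaleN1r; apply/eqP; rewrite -addr_eq0; apply/eqP; exact: (Jeq i s Hs.1 Hs.2).
rewrite innerZl mulN1r; congr (- _).
rewrite (tidal_inner (@oU i) (@msmooth i) (@msym i) (@mpos i) (@mcurv i) apos asmooth Wx
  (velocity_norm Hs) (velocity_constant Hs) (J l i s) eN1 (Fu k i s Hs)).
rewrite chart_time JB//; congr (_ + _).
have an : a (T s) != 0 by rewrite gt_eqF// apos// geodesic_time_gt0.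
(* As g(J, gamma') = - b, the component of J along gamma' cancels and only the entries of [B]
   remain. *)
have -> : J l i s 0 Tx + inner (G i) (X i s) (J l i s) (vel i s) * vel i s 0 Tx =
   Num.sqrt C / a (T s) * \sum_q c q * B s q l.
  have -> : inner (G i) (X i s) (J l i s) (vel i s) = - b l s.
    rewrite JE// innerDl innerZl inner_suml E0// velocity_norm// eN1 mulrN1 big1 ?addr0// => q _.
    by rewrite innerZl Fu// mulr0.
  have -> : J l i s 0 Tx = b l s * vel i s 0 Tx + \sum_q B s q l * F q i s 0 Tx.
    have entryD (v w : 'rV[R]_(1 + 3)) : (v + w) 0 Tx = v 0 Tx + w 0 Tx by rewrite mxE.
    have entryZ (d : R) (v : 'rV[R]_(1 + 3)) : (d *: v) 0 Tx = d * v 0 Tx by rewrite mxE.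
    rewrite JE// E0// entryD entryZ summxE; congr (_ + _).
    by apply: eq_bigr => q _; rewrite entryZ.
  rewrite mulNr addrAC subrr add0r mulr_sumr.
  by apply: eq_bigr => q _; rewrite (cE q i s Hs); ring.
rewrite (cE k i s Hs) /transverse_coeff eN1; move: (c k) (\sum_q _) => ck S.
move: sC an; move: (Num.sqrt C) (a (T s)) (a1 _) (a2 _) => rc b' h1 h2 <- bn.
by field.
Qed.

End FLRWGeodesics.

(** * Functions vanishing at the singularity and determinants built from them *)

Section Vanishing.
Variables (R : realType) (D : set R) (T : R -> R).
Implicit Types f g : R -> R.
Local Notation vanishes := (vanishes_at_singularity D T).

Definition bounded_at_singularity f :=
  exists M d : R, 0 < d /\ forall s, D s -> T s < d -> `|f s| <= M.

Lemma vanishes_bounded f : vanishes f -> bounded_at_singularity f.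
Proof.
move=> /(_ 1 ltr01)[d d0 H]; exists 1, d; split => // s Ds Ts; exact/ltW/H.
Qed.

Lemma bounded_cst (c : R) : bounded_at_singularity (fun=> c).
Proof. by exists `|c|, 1; split. Qed.

Lemma vanishes_add f g : vanishes f -> vanishes g -> vanishes (fun s => f s + g s).
Proof.
move=> Hf Hg e e0; have e2 : 0 < e / 2 by rewrite divr_gt0.
have [d d0 H] := Hf _ e2; have [d' d'0 H'] := Hg _ e2.
exists (Num.min d d'); first by rewrite lt_min d0.
move=> s Ds; rewrite lt_min => /andP[sd sd'].
by rewrite (le_lt_trans (ler_normD _ _))// [ltRHS]splitr ltrD ?H ?H'.
Qed.

Lemma vanishes_mul f g : bounded_at_singularity f -> vanishes g ->
  vanishes (fun s => f s * g s).
Proof.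
move=> [M [d [d0 H]]] Hg e e0; have M1 : 0 < `|M| + 1 by rewrite ltr_wpDl.
have [d' d'0 H'] := Hg _ (divr_gt0 e0 M1).
exists (Num.min d d'); first by rewrite lt_min d0.
move=> s Ds; rewrite lt_min => /andP[sd sd']; rewrite normrM.
have := H' s Ds sd'; rewrite ltr_pdivlMr// => lt_e; apply: le_lt_trans lt_e.
rewrite mulrC ler_wpM2l// (le_trans (H s Ds sd))// (le_trans (ler_norm _))// lerDl//.
Qed.

Lemma vanishes_opp f : vanishes f -> vanishes (fun s => - f s).
Proof. by move=> H e /H[d d0 Hd]; exists d => // s Ds /(Hd s Ds); rewrite normrN. Qed.

Lemma vanishes_sum (I : finType) (F : I -> R -> R) :
  (forall i, vanishes (F i)) -> vanishes (fun s => \sum_i F i s).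
Proof.
move=> H; elim: (index_enum I) => [|i r IH].
  by move=> e e0; exists 1 => // s _ _; rewrite big_nil normr0.
by under eq_fun do rewrite big_cons; exact: vanishes_add.
Qed.

(** The index type is nonempty because the empty product is 1. *)
Lemma vanishes_prod n (F : 'I_n.+1 -> R -> R) :
  (forall i, vanishes (F i)) -> vanishes (fun s => \prod_i F i s).
Proof.
elim: n F => [|n IH] F HF; first by under eq_fun do rewrite big_ord1; exact: HF.
under eq_fun do rewrite big_ord_recl.
by apply: vanishes_mul; [exact: vanishes_bounded|apply: IH].
Qed.

Lemma vanishes_det n (B : R -> 'M[R]_n.+1) :
  (forall k l, vanishes (fun s => B s k l)) -> vanishes (fun s => \det (B s)).
Proof.
move=> H; rewrite /determinant; apply: vanishes_sum => sg.
by apply: vanishes_mul; [exact: bounded_cst|exact: vanishes_prod].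
Qed.

Lemma det2 (M : 'M[R]_2) : \det M = M 0 0 * M 1 1 - M 0 1 * M 1 0.
Proof.
rewrite (expand_det_row M 0) big_ord_recl big_ord1 /cofactor !det_mx11 !mxE /=.
rewrite /bump /= expr0 expr1 mul1r mulN1r mulrN; congr (_ * M _ _ - M _ _ * M _ _); exact: val_inj.
Qed.

(* A rank one perturbation changes the determinant by terms linear in the perturbation,
   with the 2x2 minors of W as coefficients. *)
Lemma vanishes_det3 (B W : R -> 'M[R]_3) (c : 'I_3 -> R) (y : 'I_3 -> R -> R) :
  (forall s k l, B s k l = c k * y l s + W s k l) ->
  (forall l, bounded_at_singularity (y l)) ->
  (forall k l, vanishes (fun s => W s k l)) -> vanishes (fun s => \det (B s)).
Proof.
move=> BE yb Wv.
pose i0 : 'I_3 := ord0; pose i1 : 'I_3 := lift ord0 ord0; pose i2 : 'I_3 := lift ord0 (lift ord0 ord0).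
have det3 (M : 'M[R]_3) : \det M =
    M i0 i0 * (M i1 i1 * M i2 i2 - M i1 i2 * M i2 i1)
  - M i0 i1 * (M i1 i0 * M i2 i2 - M i1 i2 * M i2 i0)
  + M i0 i2 * (M i1 i0 * M i2 i1 - M i1 i1 * M i2 i0).
  rewrite (expand_det_row M i0) !big_ord_recl big_ord0 /cofactor !det2 !mxE.
  have e0 : lift i0 0 = i1 by exact: val_inj.
  have e1 : lift i0 1 = i2 by exact: val_inj.
  have f0 : lift (lift ord0 ord0 : 'I_3) 0 = i0 by exact: val_inj.
  have f1 : lift (lift ord0 ord0 : 'I_3) 1 = i2 by exact: val_inj.
  have g0 : lift (lift ord0 (lift ord0 ord0) : 'I_3) 0 = i0 by exact: val_inj.
  have g1 : lift (lift ord0 (lift ord0 ord0) : 'I_3) 1 = i1 by exact: val_inj.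
  by rewrite -/i0 ?e0 ?e1 ?f0 ?f1 ?g0 ?g1 -/i1 -/i2 /=; ring.
pose minor k k' l l' s := W s k l * W s k' l' - W s k l' * W s k' l.
have minorv k k' l l' : vanishes (minor k k' l l').
  apply: vanishes_add; first by apply: vanishes_mul; [exact: vanishes_bounded|].
  by apply: vanishes_opp; apply: vanishes_mul; [exact: vanishes_bounded|].
have term k l f : vanishes f -> vanishes (fun s => c k * (y l s * f s)).
  by move=> fv; apply: vanishes_mul; [exact: bounded_cst|exact: vanishes_mul].
have -> : (fun s => \det (B s)) = fun s => \det (W s)
  + c i0 * (y i0 s * minor i1 i2 i1 i2 s) + c i0 * (y i1 s * minor i1 i2 i2 i0 s)
  + c i0 * (y i2 s * minor i1 i2 i0 i1 s) + c i1 * (y i0 s * minor i2 i0 i1 i2 s)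
  + c i1 * (y i1 s * minor i2 i0 i2 i0 s) + c i1 * (y i2 s * minor i2 i0 i0 i1 s)
  + c i2 * (y i0 s * minor i0 i1 i1 i2 s) + c i2 * (y i1 s * minor i0 i1 i2 i0 s)
  + c i2 * (y i2 s * minor i0 i1 i0 i1 s).
  by apply/funext => s; rewrite !det3 !BE /minor; ring.
by do 9 ![apply: vanishes_add; last exact: term]; exact: vanishes_det.
Qed.

Lemma vanishes_cvg (tau : R -> R) (t2 : R) f : 0 < t2 ->
  (forall t, 0 < t <= t2 -> D (tau t) /\ T (tau t) = t) -> vanishes f ->
  f (tau t) @[t --> 0^'+] --> (0 : R).
Proof.
move=> t20 Htau fv; apply/cvgrPdist_lt => e e0; have [d d0 Hd] := fv e e0.
near=> t; rewrite sub0r normrN.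
have t0 : 0 < t <= t2.
  by apply/andP; split; near: t; [exact: nbhs_right_gt|exact: nbhs_right_le].
have [Dt Tt] := Htau t t0; apply: Hd => //; rewrite Tt.
by near: t; exact: nbhs_right_lt.
Unshelve. all: by end_near. Qed.

End Vanishing.

(** * Decoupling of the timelike system and conclusion *)

Unset Implicit Arguments.

Theorem mainTheorem3 (R : realType) (eps kappa : R) (a : R -> R)
    (Sigma : topologicalType) (h : metric_atlas R 3 Sigma)
    (eps_gt0 : 0 < eps)
    (Hflrw : flrw a h kappa)
    (Ha : exists2 delta : R, 0 < delta < 1 &
            forall t : R, 0 < t < delta -> a t = - (t `^ eps^-1 * ln t))
    (Hcase : (0 < eps < 1 /\ 0 < kappa) \/ (1 <= eps \/ kappa = 0)) :
  (forall C : R, 0 < C -> exists t1 : R,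
    [/\ 0 < t1,
        (\int[lebesgue_measure]_(s in `[t, t1])
           (a s * \int[lebesgue_measure]_(r in `[s, t1]) bracket a kappa r))
          @[t --> 0^'+] --> -oo &
        exists2 l : R, 0 <= l &
          (\int[lebesgue_measure]_(s in `[t, t1]) Num.max (f_fun a kappa C s) 0)
            @[t --> 0^'+] --> l]) /\
  (forall (D : set R) (gamma : R -> R * Sigma) (tau : R -> R) (epsn C t2 : R),
    epsn = 0 \/ epsn = -1 -> 0 < C -> 0 < t2 ->
    flrw_geodesic a h D gamma epsn C ->
    time_parametrization D gamma tau t2 ->
    exists2 t' : R, 0 <= t' < t2 & conjugate a h D gamma epsn tau t2 t').
Proof.
have p0 : 0 < eps^-1 by rewrite invr_gt0.
have ck : 0 <= kappa \/ eps^-1 <= 1.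
  case: Hcase => [[_ k0]|[e1|->]]; [left; exact: ltW|right|by left].
  by rewrite invf_le1.
have [_ _ _ asm [apos _]] := Hflrw.
have aD (t : R) : 0 < t -> is_derive t (1 : R) a (derive1 a t) by exact: scale_factor_derive.
have aD2 (t : R) : 0 < t -> is_derive t (1 : R) (derive1 a) (derive1n 2 a t).
  exact: scale_factor_derive2.
split; first by move=> C C0; exact: divergence_and_positive_part p0 Ha apos asm ck C C0.
move=> D gamma tau epsn C t2 He C0 t20 Hgeo Htau; pose T s := (gamma s).1.
have epsn0 : epsn <= 0 by case: He => ->; rewrite ?oppr_le0.
have Dint : is_interval D := geodesic_domain_interval Hgeo.
have T0 s : D s -> 0 < T s by exact: geodesic_time_gt0 Hgeo s.
have T_derive s : D s ->
    is_derive s (1 : R) T (Num.sqrt (C - epsn * a (T s) ^+ 2) / a (T s)).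
  exact: time_derive Hgeo s.
have T_small d : 0 < d -> exists2 s, D s & T s < d.
  (* The domain reaches the singularity through [tau]: this time lies in ]0, t2] and below [d]. *)
  move=> d0; pose t := Num.min t2 (d / 2).
  have t0 : 0 < t <= t2 by rewrite lt_min t20 divr_gt0//= ge_min lexx.
  have [Dt Tt] := Htau t t0; exists (tau t) => //; rewrite /T Tt gt_min.
  by rewrite [d / 2 < d]ltr_pdivrMr// ltr_pMr// ltr1n orbT.
have a_to0 e : 0 < e -> \forall t \near 0^'+, a t < e := near_scale_factor_lt p0 Ha (e := e).
have van Y Y1 : (forall s, D s -> is_derive s (1 : R) Y (Y1 s)) ->
    (forall s, D s -> is_derive s (1 : R) Y1 (- transverse_coeff a C epsn kappa (T s) * Y s)) ->
    vanishes_at_singularity D T Y.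
  move=> HY HY1; case: Hcase => [[_ k0]|[e1|k0]].
  - exact: (transverse_vanish_pos Dint apos aD aD2 C0 epsn0 T0 T_derive HY HY1 T_small a_to0 k0).
  - have p1 : eps^-1 <= 1 by rewrite invf_le1.
    exact: (transverse_vanish_log Dint apos aD aD2 C0 epsn0 T0 T_derive HY HY1 T_small
      (near_scale_factor_ge Ha p1) (near_scale_factor_log p0 Ha)).
  - exact: (transverse_vanish_flat Dint apos aD aD2 C0 epsn0 T0 T_derive HY HY1 T_small a_to0
      (scale_factor_nondecreasing_near p0 Ha aD) k0).
exists 0; first by rewrite lexx.
split=> [eN1 B HB|e0 B HB]; (split=> [|_]; first by rewrite ltxx); last first.
  apply: (@vanishes_cvg R D T tau t2 (fun s => \det (B s)) t20 Htau).
  have sys := null_jacobi_system Hflrw Hgeo C0 e0 HB.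
  apply: vanishes_det => k l.
  by apply: (van _ (fun s => derive1 B s k l)) => s Ds; have [H1 H2] := sys k l s Ds.
apply: (@vanishes_cvg R D T tau t2 (fun s => \det (B s)) t20 Htau).
have Ds2 : D (tau t2) by have [] := Htau t2; rewrite // t20 lexx.
have [c c1 sys] := timelike_jacobi_system Hflrw Hgeo C0 eN1 Ds2 HB.
(* The radial part of column [l]; what remains, B - c y, solves the transverse equation entry by
   entry. *)
pose y l s := \sum_q c q * B s q l.
pose y1 l s := \sum_q c q * derive1 (fun r => B r q l) s.
have y_derive l s : D s -> is_derive s (1 : R) (y l) (y1 l s).
  move=> Ds; apply: is_derive_big => q; apply: is_derive_scale.
  by have [] := sys q l s Ds.
have y1_derive l s : D s -> is_derive s (1 : R) (y1 l) (derive1n 2 a (T s) / a (T s) * y l s).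
  move=> Ds; set k1 := derive1n 2 a (T s) / a (T s).
  pose tc := transverse_coeff a C epsn kappa (T s).
  have H : is_derive s (1 : R) (y1 l)
      (\sum_q c q * - (tc * B s q l + (- k1 - tc) * y l s * c q)).
    by apply: is_derive_big => q; apply: is_derive_scale; have [] := sys q l s Ds.
  apply: (is_derive_eq H).
  (* Since [c] is a unit vector, the two occurrences of [tc] cancel and [y l] satisfies the radial
     equation. *)
  rewrite (eq_bigr (fun q => - tc * (c q * B s q l) + (k1 + tc) * y l s * c q ^+ 2)).
    by rewrite big_split -!mulr_sumr c1 -/(y l s) /=; ring.
  by move=> q _; ring.
apply: (@vanishes_det3 R D T B (fun s => \matrix_(k, l) (B s k l - c k * y l s)) c y).
- by move=> s k l; rewrite mxE addrC subrK.
- move=> l; exact: (radial_bounded Dint apos aD aD2 C0 epsn0 T0 T_derive eN1 (y_derive l)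
    (y1_derive l) T_small a_to0).
move=> k l; under eq_fun do rewrite mxE.
apply: (van _ (fun s => derive1 (fun r => B r k l) s - c k * y1 l s)) => s Ds.
  have [H _] := sys k l s Ds.
  exact: is_derive_sub H (is_derive_scale (c k) (y_derive l s Ds)).
have [_ H] := sys k l s Ds.
apply: (is_derive_eq (is_derive_sub H (is_derive_scale (c k) (y1_derive l s Ds)))).
by rewrite -/(y l s); ring.
Qed.
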